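(* Let $(\tilde u,\tilde\rho)\in H^1(\mathbb S)\times H^0(\mathbb S)$ be any initial data satisfying $\|\tilde u_x\|^2+\|\tilde\rho\|^2=4$ and $\tilde u(0)=0$. For $(t,x)\in[0,\infty)\times\mathbb S$ define $$\varphi(t,x)=\int_0^x\left\{\Big(\cos t+\frac{\tilde u_x(y)}2\sin t\Big)^2+\frac{\tilde\rho(y)^2}{4}\sin^2t\right\}dy,\qquad \varrho(t,x)=\tilde\rho(x)\int_0^t\frac{\chi_{\{\varphi_x(s,\cdot)>0\}}(x)}{\varphi_x(s,x)}\,ds .$$ Then the pair $(u,\rho)$ defined by $$u(t,\varphi(t,x))=\varphi_t(t,x),\qquad \rho(t,\varphi(t,x))=\varrho_t(t,x),\qquad (t,x)\in[0,\infty)\times\mathbb S,$$ constitutes a global weak solution of the two-component Hunter-Saxton system $$u_{txx}+u\,u_{xxx}+2u_xu_{xx}=\rho\rho_x,\qquad \rho_t+(u\rho)_x=0,\qquad t>0,\ x\in\mathbb S,$$ with initial data $(\tilde u,\tilde\rho)$. It furthermore holds that, for $t\ge0$, $$|||(u(t,\cdot),\rho(t,\cdot))|||_{\mathbb A}^2=\begin{cases}|||(\tilde u,\tilde\rho)|||_{\mathbb A}^2,&\sin t=0,\\[1mm] |||(\tilde u,\tilde\rho)|||_{\mathbb A}^2-\dfrac1{\sin^2t}\,\lambda\big(\{\tilde u_x=-2\cot t\}\cap\{\tilde\rho=0\}\big),&\sin t\neq0.\end{cases}$$ This solution is conservative in the sense that $$\|u_x(t,\cdot)\|^2+\|\rho(t,\cdot)\|^2=\|\tilde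 u_x\|^2+\|\tilde\rho\|^2\qquad\text{for a.e. }t\in[0,\infty).$$
   Context: $\mathbb S=\mathbb R/\mathbb Z$, identified with $[0,1]$ with endpoints glued; $H^k(\mathbb S)$, $k\ge0$, is the Hilbert space of (equivalence classes of) functions $\mathbb S\to\mathbb R$ which, together with their derivatives up to order $k$, are square-integrable; $\|\cdot\|$ is the norm of $H^0(\mathbb S)=L^2(\mathbb S)$; $\lambda$ is Lebesgue measure on $\mathbb S$, $\chi_E$ is the indicator function of $E$, and $\{h>0\}$ abbreviates $\{x\in\mathbb S:h(x)>0\}$ (similarly for other conditions). The integrand in the definition of $\varrho$ is taken to be $0$ where $\varphi_x(s,x)=0$, and $\varrho(t,x)=0$ where $\tilde\rho(x)=0$. The energy norm is $|||(u,\rho)|||_{\mathbb A}=\frac12\sqrt{\|u_x\|^2+\|\rho\|^2}$. Definition (weak solution). A pair $(u,\rho):[0,\infty)\times\mathbb S\to\mathbb R^2$ is a global weak solution (also called a global conservative solution) of the system with initial data $(\tilde u,\tilde\rho)\in H^1(\mathbb S)\times H^0(\mathbb S)$ if: (a) for each $t\in[0,\infty)$, the map $x\mapsto u(t,x)$ is in $H^1(\mathbb S)$; (b) $u\in C([0,\infty)\times\mathbb S;\mathbb R)$ and $u(0,\cdot)=\tilde u$ pointwise on $\mathbb S$; $\rho(0,\cdot)=\tilde\rho$ a.e. on $\mathbb S$; (c) the maps $t\mapsto u_x(t,\cdot)$ and $t\mapsto\rho(t,\cdot)$ belong to the space $L^\infty([0,\infty);H^0(\mathbb S))$; (d) the map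 $t\mapsto u(t,\cdot)$ is absolutely continuous from $[0,\infty)$ to $H^0(\mathbb S)$ and satisfies $$u_t+uu_x=\frac12\left\{\int_0^x(u_x^2+\rho^2)\,dy-x\int_{\mathbb S}(u_x^2+\rho^2)\,dy\right\}\quad\text{in }H^0(\mathbb S)\text{ for a.e. }t\in[0,\infty);$$ and the map $t\mapsto\rho(t,\cdot)$ satisfies $$\rho_t+(u\rho)_x=0\quad\text{in }H^0(\mathbb S)\text{ for a.e. }t\in[0,\infty).$$
   Formalization: The equation ρ_t+(uρ)_x=0 is stated for a.e. t in H^{-1}(S), with ρ_t the derivative in H^{-1} norm, not in H^0(S): for ũ=0 and ρ̃ a step function with values √2, √6, ρ has a moving jump and neither term lies in H^0(S). *)

(* Defs.v *)
From mathcomp Require Import all_boot all_order all_algebra.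
From mathcomp Require Import all_classical all_reals all_analysis.
Import Order.TTheory GRing.Theory Num.Theory numFieldNormedType.Exports.

Set Implicit Arguments.
Unset Strict Implicit.
Unset Printing Implicit Defensive.

Local Open Scope classical_set_scope.
Local Open Scope ring_scope.

Notation leb := lebesgue_measure.

(* The circle R/Z, seen as [0, 1] with its endpoints glued.  A function on the
   circle is an f : R -> R of which only the values on [0, 1] matter; when its
   pointwise values matter, f 0 = f 1 is required as well. *)
Definition circle (R : realType) : set R := `[0, 1]%classic.
Arguments circle {R}.

Section Spaces.
Context {R : realType}.
Implicit Types (f g psi : R -> R) (F : R -> R -> R) (t : R).

Definition ae_eq_circle f g : Prop :=
  {ae leb, forall x : R, circle x -> f x = g x}.

Definition continuous_circle f : Prop :=
  {within circle, continuous f} /\ f 0 = f 1.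

(* Elements of H^0 = L^2 are given by Borel representatives. *)
Definition in_H0 f : Prop :=
  measurable_fun circle f /\
  leb.-integrable circle (fun x => (f x ^+ 2)%:E).

(* Only meaningful on H^0, since the real-valued integral of a function with
   infinite integral is 0; below it is always applied to elements of H^0. *)
Definition norm_H0 f : R := Num.sqrt (\int[leb]_(x in circle) f x ^+ 2).

(* Test functions: 1-periodic and of class C^1 on R, that is, C^1(R/Z). *)
Definition C1_circle psi : Prop :=
  [/\ forall x, psi (x + 1) = psi x,
      forall x, derivable psi x 1 & continuous psi^`()%classic].

Definition norm_H1 psi : R :=
  Num.sqrt (norm_H0 psi ^+ 2 + norm_H0 psi^`()%classic ^+ 2).

(* The distributional derivative of f on the circle (no boundary terms, as the
   test functions are periodic). *)
Definition distr_deriv f psi : R :=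
  - \int[leb]_(x in circle) (f x * psi^`()%classic x).

Definition weak_deriv f g : Prop :=
  forall psi, C1_circle psi ->
    \int[leb]_(x in circle) (g x * psi x) = distr_deriv f psi.

Definition in_H1 f : Prop :=
  in_H0 f /\ exists g, in_H0 g /\ weak_deriv f g.

(* f_x for f in H^1: a representative of the weak derivative. *)
Definition wderiv f : R -> R :=
  xget (fun=> 0) [set g | in_H0 g /\ weak_deriv f g].

Definition energy_norm f g : R :=
  2^-1 * Num.sqrt (norm_H0 (wderiv f) ^+ 2 + norm_H0 g ^+ 2).

(* Maps F from [0, +oo[ to H^0 are curried: F t is the function F(t, .). *)

Definition simple_H0 F : Prop :=
  exists (k : nat) (A : 'I_k -> set R) (f : 'I_k -> R -> R),
    (forall i, measurable (A i) /\ in_H0 (f i)) /\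
    forall t x, F t x = \sum_(i < k) \1_(A i) t * f i x.

(* Bochner (strong) measurability. *)
Definition strongly_measurable_H0 F : Prop :=
  exists s : nat -> R -> R -> R, (forall n, simple_H0 (s n)) /\
    {ae leb, forall t : R, 0 <= t ->
      norm_H0 (fun x => s n t x - F t x) @[n --> \oo] --> (0 : R)}.

Definition in_Linfty_H0 F : Prop :=
  [/\ forall t, 0 <= t -> in_H0 (F t),
      strongly_measurable_H0 F &
      exists M : R, {ae leb, forall t : R, 0 <= t -> norm_H0 (F t) <= M}].

Definition abs_continuous_H0 F : Prop :=
  (forall t, 0 <= t -> in_H0 (F t)) /\
  forall e : R, 0 < e -> exists2 d : R, 0 < d &
    forall (n : nat) (a b : 'I_n -> R),
      (forall i, 0 <= a i <= b i) ->
      (forall i j, i != j -> b i <= a j \/ b j <= a i) ->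
      \sum_(i < n) (b i - a i) < d ->
      \sum_(i < n) norm_H0 (fun x => F (b i) x - F (a i) x) < e.

(* g is the derivative of F at t, in the norm of H^0. *)
Definition is_deriv_H0 F t g : Prop :=
  in_H0 g /\
  norm_H0 (fun x => h^-1 * (F (t + h) x - F t x) - g x) @[h --> 0^'] --> (0 : R).

(* The functional L is the derivative of F at t in the norm of
   H^{-1} = (H^1)^*; the dual norm is computed on the dense subspace C^1. *)
Definition is_deriv_Hm1 F t (L : (R -> R) -> R) : Prop :=
  forall e : R, 0 < e -> \forall h \near 0^', forall psi, C1_circle psi ->
    `|\int[leb]_(x in circle) (h^-1 * (F (t + h) x - F t x) * psi x) - L psi|
      <= e * norm_H1 psi.

(* l is the derivative at t of f : [0, +oo[ -> R (one-sided at t = 0). *)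
Definition is_tderiv f t (l : R) : Prop :=
  (s - t)^-1 * (f s - f t)
    @[s --> within [set s : R | 0 <= s] t^'] --> l.

End Spaces.

Section HunterSaxton.
Context {R : realType}.
Implicit Types u rho : R -> R -> R.

(* The first equation of the system at time t, in H^0. *)
Definition eq_u u rho (t : R) : Prop :=
  let e (y : R) := wderiv (u t) y ^+ 2 + rho t y ^+ 2 in
  exists ut : R -> R, is_deriv_H0 u t ut /\
    ae_eq_circle (fun x => ut x + u t x * wderiv (u t) x)
      (fun x => 2^-1 * (\int[leb]_(y in `[0, x]) e y
                        - x * \int[leb]_(y in circle) e y)).

(* The second equation at time t.  For rho(t, .) in H^0 only, neither rho_t nor
   (u rho)_x is in H^0 in general; both are in H^{-1}, and their sum is 0. *)
Definition eq_rho u rho (t : R) : Prop :=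
  exists rhot : (R -> R) -> R, is_deriv_Hm1 rho t rhot /\
    forall psi, C1_circle psi ->
      rhot psi + distr_deriv (fun x => u t x * rho t x) psi = 0.

Record weak_solution (u0 rho0 : R -> R) u rho : Prop := WeakSolution {
  ws_H1 : forall t, 0 <= t -> in_H1 (u t);
  ws_continuous :
    {within [set p : R * R | 0 <= p.1 /\ circle p.2],
       continuous (fun p : R * R => u p.1 p.2)};
  ws_glued : forall t, 0 <= t -> u t 0 = u t 1;
  ws_init_u : forall x, circle x -> u 0 x = u0 x;
  ws_init_rho : ae_eq_circle (rho 0) rho0;
  ws_Linfty_ux : in_Linfty_H0 (fun t => wderiv (u t));
  ws_Linfty_rho : in_Linfty_H0 rho;
  ws_abs_continuous : abs_continuous_H0 u;
  ws_eq_u : {ae leb, forall t : R, 0 <= t -> eq_u u rho t};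
  ws_eq_rho : {ae leb, forall t : R, 0 <= t -> eq_rho u rho t} }.

Definition phi (u0 rho0 : R -> R) (t x : R) : R :=
  \int[leb]_(y in `[0, x])
    ((cos t + wderiv u0 y / 2 * sin t) ^+ 2 + rho0 y ^+ 2 / 4 * sin t ^+ 2).

Definition phi_x (u0 rho0 : R -> R) (t x : R) : R := (phi u0 rho0 t)^`()%classic x.

(* As / 0 = 0, the integrand is 0 where phi_x is 0; and varrho is 0 where rho0
   is, even if the integral diverges, as the integral is real-valued. *)
Definition varrho (u0 rho0 : R -> R) (t x : R) : R :=
  rho0 x * \int[leb]_(s in `[0, t])
    (\1_[set y | 0 < phi_x u0 rho0 s y] x / phi_x u0 rho0 s x).

(* u(t, phi) = phi_t everywhere and, for each t, rho(t, phi) = varrho_t almost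
   everywhere: rho(t, .) is an L^2 class, and so are the data defining varrho. *)
Definition defines_pair (u0 rho0 : R -> R) u rho : Prop :=
  [/\ forall t x, 0 <= t -> circle x ->
        is_tderiv (phi u0 rho0 ^~ x) t (u t (phi u0 rho0 t x)),
      forall t, 0 <= t -> measurable_fun circle (rho t) &
      forall t, 0 <= t -> {ae leb, forall x : R, circle x ->
        is_tderiv (varrho u0 rho0 ^~ x) t (rho t (phi u0 rho0 t x))}].

End HunterSaxton.

(* Main.v *)
(* Write g = u0', r = rho0 and w(t, y) = (cos t + g/2 sin t)^2 + (r/2 sin t)^2. The
   flow phi(t, .) is the primitive of w(t, .), a nondecreasing surjection of [0, 1]
   that pushes w dx forward to Lebesgue measure; up to a null set it is injective
   where w > 0. With v = w_t one has u_x = v/w and rho = r/w along the flow, and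
   v^2 + r^2 = 4 w k with k = 1 + (g^2 + r^2)/4 - w, so both v and r vanish where w
   does. Hence the energy at time t is 4 minus the integral of 4 k over {w = 0},
   which is 4 leb {w = 0} / sin^2 t. The sets {w(t, .) = 0} are disjoint for times
   closer than pi, so all but countably many of them are null.

   In Lagrangian coordinates the integrals of u, u_x and rho against a smooth test
   function are C^1 in time, and w_tt = 2 (k - w) turns their derivatives into the
   weak form of the equations. So u_x and rho are weakly continuous in L^2; at a
   time of full energy weak continuity becomes norm continuity, and u_t and rho_t
   then exist in L^2 and in the dual of H^1 respectively. *)
From HB Require Import structures.
Require Import Defs.
From mathcomp Require Import all_boot all_order all_algebra.
From mathcomp Require Import all_classical all_reals all_analysis measurable_realfun.
From mathcomp Require Import ring lra.
Import Order.TTheory GRing.Theory Num.Theory numFieldNormedType.Exports.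
Local Open Scope classical_set_scope.
Local Open Scope ring_scope.
Set Implicit Arguments.
Unset Strict Implicit.
Unset Printing Implicit Defensive.

(** The map [Phi t] need be neither injective nor smooth, so the substitution rule is obtained at
    the level of measures: the image of [w dx] and Lebesgue measure agree on rays. For the same
    reason [u] and [rho] cannot be written with an inverse of the flow. The estimate [|Vel y - Vel
    x| <= 2 sqrt |Phi y - Phi x|] makes [u] well defined and Hoelder continuous; [rho] and [u_x] are
    built with a monotone, hence measurable, section of the flow. Total energy 4 is the
    normalisation that gives [w] mean 1 at all times, so that the flow maps [0, 1] onto itself
    without rescaling. The equation for [u] is established only at times of full energy, whereas
    mean value points of the test integrals may fall anywhere. What saves the argument is that the
    time derivative of a test integral is continuous at every time: bounds that hold almost
    everywhere extend to all times, and duality with continuous functions turns them into bounds in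
    L^2. *)

Local Notation intc f := (leb.-integrable circle (EFin \o f)).
Local Notation "'\oint' f" := (Rintegral leb circle f) (at level 10, f at level 9).

(** * Integration and the L2 norm on the circle *)

Section CircleIntegration.
Context {R : realType}.
Implicit Types (f g h : R -> R) (a b c e x y z M : R).

Lemma aeS (P Q : R -> Prop) : (forall x, P x -> Q x) ->
  {ae leb, forall x, P x} -> {ae leb, forall x, Q x}.
Proof. by move=> PQ; apply: filterS => //; exact: (ae_filter_ringOfSetsType leb). Qed.

Lemma aeS2 (P Q S : R -> Prop) : (forall x, P x -> Q x -> S x) ->
  {ae leb, forall x, P x} -> {ae leb, forall x, Q x} -> {ae leb, forall x, S x}.
Proof. by move=> PQ; apply: filterS2 => //; exact: (ae_filter_ringOfSetsType leb). Qed.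

Lemma aeT (P : R -> Prop) : (forall x, P x) -> {ae leb, forall x, P x}.
Proof. by move=> HP; apply: (aeW leb). Qed.

Lemma measurable_circle : measurable (@circle R).
Proof. exact: measurable_itv. Qed.
Hint Resolve measurable_circle : core.

Lemma leb_circle : leb (@circle R) = 1%E.
Proof. by rewrite /circle lebesgue_measure_itv/= lte_fin ltr01 sube0. Qed.

Lemma leb_circle_lty : (leb (@circle R) < +oo)%E.
Proof. by rewrite leb_circle ltry. Qed.

Lemma intc_meas f : intc f -> measurable_fun circle f.
Proof. by move=> /measurable_int/measurable_EFinP. Qed.

Lemma intc_le f g : measurable_fun circle f -> (forall x, circle x -> `|f x| <= g x) ->
  intc g -> intc f.
Proof.
move=> mf fg ig; apply: (le_integrable _ _ _ ig) => //; first exact/measurable_EFinP.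
by move=> x Cx; rewrite /= lee_fin (le_trans (fg x Cx))// ler_norm.
Qed.

Lemma intcD f g : intc f -> intc g -> intc (fun x => f x + g x).
Proof. move=> fi gi; exact: (integrableD _ fi gi). Qed.

Lemma intcZ c f : intc f -> intc (fun x => c * f x).
Proof. move=> fi; exact: (integrableZl _ c fi). Qed.

Lemma intcN f : intc f -> intc (fun x => - f x).
Proof. move=> fi; exact: (integrableN fi). Qed.

Lemma intcB f g : intc f -> intc g -> intc (fun x => f x - g x).
Proof. by move=> fi gi; apply: intcD => //; exact: intcN. Qed.

Lemma intc_norm f : intc f -> intc (fun x => `|f x|).
Proof. exact: integrable_norm. Qed.

Lemma intc_cst c : intc (fun=> c).
Proof.
apply: measurable_bounded_integrable => //; first exact: leb_circle_lty.
exact: bounded_cst.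
Qed.

Lemma intc_bnd f M : measurable_fun circle f -> (forall x, circle x -> `|f x| <= M) -> intc f.
Proof. by move=> mf fM; apply: (intc_le mf fM); exact: intc_cst. Qed.

Lemma intcM f h M : intc f -> measurable_fun circle h ->
  (forall x, circle x -> `|h x| <= M) -> intc (fun x => f x * h x).
Proof.
move=> fi mh hM; apply: (@intc_le _ (fun x => M * `|f x|)).
- by apply: measurable_funM => //; exact: intc_meas.
- by move=> x Cx; rewrite normrM mulrC ler_wpM2r// hM.
- exact/intcZ/intc_norm.
Qed.

Lemma oint_ae f g : measurable_fun circle f -> measurable_fun circle g ->
  ae_eq_circle f g -> \oint f = \oint g.
Proof.
move=> mf mg fg; congr fine; apply: ae_eq_integral => //; [exact/measurable_EFinP..|].
by move: fg; apply: aeS => x fgx Cx; rewrite /= fgx.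
Qed.

Lemma eq_oint f g : (forall x, circle x -> f x = g x) -> \oint f = \oint g.
Proof. by move=> fg; apply: eq_Rintegral => x /[!inE]; exact: fg. Qed.

Lemma ointD f g : intc f -> intc g -> \oint (fun x => f x + g x) = \oint f + \oint g.
Proof. by move=> *; rewrite -RintegralD. Qed.

Lemma ointB f g : intc f -> intc g -> \oint (fun x => f x - g x) = \oint f - \oint g.
Proof. by move=> *; rewrite -RintegralB. Qed.

Lemma ointZ c f : intc f -> \oint (fun x => c * f x) = c * \oint f.
Proof. by move=> *; rewrite -RintegralZl. Qed.

Lemma oint_cst c : \oint (fun=> c) = c.
Proof.
rewrite Rintegral_cst// -[RHS]mulr1; congr (_ * _).
exact: (congr1 fine leb_circle).
Qed.

Lemma le_oint f g : intc f -> intc g -> (forall x, circle x -> f x <= g x) ->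
  \oint f <= \oint g.
Proof. by move=> *; apply: le_Rintegral. Qed.

Lemma oint_ge0 f : (forall x, circle x -> 0 <= f x) -> 0 <= \oint f.
Proof. by move=> *; apply: Rintegral_ge0. Qed.

Lemma le_norm_oint f : intc f -> `|\oint f| <= \oint (fun x => `|f x|).
Proof. by move=> fi; apply: le_normr_Rintegral. Qed.

Lemma norm_oint_le f g : intc f -> intc g -> (forall x, circle x -> `|f x| <= g x) ->
  `|\oint f| <= \oint g.
Proof.
by move=> fi gi fg; apply: (le_trans (le_norm_oint fi)); apply: le_oint => //; exact: intc_norm.
Qed.

Lemma norm_oint_bnd f M : intc f -> (forall x, circle x -> `|f x| <= M) -> `|\oint f| <= M.
Proof.
by move=> fi fM; rewrite -[leRHS]oint_cst; apply: norm_oint_le => //; exact: intc_cst.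
Qed.

Lemma ae_eq_circle_comp2 (op : R -> R -> R) f f' g g' :
  ae_eq_circle f f' -> ae_eq_circle g g' ->
  ae_eq_circle (fun x => op (f x) (g x)) (fun x => op (f' x) (g' x)).
Proof. by apply: aeS2 => x ff gg Cx; rewrite ff// gg. Qed.

Lemma H0_meas f : in_H0 f -> measurable_fun circle f.
Proof. by case. Qed.

Lemma H0_sqr f : in_H0 f -> intc (fun x => f x ^+ 2).
Proof. by case. Qed.

Lemma H0M f g : in_H0 f -> in_H0 g -> intc (fun x => f x * g x).
Proof.
move=> [mf f2] [mg g2].
apply: (@intc_le _ (fun x => f x ^+ 2 + g x ^+ 2)).
- exact: measurable_funM.
- move=> x _; rewrite normrM -[f x ^+ 2]real_normK ?num_real//.
  rewrite -[g x ^+ 2]real_normK ?num_real//.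
  have := sqr_ge0 (`|f x| - `|g x|).
  have := mulr_ge0 (normr_ge0 (f x)) (normr_ge0 (g x)).
  by nra.
- exact: intcD.
Qed.

Lemma H0_bnd f M : measurable_fun circle f -> (forall x, circle x -> `|f x| <= M) -> in_H0 f.
Proof.
move=> mf fM; split=> //; apply: (@intc_bnd _ (M ^+ 2)); first exact: measurable_funX.
by move=> x Cx; rewrite normrX lerXn2r// ?nnegrE// ?fM// (le_trans _ (fM x Cx)).
Qed.

Lemma H0_cst c : in_H0 (fun=> c).
Proof. exact: (@H0_bnd _ `|c|). Qed.

Lemma H0_intc f : in_H0 f -> intc f.
Proof.
move=> /H0M - /(_ _ (H0_cst 1)) fi.
by apply: eq_integrable fi => // x _; rewrite /= mulr1.
Qed.

Lemma H0_ext f g : (forall x, circle x -> f x = g x) -> in_H0 f -> in_H0 g.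
Proof.
move=> fg [mf f2]; split; first by apply: eq_measurable_fun mf => x /[!inE]; exact: fg.
by apply: eq_integrable f2 => // x /[!inE] Cx; rewrite /= fg.
Qed.

Lemma H0D f g : in_H0 f -> in_H0 g -> in_H0 (fun x => f x + g x).
Proof.
move=> Hf Hg; split; first by apply: measurable_funD; [exact: H0_meas|exact: H0_meas].
have := intcD (intcD (H0_sqr Hf) (intcZ 2 (H0M Hf Hg))) (H0_sqr Hg).
by apply: eq_integrable => // x _ /=; congr EFin; ring.
Qed.

Lemma H0Mb f h M : in_H0 f -> measurable_fun circle h ->
  (forall x, circle x -> `|h x| <= M) -> in_H0 (fun x => f x * h x).
Proof.
move=> Hf mh hM; split; first by apply: measurable_funM => //; exact: H0_meas.
have mh2 : measurable_fun circle (fun x => h x ^+ 2) by exact: measurable_funX.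
have := @intcM _ _ (M ^+ 2) (H0_sqr Hf) mh2.
have -> : (fun x => f x ^+ 2 * h x ^+ 2) = (fun x => (f x * h x) ^+ 2).
  by apply/funext => x; rewrite exprMn.
apply => x Cx.
by rewrite normrX lerXn2r// ?nnegrE// ?hM// (le_trans _ (hM x Cx)).
Qed.

Lemma H0Z c f : in_H0 f -> in_H0 (fun x => c * f x).
Proof.
move=> Hf; apply: (H0_ext (f := fun x => f x * c)); first by move=> x _; rewrite mulrC.
exact: (@H0Mb _ _ `|c|).
Qed.

Lemma H0N f : in_H0 f -> in_H0 (fun x => - f x).
Proof. by move=> /(H0Z (-1)); apply: H0_ext => x _; rewrite mulN1r. Qed.

Lemma H0B f g : in_H0 f -> in_H0 g -> in_H0 (fun x => f x - g x).
Proof. by move=> Hf Hg; apply: H0D => //; exact: H0N. Qed.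

Lemma norm_H0_ge0 f : 0 <= norm_H0 f.
Proof. exact: sqrtr_ge0. Qed.

Lemma norm_H0_sqr f : norm_H0 f ^+ 2 = \oint (fun x => f x ^+ 2).
Proof. by rewrite /norm_H0 sqr_sqrtr// oint_ge0// => x _; exact: sqr_ge0. Qed.

Lemma norm_H0_le f M : 0 <= M -> \oint (fun x => f x ^+ 2) <= M ^+ 2 -> norm_H0 f <= M.
Proof.
move=> M0; rewrite -norm_H0_sqr => h.
by rewrite -(@ler_pXn2r _ 2)// nnegrE// norm_H0_ge0.
Qed.

Lemma norm_H0_ae f g : measurable_fun circle f -> measurable_fun circle g ->
  ae_eq_circle f g -> norm_H0 f = norm_H0 g.
Proof.
move=> mf mg fg; congr Num.sqrt; apply: oint_ae; [exact: measurable_funX..|].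
by move: fg; apply: aeS => x fgx Cx; rewrite /= fgx.
Qed.

Lemma eq_norm_H0 f g : (forall x, circle x -> f x = g x) -> norm_H0 f = norm_H0 g.
Proof. by move=> fg; congr Num.sqrt; apply: eq_oint => x Cx; rewrite fg. Qed.

(* Cauchy-Schwarz, from the nonnegativity of [a ^+ 2 - 2 s c + s ^+ 2 b ^+ 2]
   for every real s *)
Lemma cauchy_schwarz f g : in_H0 f -> in_H0 g ->
  `|\oint (fun x => f x * g x)| <= norm_H0 f * norm_H0 g.
Proof.
move=> Hf Hg; set a := norm_H0 f; set b := norm_H0 g; set c := \oint _.
have q s : 0 <= a ^+ 2 - 2 * s * c + s ^+ 2 * b ^+ 2.
  have := @oint_ge0 (fun x => (f x - s * g x) ^+ 2) (fun x _ => sqr_ge0 _).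
  rewrite (@eq_oint _ (fun x => f x ^+ 2 - (2 * s) * (f x * g x) + s ^+ 2 * g x ^+ 2)); last first.
    by move=> x _; ring.
  rewrite ointD; [|exact/intcB/intcZ/H0M/Hg/Hf/H0_sqr|exact/intcZ/H0_sqr].
  rewrite ointB; [|exact: H0_sqr|exact/intcZ/H0M].
  rewrite ointZ; last exact: H0M.
  rewrite ointZ; last exact: H0_sqr.
  by rewrite -!norm_H0_sqr.
have a0 : 0 <= a := norm_H0_ge0 f.
have b0 : 0 <= b := norm_H0_ge0 g.
rewrite -(@ler_pXn2r _ 2)// ?nnegrE ?mulr_ge0// real_normK ?num_real//.
have [b00|bn0] := eqVneq b 0.
  have [->|c0] := eqVneq c 0; first by rewrite expr0n/= sqr_ge0.
  have := q ((a ^+ 2 + 1) / (2 * c)); rewrite b00 expr0n/= mulr0 addr0.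
  have -> : 2 * ((a ^+ 2 + 1) / (2 * c)) * c = a ^+ 2 + 1 by field.
  by lra.
have b2 : 0 < b ^+ 2 by rewrite exprn_gt0// lt_def bn0.
have := q (c / b ^+ 2).
have -> : a ^+ 2 - 2 * (c / b ^+ 2) * c + (c / b ^+ 2) ^+ 2 * b ^+ 2 = a ^+ 2 - c ^+ 2 / b ^+ 2.
  by field.
by rewrite subr_ge0 ler_pdivrMr// exprMn.
Qed.

Lemma norm_H0D f g : in_H0 f -> in_H0 g ->
  norm_H0 (fun x => f x + g x) <= norm_H0 f + norm_H0 g.
Proof.
move=> Hf Hg; apply: norm_H0_le; first by rewrite addr_ge0// norm_H0_ge0.
rewrite (@eq_oint _ (fun x => f x ^+ 2 + 2 * (f x * g x) + g x ^+ 2)); last first.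
  by move=> x _; ring.
rewrite ointD; [|exact/intcD/intcZ/H0M/Hg/Hf/H0_sqr|exact/H0_sqr].
rewrite ointD; [|exact: H0_sqr|exact/intcZ/H0M].
rewrite ointZ; last exact: H0M.
rewrite -!norm_H0_sqr.
by have := cauchy_schwarz Hf Hg; have := ler_norm (\oint (fun x => f x * g x)); nra.
Qed.

Lemma norm_H0Z c f : in_H0 f -> norm_H0 (fun x => c * f x) = `|c| * norm_H0 f.
Proof.
move=> Hf; rewrite -(@ger0_norm _ (norm_H0 f)) ?norm_H0_ge0// -normrM.
rewrite -[LHS](@ger0_norm _ _ (norm_H0_ge0 _)); apply/eqP.
rewrite -(@eqrXn2 _ 2)//; apply/eqP.
rewrite !real_normK ?num_real// exprMn !norm_H0_sqr -ointZ; last exact: H0_sqr.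
by apply: eq_oint => x _; rewrite exprMn.
Qed.

Lemma norm_H0N f : norm_H0 (fun x => - f x) = norm_H0 f.
Proof. by congr Num.sqrt; apply: eq_oint => x _; rewrite sqrrN. Qed.

Lemma norm_H0B f g : in_H0 f -> in_H0 g ->
  norm_H0 (fun x => f x - g x) <= norm_H0 f + norm_H0 g.
Proof. by move=> Hf Hg; rewrite -[norm_H0 g]norm_H0N; apply: norm_H0D => //; exact: H0N. Qed.

Lemma norm_H0_bnd f M : 0 <= M -> measurable_fun circle f ->
  (forall x, circle x -> `|f x| <= M) -> norm_H0 f <= M.
Proof.
move=> M0 mf fM; apply: norm_H0_le => //; rewrite -[leRHS]oint_cst.
apply: le_oint; [exact/H0_sqr/(H0_bnd mf fM)|exact: intc_cst|move=> x Cx].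
by rewrite -[f x ^+ 2]real_normK ?num_real// lerXn2r// ?nnegrE// fM.
Qed.

End CircleIntegration.
#[local] Hint Resolve measurable_circle : core.

(** * Indefinite integrals and their differentiability almost everywhere *)

Section IndefiniteIntegral.
Context {R : realType}.
Let mC : measurable (@circle R) := measurable_circle.
Hint Resolve mC : core.
Implicit Types (f g h : R -> R) (a b c e x y z M : R).

Definition indef f x : R := \int[leb]_(y in `[0, x]) f y.

Lemma circleP x : circle x <-> 0 <= x <= 1.
Proof. by rewrite /circle/= in_itv. Qed.

Lemma sub_itv_circle (a b : bool) x y : 0 <= x -> y <= 1 ->
  [set` Interval (BSide a x) (BSide b y)] `<=` (@circle R).
Proof.
move=> x0 y1 z /=; rewrite /circle/= !in_itv/= => /andP[xz zy].
have xz' : x <= z by case: a xz => // /ltW.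
have zy' : z <= y by case: b zy => // /ltW.
by rewrite (le_trans x0 xz') (le_trans zy' y1).
Qed.

Lemma intc_sub f (A : set R) : measurable A -> A `<=` circle -> intc f ->
  leb.-integrable A (EFin \o f).
Proof. by move=> mA AC; apply: integrableS => //; exact: measurable_circle. Qed.

Lemma indef0 f : indef f 0 = 0.
Proof. by rewrite /indef set_itv1 Rintegral_set1. Qed.

Lemma indef1 f : indef f 1 = \oint f.
Proof. by []. Qed.

Lemma indefB f x y : intc f -> 0 <= x -> x <= y -> y <= 1 ->
  indef f y - indef f x = \int[leb]_(z in `]x, y]) f z.
Proof.
move=> fi x0 xy y1; rewrite /indef Rintegral_itvB ?bnd_simp//.
by apply: intc_sub fi => //; exact: sub_itv_circle.
Qed.

Lemma indef_cont f : intc f -> {within circle, continuous (indef f)}.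
Proof. by move=> fi; exact: (@parameterized_integral_continuous _ 0 1). Qed.

Lemma indef_meas f : intc f -> measurable_fun circle (indef f).
Proof.
by move=> fi; apply: subspace_continuous_measurable_fun => //; exact: indef_cont.
Qed.

Lemma indefD f g x : intc f -> intc g -> circle x ->
  indef (fun y => f y + g y) x = indef f x + indef g x.
Proof.
move=> fi gi /circleP/andP[x0 x1]; rewrite /indef RintegralD//;
  by apply: intc_sub => //; exact: sub_itv_circle.
Qed.

Lemma indefZ c f x : intc f -> circle x -> indef (fun y => c * f y) x = c * indef f x.
Proof.
move=> fi /circleP/andP[x0 x1]; rewrite /indef RintegralZl//.
by apply: intc_sub => //; exact: sub_itv_circle.
Qed.

Lemma indef_cst c x : circle x -> indef (fun=> c) x = c * x.
Proof.
move=> /circleP/andP[x0 x1]; rewrite /indef Rintegral_cst//; congr (_ * _).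
transitivity (fine (leb (`[0, x]%classic : set R))); first by [].
rewrite lebesgue_measure_itv/= lte_fin; case: (ltP 0 x) => x00 /=; first by rewrite oppr0 addr0.
by apply/le_anti; rewrite x00 x0.
Qed.

Lemma eq_indef f g x : circle x -> (forall y, circle y -> f y = g y) -> indef f x = indef g x.
Proof.
move=> /circleP/andP[x0 x1] fg; apply: eq_Rintegral => y /[!inE] yx.
by apply: fg; apply: sub_itv_circle yx.
Qed.

Lemma indef_le f x y : intc f -> (forall z, circle z -> 0 <= f z) ->
  0 <= x -> x <= y -> y <= 1 -> indef f x <= indef f y.
Proof.
move=> fi f0 x0 xy y1; rewrite -subr_ge0 indefB//; apply: Rintegral_ge0 => z xzy.
by apply: f0; apply: sub_itv_circle xzy.
Qed.

(** Kept as a bound on increments because the velocity estimate needs the difference of two values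
    of [indef g], not only its total mass. *)
Lemma indef_dist f g x y : intc f -> intc g -> (forall z, circle z -> `|f z| <= g z) ->
  0 <= x -> x <= y -> y <= 1 -> `|indef f y - indef f x| <= indef g y - indef g x.
Proof.
move=> fi gi fg x0 xy y1; rewrite !indefB//.
have S := @sub_itv_circle false false x y x0 y1.
have fi' : leb.-integrable `]x, y] (EFin \o f) by exact: intc_sub fi.
apply: (le_trans (le_normr_Rintegral _ fi')) => //.
apply: le_Rintegral => //; [exact: integrable_norm|exact: intc_sub gi|].
by move=> z /S; exact: fg.
Qed.

Lemma indef_norm f x : intc f -> circle x -> `|indef f x| <= \oint (fun y => `|f y|).
Proof.
move=> fi /circleP/andP[x0 x1].
have := @indef_dist f (fun y => `|f y|) 0 x fi (intc_norm fi) (fun _ _ => lexx _) (lexx 0) x0 x1.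
rewrite !indef0 !subr0 => /le_trans; apply; rewrite -indef1.
by apply: indef_le => //; exact: intc_norm.
Qed.

(** Derivatives on R are two-sided, whereas [indef f] is governed by [f] on the circle only inside
    [0, 1]; the endpoints are therefore discarded. *)
Lemma ae_oo : {ae leb, forall x : R, circle x -> 0 < x < 1}.
Proof.
have : leb.-negligible ([set 0] `|` [set 1] : set R).
  by apply: negligibleU; apply/negligibleP; rewrite ?measurable_set1//; exact: lebesgue_measure_set1.
apply: negligibleS => x /= /not_implyP [/circleP/andP[x0 x1]] /negP.
rewrite !lt_neqAle x0 x1 !andbT negb_and !negbK => /orP[/eqP<-|/eqP ->]; first by left.
by right.
Qed.

Lemma indef_derive f : intc f ->
  {ae leb, forall x, circle x -> is_derive x 1 (indef f) (f x)}.
Proof.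
(* Extension by zero gives an integrand on the whole line; the two primitives coincide near interior
   points. *)
move=> fi; pose W := f \_ circle.
have Wi : leb.-integrable setT (EFin \o W).
  have -> : EFin \o W = (EFin \o f) \_ circle by rewrite restrict_EFin.
  by rewrite -integrable_mkcond//; exact: measurable_circle.
have Wy y : leb.-integrable [set` Interval (BLeft 0) (BRight y)] (EFin \o W).
  by apply: integrableS Wi.
have Wl : locally_integrable [set: R] W by exact: integrable_locally measurable_circle fi.
have H := FTC1 Wy Wl.
apply: aeS2 H ae_oo => x H /[apply] /andP[x0 x1].
have [|d1 d2] := H; first by rewrite lte_fin.
have dW : is_derive x 1 (indef W) (f x).
  split; first exact: d1.
  by rewrite -derive1E d2 /W patchE mem_set//; apply/circleP; rewrite !ltW.
apply: (@near_eq_is_derive _ _ _ (indef W)) => //.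
near=> y.
apply: eq_Rintegral => z /[!inE]; rewrite /= in_itv/= => /andP[z0 zy].
rewrite /W patchE mem_set//; apply/circleP; rewrite z0/= (le_trans zy)//.
by near: y; exact: lt_le_nbhsl.
Unshelve. all: by end_near. Qed.

End IndefiniteIntegral.

(** * Change of variables along a monotone map *)

Section ChangeOfVariables.
Context {R : realType} (w : R -> R).
Let mC : measurable (@circle R) := measurable_circle.
Hint Resolve mC : core.
Hypothesis wi : intc w.
Hypothesis w0 : forall x, circle x -> 0 <= w x.
Hypothesis w1 : \oint w = 1.
Local Notation phi := (indef w).

Lemma cov_nondecr x y : 0 <= x -> x <= y -> y <= 1 -> phi x <= phi y.
Proof. exact: indef_le. Qed.

Lemma cov_range x : circle x -> circle (phi x).
Proof.
move=> /circleP/andP[x0 x1]; apply/circleP.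
have := cov_nondecr (lexx 0) x0 x1; rewrite indef0 => -> /=.
by have := cov_nondecr x0 x1 (lexx 1); rewrite indef1 w1.
Qed.

Lemma cov_onto y : circle y -> exists2 x, circle x & phi x = y.
Proof.
move=> /circleP/andP[y0 y1].
have [|x] := @IVT R phi 0 1 y ler01 (indef_cont wi).
apply/andP; split.
- by rewrite indef0 indef1 w1 ge_min y0.
- by rewrite indef0 indef1 w1 le_max y1 orbT.
by move=> xC <-; exists x.
Qed.

Lemma cov_meas : measurable_fun circle phi.
Proof. exact: indef_meas. Qed.

Definition cov_measure (A : set (measurableTypeR R)) : \bar R :=
  (\int[leb]_(x in circle `&` phi @^-1` A) (w x)%:E)%E.

Let cov_measurable (A : set R) : measurable A -> measurable (circle `&` phi @^-1` A).
Proof. by move=> mA; exact: cov_meas. Qed.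

Let cov0 : cov_measure set0 = 0%E.
Proof. by rewrite /cov_measure preimage_set0 setI0 integral_set0. Qed.

Let cov_ge0 A : (0 <= cov_measure A)%E.
Proof. by apply: integral_ge0 => x [Cx _]; rewrite lee_fin w0. Qed.

Let cov_sigma : semi_sigma_additive (cov_measure : set (measurableTypeR R) -> \bar R).
Proof.
move=> A mA tA mUA.
rewrite /cov_measure preimage_bigcup setI_bigcupr ge0_integral_bigcup//=.
- apply: is_cvg_ereal_nneg_natsum_cond => n _ _; exact: cov_ge0.
- by move=> k; apply: cov_measurable; exact: mA.
- apply: measurable_funS (measurable_int _ wi) => //.
  by apply: bigcup_sub => i _; exact: subIsetl.
- by move=> x [k _ [Cx _]]; rewrite lee_fin w0.
- apply/trivIsetP => i j _ _ ij.
  move/trivIsetP : tA => /(_ i j I I ij) Aij.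
  rewrite setIACA setIid -preimage_setI Aij preimage_set0 setI0//.
Qed.

(** Monotonicity and surjectivity replace injectivity: for [0 < b <= 1] the preimage of the ray lies
    in [[0, x]] when [phi x = b], and contains [[0, x]] when [phi x = b - e]. The mass of [[0, x]]
    is [phi x] by definition. *)
Lemma cov_ray b : cov_measure `]-oo, b[%classic = leb (circle `&` `]-oo, b[).
Proof.
rewrite /cov_measure.
have ms : measurable (circle `&` phi @^-1` `]-oo, b[) by apply: cov_measurable; exact: measurable_itv.
have wE : measurable_fun circle (EFin \o w) by exact: measurable_int wi.
have [b0|b0] := leP b 0.
  have -> : circle `&` phi @^-1` `]-oo, b[ = set0.
    apply/seteqP; split=> // x [/cov_range/circleP/andP[p0 _]] /=.
    by rewrite in_itv/= => /(lt_le_trans)/(_ b0); rewrite ltNge p0.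
  rewrite integral_set0.
  have -> : circle `&` `]-oo, b[ = set0 :> set R.
    apply/seteqP; split=> // x [/circleP/andP[p0 _]] /=.
    by rewrite in_itv/= => /(lt_le_trans)/(_ b0); rewrite ltNge p0.
  by rewrite measure0.
have [b1|b1] := ltP 1 b.
  have -> : circle `&` phi @^-1` `]-oo, b[ = circle.
    apply/seteqP; split=> [x []//|x Cx]; split=> //=.
    by have /circleP/andP[_ p1] := cov_range Cx; rewrite in_itv/= (le_lt_trans p1).
  have -> : circle `&` `]-oo, b[ = circle :> set R.
    apply/seteqP; split=> [x []//|x Cx]; split=> //=.
    by have /circleP/andP[_ p1] := Cx; rewrite in_itv/= (le_lt_trans p1).
  rewrite leb_circle -[LHS]fineK; last exact: (integrable_fin_num _ wi).
  by congr EFin.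
have -> : circle `&` `]-oo, b[ = `[0, b[%classic.
  apply/seteqP; split=> x /=; rewrite /circle/= !in_itv/=.
    by move=> [/andP[-> _]].
  by move=> /andP[-> xb]; split=> //; rewrite ltW// (lt_le_trans xb).
rewrite lebesgue_measure_itv/= lte_fin b0 sube0.
have key x : circle x -> (\int[leb]_(y in `[0%R, x]) (w y)%:E)%E = (phi x)%:E.
  move=> /circleP/andP[x0 x1]; rewrite fineK//.
  apply: integrable_fin_num => //; apply: intc_sub wi => //.
  exact: sub_itv_circle.
have ws x : circle x -> measurable_fun (`[0, x] : set R) (EFin \o w).
  move=> /circleP/andP[x0 x1]; apply: measurable_funS wE => //; exact: sub_itv_circle.
apply/eqP; rewrite eq_le; apply/andP; split.
  have [|x Cx xE] := @cov_onto b; first by apply/circleP; rewrite ltW.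
  rewrite -[X in (_ <= X%:E)%E]xE -key//; apply: ge0_subset_integral => //.
  - exact: ws.
  - move=> y /=; rewrite in_itv/= => /andP[y0 yx]; rewrite lee_fin w0//.
    by move/circleP : Cx => /andP[_ x1]; apply/circleP; rewrite y0 (le_trans yx).
  - move=> y [/circleP/andP[y0 y1]] /=; rewrite !in_itv/= y0/= -xE.
    apply: contraTT; rewrite -ltNge -leNgt => xy.
    by move/circleP : Cx => /andP[x0 _]; apply: cov_nondecr => //; exact: ltW.
apply/lee_addgt0Pr => e e0.
have [eb|be] := leP b e.
  rewrite (le_trans (y := e%:E))// ?lee_fin// leeDr//; exact: cov_ge0.
have [|x Cx xE] := @cov_onto (b - e).
  by apply/circleP; rewrite subr_ge0 ltW//= lerBlDr (le_trans b1)// lerDl ltW.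
rewrite -leeBlDr// -EFinB -xE -key//.
apply: ge0_subset_integral => //.
- by apply: measurable_funS wE => //; exact: subIsetl.
- by move=> y [Cy _]; rewrite lee_fin w0.
- move=> y /=; rewrite !in_itv/= => /andP[y0 yx].
  have /circleP/andP[x0 x1] := Cx; split.
    by apply/circleP; rewrite y0 (le_trans yx).
  by rewrite (le_lt_trans (cov_nondecr y0 yx x1))// xE ltrBlDr ltrDl.
Qed.

(** Rays are closed under intersection and generate the Borel sets, so two finite measures agreeing
    on them are equal. *)
Lemma cov_set (A : set R) : measurable A ->
  leb (circle `&` A) = (\int[leb]_(x in circle) (w x * \1_A (phi x))%:E)%E.
Proof.
move=> mA.
pose m1 : {measure set (measurableTypeR R) -> \bar R} := mrestr leb mC.
pose m2 : {measure set (measurableTypeR R) -> \bar R} :=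
  HB.pack cov_measure (isMeasure.Build _ (measurableTypeR R) R cov_measure cov0 cov_ge0 cov_sigma).
have E b : m1 `]-oo, b[%classic = m2 `]-oo, b[%classic.
  by rewrite [RHS]cov_ray /m1/= /mrestr setIC.
transitivity (m2 A); last first.
  rewrite [LHS]/(cov_measure A) /cov_measure.
  rewrite integral_mkcondr; apply: eq_integral => x xC.
  by rewrite patchE indicE -[x \in phi @^-1` A]/(phi x \in A); case: ifP => _; rewrite ?mulr1 ?mulr0.
rewrite setIC -[LHS]/(m1 A).
have mA' : <<s (@RGenInftyO.G R) >> A.
  change ((@RGenInftyO.G R).-sigma.-measurable A).
  by rewrite -RGenInftyO.measurableE; exact: mA.
apply: (@g_sigma_algebra_measure_unique _ R (measurableTypeR R) (@RGenInftyO.G R) _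
  (fun n => `]-oo, n%:R[%classic) _ _ m1 m2 _ _ _ A mA').
- by move=> _ [x ->]; exact: measurable_itv.
- by move=> n; exists n%:R.
- apply/seteqP; split=> // x _; exists (Num.truncn `|x|).+1 => //=.
  by rewrite in_itv/=; apply: le_lt_trans (ler_norm x) _; exact: truncnS_gt.
- move=> _ _ [x ->] [y ->]; exists (Num.min x y); apply/seteqP; split=> z /=; rewrite !in_itv/=.
    by move=> [zx zy]; rewrite lt_min zx.
  by rewrite lt_min => /andP[].
- by move=> _ [x ->]; exact: E.
- move=> k; rewrite /m1/= /mrestr; apply: le_lt_trans leb_circle_lty.
  apply: le_measure => //; rewrite ?inE//; apply: measurableI => //; exact: measurable_itv.
Qed.

End ChangeOfVariables.

Section ChangeOfVariablesFun.
Import HBNNSimple.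
Context {R : realType} (w : R -> R).
Let mC : measurable (@circle R) := measurable_circle.
Hint Resolve mC : core.
Hypothesis wi : intc w.
Hypothesis w0 : forall x, circle x -> 0 <= w x.
Hypothesis w1 : \oint w = 1.
Local Notation phi := (indef w).

Let ran := cov_range wi w0 w1.
Let mphi : measurable_fun circle phi := cov_meas wi.

Lemma measurable_comp_cov d (T : sigmaRingType d) (h : R -> T) : measurable_fun circle h ->
  measurable_fun circle (h \o phi).
Proof.
move=> mh; apply: (measurable_comp mC) => //.
by move=> _ [x Cx <-]; exact: ran.
Qed.

(** Linearity extends the formula from sets to simple functions, and monotone convergence to
    nonnegative ones: multiplication by [w >= 0] preserves the monotonicity of the approximating
    sequence. *)
Lemma cov_ge0_integral (f : R -> \bar R) : measurable_fun circle f ->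
  (forall y, circle y -> 0 <= f y)%E ->
  (\int[leb]_(y in circle) f y = \int[leb]_(x in circle) ((w x)%:E * f (phi x)))%E.
Proof.
move=> mf f0.
have mw : measurable_fun circle w by exact: intc_meas.
pose f_ := nnsfun_approx mC mf.
pose F n (y : R) : R := f_ n y.
pose K n (r : R) : set R := f_ n @^-1` [set r].
pose rg n : set R := range (f_ n).
have mF D n : measurable_fun D (F n) by exact: measurable_funP.
have mK n k : measurable (K n k) by exact: measurable_funPTI.
have mI D n k : measurable_fun D (fun x => \1_(K n k) x : R) by apply: measurable_funTS; exact: measurable_indic.
have ndF y m n : (m <= n)%N -> F m y <= F n y.
  by move=> mn; have /lefP := @nd_nnsfun_approx _ _ R _ mC _ mf _ _ mn; apply.
transitivity (limn (fun n => \int[leb]_(x in circle) (F n x)%:E)%E).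
  rewrite -monotone_convergence//.
  - apply: eq_integral => y /[!inE] Cy; apply/esym/cvg_lim => //.
    by apply: cvg_nnsfun_approx => // z; exact: f0.
  - by move=> n; apply/measurable_EFinP; exact: mF.
  - by move=> n y _; rewrite lee_fin.
  - by move=> y _ m n mn; rewrite lee_fin; exact: ndF.
transitivity (limn (fun n => \int[leb]_(x in circle) (w x * F n (phi x))%:E)%E); last first.
  rewrite -monotone_convergence//; last 3 first.
  - move=> n; apply/measurable_EFinP; apply: measurable_funM => //.
    by apply: (measurableT_comp _ mphi).
  - by move=> n x Cx; rewrite lee_fin mulr_ge0// w0.
  - by move=> x Cx m n mn; rewrite lee_fin ler_wpM2l ?w0//; exact: ndF.
  apply: eq_integral => x /[!inE] Cx /=; apply/cvg_lim => //.
  have := @cvg_nnsfun_approx _ _ R _ mC _ mf (fun z => f0 z) _ (ran Cx).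
  under [X in _ -> X @ _ --> _]eq_fun do rewrite EFinM.
  by move=> h; apply: cvgeZl => //.
congr (limn _); apply/funext => n.
transitivity (\sum_(k \in rg n)
    \int[leb]_(x in circle) (k * \1_(K n k) x)%:E)%E.
  under eq_integral do rewrite /F fimfunE -fsumEFin//.
  rewrite ge0_integral_fsum//.
  - move=> y; apply/measurable_EFinP/measurable_funM => //; exact: mI.
  - by move=> y x _; rewrite nnfun_muleindic_ge0.
transitivity (\sum_(k \in rg n)
    \int[leb]_(x in circle) (w x * (k * \1_(K n k) (phi x)))%:E)%E; last first.
  have kge0 k x : 0 <= k * \1_(K n k) x.
    by have := nnfun_muleindic_ge0 (f_ n) k x; rewrite lee_fin.
  rewrite -ge0_integral_fsum//.
  - apply: eq_integral => x /[!inE] Cx.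
    under eq_fsbigr do rewrite EFinM.
    rewrite -ge0_mule_fsumr; last by move=> k; rewrite lee_fin.
    by rewrite fsumEFin// -EFinM /F fimfunE.
  - move=> k; apply/measurable_EFinP; apply: measurable_funM => //.
    apply: measurable_funM => //; apply: (measurableT_comp _ mphi).
    exact: mI.
  - by move=> k x Cx; rewrite lee_fin mulr_ge0// w0.
apply: eq_fsbigr => k _.
have -> : (\int[leb]_(x in circle) (k * \1_(K n k) x)%:E = k%:E * leb (circle `&` K n k))%E.
  have i1 : intc (\1_(K n k) : R -> R).
    apply: (@intc_bnd _ _ 1); first exact: mI.
    by move=> x _; rewrite indicE; case: (_ \in _); rewrite ?normr1 ?normr0.
  rewrite setIC; transitivity (k%:E * \int[leb]_(x in circle) (\1_(K n k) x)%:E)%E.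
    transitivity (\int[leb]_(x in circle) (k%:E * (\1_(K n k) x)%:E))%E.
      by apply: eq_integral => x _; rewrite EFinM.
    by apply: (integralZl _ i1 k).
  by congr (_ * _)%E; by apply: integral_indic => //; exact: mK.
have -> : (\int[leb]_(x in circle) (w x * (k * \1_(K n k) (phi x)))%:E =
  k%:E * \int[leb]_(x in circle) (w x * \1_(K n k) (phi x))%:E)%E.
  have i2 : intc (fun x => w x * \1_(K n k) (phi x)).
    apply: (@intcM _ _ _ 1) => //.
      by apply: (measurable_comp_cov (h := fun y => \1_(K n k) y : R)); exact: mI.
    by move=> x _; rewrite indicE; case: (_ \in _); rewrite ?normr1 ?normr0.
  transitivity (\int[leb]_(x in circle) (k%:E * (w x * \1_(K n k) (phi x))%:E))%E.
    by apply: eq_integral => x _; rewrite -EFinM mulrCA.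
  by apply: (integralZl _ i2 k).
by rewrite (cov_set wi w0 w1).
Qed.

(** The factor [w >= 0] commutes with taking positive and negative parts, which reduces the signed
    case to the nonnegative one. *)
Lemma cov_int (h : R -> R) : measurable_fun circle h ->
  (\int[leb]_(y in circle) (h y)%:E = \int[leb]_(x in circle) (w x * h (phi x))%:E)%E.
Proof.
move=> mh; rewrite integralE [RHS]integralE.
have mh' : measurable_fun circle (EFin \o h) by exact/measurable_EFinP.
congr (_ - _)%E.
- rewrite cov_ge0_integral//; last exact: measurable_funepos.
  apply: eq_integral => x /[!inE] Cx; rewrite !funeposE/= -EFin_max -EFinM.
  by rewrite -EFin_max maxr_pMr ?w0// mulr0.
- rewrite cov_ge0_integral//; last exact: measurable_funeneg.
  apply: eq_integral => x /[!inE] Cx; rewrite !funenegE/= -EFin_max -EFinM.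
  by rewrite -EFin_max maxr_pMr ?w0// mulr0 mulrN.
Qed.

Lemma cov_oint (h : R -> R) : measurable_fun circle h ->
  \oint h = \oint (fun x => w x * h (phi x)).
Proof. by move=> mh; congr fine; exact: cov_int. Qed.

Lemma cov_intc (h : R -> R) : measurable_fun circle h ->
  intc h <-> intc (fun x => w x * h (phi x)).
Proof.
move=> mh.
have mh' : measurable_fun circle (fun x => w x * h (phi x)).
  by apply: measurable_funM; [exact: intc_meas|exact: measurable_comp_cov].
have ma : measurable_fun circle (fun x => `|h x|) by exact: measurableT_comp.
have E := cov_int ma.
have E' : (\int[leb]_(x in circle) `|(w x * h (phi x))%:E| =
           \int[leb]_(x in circle) (w x * `|h (phi x)|)%:E)%E.
  by apply: eq_integral => x /[!inE] Cx; rewrite /= normrM ger0_norm ?w0.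
split=> /integrableP[_ H]; apply/integrableP; split; try exact/measurable_EFinP.
- by rewrite [X in (X < _)%E]E' -E.
- by move: H; rewrite [X in (X < _)%E]E' -E.
Qed.

End ChangeOfVariablesFun.

(** * Primitives and density of continuous functions *)

Section Primitive.
Context {R : realType}.
Let mC : measurable (@circle R) := measurable_circle.
Hint Resolve mC : core.
Implicit Types (f g h q : R -> R) (a b c e x y z M : R).

Lemma cont_itv_intble q a b : continuous q -> leb.-integrable `[a, b] (EFin \o q).
Proof.
move=> cq; apply: continuous_compact_integrable; first exact: segment_compact.
exact: continuous_subspaceT.
Qed.

Lemma cont_meas q (D : set R) : continuous q -> measurable_fun D q.
Proof. by move=> cq; apply: measurable_funTS; exact: continuous_measurable_fun. Qed.

Lemma cont_meas_comp q f (D : set R) : continuous q -> measurable_fun D f ->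
  measurable_fun D (fun x => q (f x)).
Proof.
move=> cq mf; have mq : measurable_fun setT q by exact: cont_meas.
exact: measurableT_comp mq mf.
Qed.

Lemma cont_intc q : continuous q -> intc q.
Proof. exact: cont_itv_intble. Qed.

Lemma cont_bnd q : continuous q -> exists M, forall x, circle x -> `|q x| <= M.
Proof.
move=> cq; have [|c _ cM] := @EVT_max R (fun x => `|q x|) 0 1 ler01.
  by apply: continuous_subspaceT => x; apply: continuous_comp; [exact: cq|exact: norm_continuous].
by exists `|q c| => x Cx; exact: cM.
Qed.

Lemma cont_H0 q : continuous q -> in_H0 q.
Proof.
by move=> cq; have [M qM] := cont_bnd cq; apply: H0_bnd qM; exact: cont_meas.
Qed.

(** At most one of the two integrals is nonzero: this is the signed primitive on all of R. For
    continuous [q] it is differentiable at 0 and 1 too, so it can be corrected to a periodic test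
    function and composed with the flow. *)
Definition primitive q (x : R) : R :=
  \int[leb]_(y in `[0, x]) q y - \int[leb]_(y in `[x, 0]) q y.

Lemma Rintegral_itv_ge q (x y : R) : y <= x -> \int[leb]_(z in `[x, y]) q z = 0.
Proof.
rewrite le_eqVlt => /predU1P[->|yx]; first by rewrite set_itv1 Rintegral_set1.
by rewrite set_itv_ge ?bnd_simp -?ltNge// Rintegral_set0.
Qed.

Lemma primitive_indef q x : circle x -> primitive q x = indef q x.
Proof. by move=> /circleP/andP[x0 _]; rewrite /primitive (Rintegral_itv_ge _ x0) subr0. Qed.

Lemma primitive_ge0 q x : 0 <= x -> primitive q x = \int[leb]_(y in `[0, x]) q y.
Proof. by move=> x0; rewrite /primitive (Rintegral_itv_ge _ x0) subr0. Qed.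

Lemma primitive_derive q x : continuous q -> is_derive x 1 (primitive q) (q x).
Proof.
(* A base point to the left of both 0 and [x] allows a single application of the fundamental
   theorem; subtracting [F 0] then restores the signed primitive. *)
move=> cq; pose a := - (`|x| + 1).
have a0 : a < 0 by rewrite /a oppr_lt0 ltr_wpDl.
have ax : a < x.
  by rewrite /a ltrNl; apply: le_lt_trans (ler_norm (- x)) _; rewrite normrN ltrDl.
have iq u v := cont_itv_intble u v cq.
have x1 : x < x + 1 by rewrite ltrDl.
have [d1 d2] := continuous_FTC1_closed x1 (cont_itv_intble a (x + 1) cq) ax (cq x).
pose F y := \int[leb]_(t in `[a, y]) q t.
have dF : is_derive x 1 F (q x) by split; [exact: d1|rewrite -derive1E].
have dF' : is_derive x 1 (fun y => F y - F 0) (q x).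
  by apply: is_derive_eq; rewrite subr0.
apply: near_eq_is_derive dF'; near=> y.
have ay : a < y by near: y; exact: lt_nbhsr.
have [y0|y0] := leP 0 y.
  rewrite /primitive (Rintegral_itv_ge _ y0) subr0 /F.
  rewrite Rintegral_itvB ?bnd_simp ?(ltW a0)//.
  rewrite Rintegral_itv_obnd_cbnd//; apply: integrableS (cont_itv_intble 0 y cq) => //.
  exact: subset_itv_oc_cc.
rewrite /primitive (Rintegral_itv_ge _ (ltW y0)) sub0r /F -opprB.
rewrite Rintegral_itvB ?bnd_simp ?(ltW y0) ?(ltW ay)//.
rewrite Rintegral_itv_obnd_cbnd//; apply: integrableS (cont_itv_intble y 0 cq) => //.
exact: subset_itv_oc_cc.
Unshelve. all: by end_near. Qed.

Lemma primitive0 q : primitive q 0 = 0.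
Proof. by rewrite /primitive subrr. Qed.

Lemma is_derive_cont (f : R -> R) l x : is_derive x 1 f l -> {for x, continuous f}.
Proof. by move=> [d _]; apply/differentiable_continuous/derivable1_diffP. Qed.

Lemma primitive_cont q : continuous q -> continuous (primitive q).
Proof. by move=> cq x; apply: is_derive_cont (primitive_derive x cq). Qed.

Lemma is_derive_const_eq (f : R -> R) : (forall x, is_derive x 1 f 0) ->
  forall x y, f x = f y.
Proof.
move=> df x y; wlog xy : x y / x < y.
  by move=> H; have [/H->|/H->|->] := ltgtP x y.
have [z _] := MVT xy (fun z _ => df z)
  (@continuous_subspaceT _ _ _ _ (fun z => is_derive_cont (df z))).
by rewrite mul0r => /eqP; rewrite subr_eq0 => /eqP.
Qed.

End Primitive.

(** * Density of continuous functions in L^2 *)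

Section Density.
Context {R : realType}.
Let mC : measurable (@circle R) := measurable_circle.
Hint Resolve mC : core.
Implicit Types (f g h q : R -> R) (a b c e x y z M : R).

Definition trunc (M x : R) : R := Num.max (- M) (Num.min M x).

Lemma trunc_norm M x : 0 <= M -> `|trunc M x| <= M.
Proof.
move=> M0; rewrite /trunc ler_norml; apply/andP; split; first by rewrite le_max lexx.
by rewrite ge_max ge_min lexx /= (le_trans _ M0)// oppr_le0.
Qed.

Lemma trunc_id M x : `|x| <= M -> trunc M x = x.
Proof.
by rewrite ler_norml /trunc => /andP[Mx xM]; rewrite (min_idPr xM) (max_idPr Mx).
Qed.

Lemma trunc_dist M x y : `|trunc M x - trunc M y| <= `|x - y|.
Proof.
rewrite /trunc.
case: (leP M x) => h1; case: (leP M y) => h2; case: (leP (- M) M) => h3;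
  case: (leP (- M) x) => h4; case: (leP (- M) y) => h5;
  have := ler_norm (x - y); have := ler_norm (y - x); rewrite (distrC y x) => h6 h7;
  rewrite ler_norml; apply/andP; split; lra.
Qed.

Lemma trunc_cont M : continuous (trunc M).
Proof.
move=> x; apply/cvgrPdist_le => e e0; near=> y.
apply: le_trans (trunc_dist M x y) _.
by near: y; apply: cvgr_dist_le => //; exact: cvg_id.
Unshelve. all: by end_near. Qed.

Lemma trunc_sub M x : 0 <= M -> `|x - trunc M x| <= `|x|.
Proof.
move=> M0; rewrite /trunc; case: (leP M x) => h1; case: (leP (- M) M) => h2;
  case: (leP (- M) x) => h3; case: (leP 0 x) => h4;
  rewrite ?(ger0_norm h4) ?(ltr0_norm h4) ler_norml; apply/andP; split; lra.
Qed.

(** Dominated convergence along integer truncation levels, with majorant [f ^+ 2]. *)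
Lemma H0_trunc_close f e : in_H0 f -> 0 < e -> exists2 M, 0 <= M &
  norm_H0 (fun x => f x - trunc M (f x)) <= e.
Proof.
move=> Hf e0.
have mt n : measurable_fun circle (fun x => (f x - trunc n%:R (f x)) ^+ 2).
  apply: measurable_funX; apply: measurable_funB; first exact: H0_meas.
  exact: cont_meas_comp (@trunc_cont n%:R) (H0_meas Hf).
have [] := @dominated_convergence _ _ R leb circle mC
  (fun n x => ((f x - trunc n%:R (f x)) ^+ 2)%:E) (fun=> 0%E) (fun x => (f x ^+ 2)%:E).
- by move=> n; apply/measurable_EFinP; exact: mt.
- exact: measurable_cst.
- apply: aeT => x Cx; apply: cvg_near_cst; near=> n; rewrite trunc_id ?subrr ?expr0n//.
  by near: n; exact: nbhs_infty_ger.
- exact: H0_sqr.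
- apply: aeT => x n Cx; rewrite /= lee_fin ger0_norm ?sqr_ge0//.
  rewrite -[leLHS]real_normK ?num_real// -[leRHS]real_normK ?num_real//.
  rewrite lerXn2r ?nnegrE//.
  exact: trunc_sub.
move=> _ _; rewrite integral0 => /fine_cvg H.
have e2 : 0 < e ^+ 2 by rewrite exprn_gt0.
have /cvgrPdist_le /(_ _ e2) [n _ /(_ n (leqnn n))] := H.
rewrite /= sub0r normrN => Hn; exists n%:R => //.
apply: norm_H0_le; first exact: ltW.
by apply: le_trans Hn; exact: ler_norm.
Unshelve. all: by end_near. Qed.

(** Approximation in L^1 is upgraded by truncation: for two functions bounded by [M], the square of
    the difference is at most [2 M] times its absolute value. *)
Lemma H0_dense f e : in_H0 f -> 0 < e -> exists2 h, continuous h &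
  norm_H0 (fun x => f x - h x) <= e.
Proof.
move=> Hf e0; have e20 : 0 < e / 2 by rewrite divr_gt0.
have [M M0 fM] := H0_trunc_close Hf e20.
have mF : measurable_fun circle (fun x => trunc M (f x)).
  exact: cont_meas_comp (@trunc_cont M) (H0_meas Hf).
have FM x : circle x -> `|trunc M (f x)| <= M by move=> _; exact: trunc_norm.
have HF := H0_bnd mF FM.
have [g [gc gi gcvg]] := @approximation_continuous_integrable R circle
  (fun x => trunc M (f x)) mC leb_circle_lty (H0_intc HF).
(* The added 1 keeps the divisor positive when [M = 0]. *)
have M1 : 0 < 2 * M + 1 by rewrite ltr_wpDl// mulr_ge0.
have d0 : 0 < (e / 2) ^+ 2 / (2 * M + 1) by rewrite divr_gt0// exprn_gt0.
have /fine_cvgP[_ /cvgrPdist_le /(_ _ d0) [n _ /(_ n (leqnn n))]] := gcvg.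
rewrite /= sub0r normrN => Hn.
have ch : continuous (fun x => trunc M (g n x)).
  by move=> x; apply: continuous_comp; [exact: gc|exact: trunc_cont].
exists (fun x => trunc M (g n x)) => //.
have Hh := cont_H0 ch.
rewrite (@eq_norm_H0 _ _ (fun x => (f x - trunc M (f x)) + (trunc M (f x) - trunc M (g n x)))); last first.
  by move=> x _; rewrite addrA subrK.
apply: (le_trans (norm_H0D _ _)); [exact: H0B|exact: H0B|].
rewrite (splitr e) lerD// norm_H0_le//; first exact: ltW.
have ia : intc (fun x => `|trunc M (f x) - g n x|).
  by apply: intc_norm; apply: intcB => //; exact: H0_intc.
have -> : (e / 2) ^+ 2 = (2 * M + 1) * ((e / 2) ^+ 2 / (2 * M + 1)).
  by field; rewrite gt_eqF.
apply: (@le_trans _ _ ((2 * M + 1) * \oint (fun x => `|trunc M (f x) - g n x|))); last first.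
  by apply: ler_wpM2l; [exact: ltW|apply: le_trans Hn; exact: ler_norm].
rewrite -ointZ//; apply: le_oint; [exact/H0_sqr/H0B|exact: intcZ|].
move=> x Cx; rewrite -[leLHS]real_normK ?num_real// expr2 ler_pM//.
  apply: (le_trans (ler_normB _ _)).
  have := trunc_norm (f x) M0; have := trunc_norm (g n x) M0; lra.
by rewrite -{1}(trunc_id (FM x Cx)); exact: trunc_dist.
Qed.

End Density.

(** * Weak derivatives *)

Section WeakDerivative.
Context {R : realType}.
Let mC : measurable (@circle R) := measurable_circle.
Hint Resolve mC : core.
Implicit Types (f g h q psi : R -> R) (a b c e x y z M : R).

Lemma ae_meets (P : R -> Prop) a b : {ae leb, forall x, P x} -> a < b ->
  exists2 x, a < x < b & P x.
Proof.
move=> [N [mN N0 PN]] ab; apply: contrapT => nP.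
have sub : `]a, b[%classic `<=` N.
  move=> x; rewrite /= in_itv/= => xab; apply: PN => Px; apply: nP.
  by exists x.
have : (leb (`]a, b[%classic : set R) <= leb N)%E by apply: le_measure => //; rewrite inE.
rewrite [X in (_ <= X)%E]N0 lebesgue_measure_itv/= lte_fin ab -EFinB lee_fin.
by rewrite leNgt subr_gt0 ab.
Qed.

Lemma within_circle_ball f x e : {within circle, continuous f} -> circle x -> 0 < e ->
  exists2 d, 0 < d & forall y, circle y -> `|x - y| < d -> `|f x - f y| < e.
Proof.
move=> /subspace_continuousP cf Cx e0.
have /cvgrPdist_lt /(_ _ e0) := cf x Cx.
move=> [d /= d0 H]; exists d => // y Cy xy.
by apply: H.
Qed.

Lemma ae_eq_continuous f g : {within circle, continuous f} -> {within circle, continuous g} ->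
  ae_eq_circle f g -> forall x, circle x -> f x = g x.
Proof.
move=> cf cg fg x Cx; apply/eqP; rewrite -subr_eq0 -normr_le0; apply/ler_addgt0Pr => e e0.
have e2 : 0 < e / 2 by rewrite divr_gt0.
have [d1 d10 H1] := within_circle_ball cf Cx e2.
have [d2 d20 H2] := within_circle_ball cg Cx e2.
pose d := Num.min d1 d2.
have d0 : 0 < d by rewrite lt_min d10.
have /circleP/andP[x0 x1] := Cx.
(* The window is cut at 0 and 1, so that the endpoints are reached by one-sided approximation. *)
have [|y /andP[ay yb] fgy] := ae_meets (a := Num.max 0 (x - d)) (b := Num.min 1 (x + d)) fg.
  rewrite gt_max !lt_min; apply/andP; split; apply/andP; split => //; lra.
move: ay yb; rewrite gt_max lt_min => /andP[y0 xy] /andP[y1 yx].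
have Cy : circle y by apply/circleP; rewrite !ltW.
have xyd : `|x - y| < d by rewrite ltr_norml; apply/andP; split; lra.
move: (xyd); rewrite lt_min => /andP[/(H1 y Cy){}H1 /(H2 y Cy){}H2].
rewrite add0r (_ : f x - g x = (f x - f y) - (g x - g y)); last by rewrite fgy//; ring.
by rewrite (le_trans (ler_normB _ _))// (splitr e) lerD// ltW.
Qed.

Lemma intc_approx f e : intc f -> 0 < e -> exists2 g, continuous g &
  \oint (fun x => `|f x - g x|) <= e.
Proof.
move=> fi e0.
have [g [gc gi gcvg]] := @approximation_continuous_integrable R circle f mC leb_circle_lty fi.
have /fine_cvgP[_ /cvgrPdist_le /(_ _ e0) [n _ /(_ n (leqnn n))]] := gcvg.
rewrite /= sub0r normrN => Hn; exists (g n); first exact: gc.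
by apply: le_trans Hn; exact: ler_norm.
Qed.

Lemma ibp_cont f h : continuous f -> continuous h ->
  \oint (fun x => indef f x * h x) =
  (\oint f) * primitive h 1 - \oint (fun x => f x * primitive h x).
Proof.
move=> cf ch.
have D q : continuous q -> derivable_oo_LRcontinuous (primitive q) 0 1.
  move=> cq; split.
  - by move=> x _; have [] := primitive_derive x cq.
  - by apply: cvg_at_right_filter; exact: primitive_cont.
  - by apply: cvg_at_left_filter; exact: primitive_cont.
have D' q : continuous q -> {in `]0, 1[, (primitive q)^`()%classic =1 q}.
  by move=> cq x _; rewrite derive1E; have [_ ->] := primitive_derive x cq.
transitivity (\oint (fun x => primitive f x * h x)).
  by apply: eq_oint => x Cx; rewrite primitive_indef.
rewrite (@Rintegration_by_parts R (primitive f) (primitive h) f h 0 1)//; last 6 first.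
- exact: continuous_subspaceT.
- exact: D.
- exact: D'.
- exact: continuous_subspaceT.
- exact: D.
- exact: D'.
rewrite primitive0 mul0r subr0 (primitive_indef f)//.
by apply/circleP; rewrite ler01 lexx.
Qed.

(** Both sides are continuous in [f] for the L^1 norm and agree for continuous [f]. The defect [P]
    is linear and bounded by [B + 2 B'] times that norm, where [B] and [B'] bound [h] and its
    primitive. *)
Lemma ibp f h : intc f -> continuous h ->
  \oint (fun x => indef f x * h x) =
  (\oint f) * primitive h 1 - \oint (fun x => f x * primitive h x).
Proof.
move=> fi ch; have [B hB] := cont_bnd ch; have [B' HB] := cont_bnd (primitive_cont ch).
have mh : measurable_fun circle h by exact: cont_meas.
have mH : measurable_fun circle (primitive h) by apply: cont_meas; exact: primitive_cont.
have C1 : circle (1 : R) by apply/circleP; rewrite ler01 lexx.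
have B0 : 0 <= B by apply: le_trans (hB 1 C1).
have B'0 : 0 <= B' by apply: le_trans (HB 1 C1).
have i1 k : intc k -> intc (fun x => indef k x * h x).
  move=> ki; apply: (@intcM _ _ _ B) => //.
  apply: (@intc_bnd _ _ (\oint (fun y => `|k y|))); first exact: indef_meas.
  by move=> x; exact: indef_norm.
have i2 k : intc k -> intc (fun x => k x * primitive h x).
  by move=> ki; apply: (@intcM _ _ _ B').
pose P k := \oint (fun x => indef k x * h x) -
  ((\oint k) * primitive h 1 - \oint (fun x => k x * primitive h x)).
suff : P f = 0 by move/eqP; rewrite subr_eq0 => /eqP.
apply/eqP; rewrite -normr_le0; apply/ler_addgt0Pr => e e0; rewrite add0r.
have M0 : 0 < B + B' + B' + 1 by lra.
have [g gc fg] := intc_approx fi (divr_gt0 e0 M0).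
have gi := cont_intc gc.
have PB : P f = P (fun x => f x - g x).
  have Pg : P g = 0 by apply/eqP; rewrite subr_eq0 ibp_cont.
  rewrite -[LHS]subr0 -Pg /P ointB//.
  rewrite (@eq_oint _ (fun x => indef (fun y => f y - g y) x * h x)
    (fun x => indef f x * h x - indef g x * h x)); last first.
    move=> x Cx; rewrite (@eq_indef _ (fun y => f y - g y) (fun y => f y + (-1) * g y))//; last first.
      by move=> y _; rewrite mulN1r.
    by rewrite indefD ?indefZ//; [ring|exact: intcZ].
  rewrite (@eq_oint _ (fun x => (f x - g x) * primitive h x)
    (fun x => f x * primitive h x - g x * primitive h x)); last by move=> x _; ring.
  by rewrite !ointB//; [ring|exact: i2|exact: i2|exact: i1|exact: i1].
rewrite PB.
have ki : intc (fun x => f x - g x) by exact: intcB.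
have K1 : `|\oint (fun x => f x - g x)| <= \oint (fun x => `|f x - g x|).
  exact: le_norm_oint.
set k := (fun x => f x - g x) in ki K1 *.
set N := \oint (fun x => `|k x|) in K1 *.
have {}fg : N <= e / (B + B' + B' + 1) by [].
have N0 : 0 <= N by apply: oint_ge0.
have T1 : `|\oint (fun x => indef k x * h x)| <= N * B.
  apply: norm_oint_bnd; first exact: i1.
  by move=> x Cx; rewrite normrM ler_pM// ?hB//; exact: indef_norm.
have T2 : `|(\oint k) * primitive h 1| <= N * B' by rewrite normrM ler_pM// HB.
have T3 : `|\oint (fun x => k x * primitive h x)| <= N * B'.
  rewrite (mulrC N) -ointZ; last exact: intc_norm.
  apply: norm_oint_le; [exact: i2|exact/intcZ/intc_norm|].
  by move=> x Cx; rewrite normrM mulrC ler_wpM2r// HB.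
apply: (@le_trans _ _ (N * (B + B' + B' + 1))); last by rewrite -ler_pdivlMr.
rewrite /P (le_trans (ler_normB _ _))//.
have := ler_normB ((\oint k) * primitive h 1) (\oint (fun x => k x * primitive h x)).
by lra.
Qed.

Lemma C1_circleI psi (dpsi : R -> R) : (forall x, psi (x + 1) = psi x) ->
  (forall x, is_derive x 1 psi (dpsi x)) -> continuous dpsi -> C1_circle psi.
Proof.
move=> per d c; have E : psi^`()%classic = dpsi.
  by apply/funext => x; rewrite derive1E; have [_ ->] := d x.
split; [exact: per|by move=> x; have [] := d x|by rewrite E].
Qed.

Lemma C1_derive psi x : C1_circle psi -> is_derive x 1 psi (psi^`()%classic x).
Proof. by move=> [_ d _]; split; [exact: d|rewrite derive1E]. Qed.

Lemma C1_cont psi : C1_circle psi -> continuous psi.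
Proof. by move=> c x; exact: is_derive_cont (C1_derive x c). Qed.

Lemma C1_primitive psi x : C1_circle psi -> primitive psi^`()%classic x = psi x - psi 0.
Proof.
move=> c; have [per d cd] := c.
pose k y := psi y - primitive psi^`()%classic y.
have dk y : is_derive y 1 k 0.
  have D1 := C1_derive y c; have D2 := primitive_derive y cd.
  by apply: is_derive_eq; rewrite subrr.
have := is_derive_const_eq dk x 0; rewrite /k primitive0 subr0 => <-.
by rewrite opprB addrC subrK.
Qed.

(** The zero mean makes the boundary term of the integration by parts vanish and cancels the
    constant [psi 0]. *)
Lemma indef_weak_deriv f : intc f -> \oint f = 0 -> weak_deriv (indef f) f.
Proof.
move=> fi f0 psi c; have [per d cd] := c.
have cp := C1_cont c; have [M pM] := cont_bnd cp.
have mp : measurable_fun circle psi by exact: cont_meas.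
rewrite /distr_deriv (ibp (h := psi^`()%classic))// f0 mul0r sub0r opprK.
rewrite (@eq_oint _ (fun x => f x * primitive psi^`()%classic x)
  (fun x => f x * psi x - psi 0 * f x)); last first.
  by move=> x _; rewrite (C1_primitive _ c); ring.
rewrite ointB; [|exact: (intcM fi mp pM)|exact: intcZ].
by rewrite ointZ// f0 mulr0 subr0.
Qed.
End WeakDerivative.

(** * The fundamental lemma of the calculus of variations on the circle *)

Section FundamentalLemma.
Context {R : realType}.
Let mC : measurable (@circle R) := measurable_circle.
Hint Resolve mC : core.
Implicit Types (f g h q psi : R -> R) (a b c e x y z M : R).

(* [sin (pi x) sin (pi (b - x))] is 1-periodic, positive on ]0, b[ and negative
   on ]b, 1[: composed with steep sigmoids it gives periodic test functions
   converging to the indicator of [0, b]. *)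
Let s b x : R := sin (pi * x) * sin (pi * (b - x)).
Let ds b x : R := pi * cos (pi * x) * sin (pi * (b - x)) - pi * sin (pi * x) * cos (pi * (b - x)).

Let s_per b x : s b (x + 1) = s b x.
Proof.
rewrite /s mulrDr mulr1 sinDpi.
rewrite (_ : pi * (b - x) = pi * (b - (x + 1)) + pi); last by ring.
by rewrite sinDpi mulNr mulrN.
Qed.

Let s_derive b x : is_derive x 1 (s b) (ds b x).
Proof.
have d1 : is_derive x 1 (fun y : R => pi * y) pi.
  by apply: is_derive_eq; rewrite /GRing.scale/=; ring.
have d2 : is_derive x 1 (fun y : R => pi * (b - y)) (- pi).
  by apply: is_derive_eq; rewrite /GRing.scale/=; ring.
have e1 := is_derive1_comp (f := sin) (g := fun y => pi * y) (is_derive_sin _) d1.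
have e2 := is_derive1_comp (f := sin) (g := fun y => pi * (b - y)) (is_derive_sin _) d2.
by apply: (is_derive_eq (is_deriveM e1 e2)); rewrite /ds/= /GRing.scale/=; ring.
Qed.

Let ds_cont b : continuous (ds b).
Proof.
have c1 : continuous (fun y : R => pi * y) by move=> x; apply: cvgM; [exact: cvg_cst|exact: cvg_id].
have c2 : continuous (fun y : R => pi * (b - y)).
  by move=> x; apply: cvgM; [exact: cvg_cst|apply: cvgB; [exact: cvg_cst|exact: cvg_id]].
move=> x; apply: cvgB; apply: cvgM; try apply: cvgM; try exact: cvg_cst.
- by apply: continuous_comp; [exact: c1|exact: continuous_cos].
- by apply: continuous_comp; [exact: c2|exact: continuous_sin].
- by apply: continuous_comp; [exact: c1|exact: continuous_sin].
- by apply: continuous_comp; [exact: c2|exact: continuous_cos].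
Qed.

Definition sigmoid (k : R) y : R := (1 + expR (- (k * y)))^-1.

Lemma sigmoid_den k y : 0 < 1 + expR (- (k * y)).
Proof. by rewrite ltr_wpDl// expR_gt0. Qed.

Lemma sigmoid_norm k y : `|sigmoid k y| <= 1.
Proof.
rewrite /sigmoid ger0_norm; last by rewrite invr_ge0 ltW// sigmoid_den.
by rewrite invf_le1 ?sigmoid_den// lerDl expR_ge0.
Qed.

Lemma sigmoid_derive k y :
  is_derive y 1 (sigmoid k) (k * expR (- (k * y)) * sigmoid k y ^+ 2).
Proof.
have d1 : is_derive y 1 (fun z : R => - (k * z)) (- k).
  by apply: is_derive_eq; rewrite /GRing.scale/=; ring.
have d2 := is_derive1_comp (f := expR) (g := fun z => - (k * z)) (is_derive_expR _) d1.
have d3 : is_derive y 1 (fun z : R => 1 + expR (- (k * z))) (- k * expR (- (k * y))).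
  by apply: (is_derive_eq (is_deriveD (is_derive_cst (1 : R) y 1) d2)); rewrite /GRing.scale/=; ring.
have n0 : 1 + expR (- (k * y)) != 0 by rewrite gt_eqF// sigmoid_den.
have d4 := is_deriveV (f := fun z : R => 1 + expR (- (k * z))) n0 d3.
by apply: (is_derive_eq d4); rewrite /sigmoid /GRing.scale/=; field.
Qed.

Lemma sigmoid_cont k : continuous (sigmoid k).
Proof. by move=> y; exact: is_derive_cont (sigmoid_derive k y). Qed.

Lemma sigmoid_cvg1 y : 0 < y -> sigmoid n%:R y @[n --> \oo] --> (1 : R).
Proof.
move=> y0; apply/cvgrPdist_le => e e0; near=> n.
have n0 : (0 : R) < n%:R by near: n; exact: nbhs_infty_gtr.
have ny : 0 < n%:R * y by rewrite mulr_gt0.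
have E : expR (- (n%:R * y)) <= (n%:R * y)^-1.
  rewrite expRN lef_pV2 ?posrE ?expR_gt0//.
  by apply: le_trans (expR_ge1Dx _); rewrite lerDr.
have -> : 1 - sigmoid n%:R y = expR (- (n%:R * y)) * sigmoid n%:R y.
  rewrite /sigmoid; field; by rewrite gt_eqF// sigmoid_den.
rewrite normrM ger0_norm ?expR_ge0//.
apply: le_trans (_ : (n%:R * y)^-1 * 1 <= _).
  by apply: ler_pM; rewrite ?expR_ge0 ?normr_ge0 ?sigmoid_norm.
rewrite mulr1 invfM -ler_pdivlMr ?invr_gt0// invrK -[leRHS]invrK lef_pV2 ?posrE ?invr_gt0 ?mulr_gt0//.
by near: n; exact: nbhs_infty_ger.
Unshelve. all: by end_near. Qed.

Lemma sigmoid_cvg0 y : y < 0 -> sigmoid n%:R y @[n --> \oo] --> (0 : R).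
Proof.
move=> y0.
have E n : sigmoid n%:R y = 1 - sigmoid n%:R (- y).
  have := expR_gt0 (n%:R * y); rewrite /sigmoid mulrN opprK expRN.
  set z := expR _ => z0; field.
  by do ?[apply/andP; split]; rewrite gt_eqF//; lra.
rewrite (_ : (fun n => _) = (fun n : nat => 1 - sigmoid n%:R (- y))); last exact/funext.
have -> : (0 : R) = 1 - 1 by rewrite subrr.
by apply: cvgB; [exact: cvg_cst|apply: sigmoid_cvg1; lra].
Qed.

Let psi n b x : R := sigmoid n%:R (s b x).

Let psi_C1 n b : C1_circle (psi n b).
Proof.
pose d y : R := n%:R * expR (- (n%:R * y)) * sigmoid n%:R y ^+ 2.
have cd : continuous d.
  move=> y; apply: cvgM; last first.
    apply: (continuous_comp (f := sigmoid n%:R) (g := fun z : R => z ^+ 2)); first exact: sigmoid_cont.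
    exact: exprn_continuous.
  apply: cvgM; first exact: cvg_cst.
  apply: (continuous_comp (f := fun z : R => - (n%:R * z))); last exact: continuous_expR.
  by apply: cvgN; apply: cvgM; [exact: cvg_cst|exact: cvg_id].
apply: (@C1_circleI _ _ (fun x => d (s b x) * ds b x)).
- by move=> x; rewrite /psi s_per.
- move=> x; exact: (is_derive1_comp (f := sigmoid n%:R) (g := s b) (sigmoid_derive _ _) (s_derive b x)).
- move=> x; apply: cvgM; last exact: ds_cont.
  apply: (continuous_comp (f := s b) (g := d)); last exact: cd.
  exact: is_derive_cont (s_derive b x).
Qed.

(** Dominated convergence with majorant [|h|]. The limit is identified away from 0, [b] and 1, the
    zeros of [s b] on the circle. *)
Lemma fundamental_indef h b : intc h -> (forall psi, C1_circle psi -> \oint (fun x => h x * psi x) = 0) ->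
  0 < b < 1 -> indef h b = 0.
Proof.
move=> hi H /andP[b0 b1].
have mpsi n : measurable_fun circle (psi n b) by apply: cont_meas; exact: C1_cont (psi_C1 n b).
have mh := intc_meas hi.
pose hb := h \_ `[0, b].
have sb : `[0, b] `<=` (@circle R) by apply: sub_itv_circle => //; exact: ltW.
have Eb : \oint hb = indef h b.
  by rewrite /hb -Rintegral_mkcondr; congr Rintegral; apply/setIidPr.
have mhb : measurable_fun circle hb.
  by apply/measurable_restrict => //; apply: measurable_funS mh.
have [] := @dominated_convergence _ _ R leb circle mC
  (fun n x => (h x * psi n b x)%:E) (fun x => (hb x)%:E) (fun x => `|h x|%:E).
- by move=> n; apply/measurable_EFinP; exact: (measurable_funM mh (mpsi n)).
- exact/measurable_EFinP.
- have ne : {ae leb, forall x : R, x != b}.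
    by exists [set b]; split=> //; [exact: lebesgue_measure_set1|move=> x /= /negP/negPn/eqP].
  apply: aeS2 ae_oo ne => x ox xb Cx; have /andP[x0 x1] := ox Cx.
  apply: cvg_EFin; first exact: nearW.
  have px : 0 < pi * x by rewrite mulr_gt0// pi_gt0.
  have px1 : pi * x < pi by rewrite gtr_pMr// pi_gt0.
  have sx : 0 < sin (pi * x) by rewrite sin_gt0_pi// px px1.
  rewrite /hb patchE; have [xb'|bx] := ltP x b.
    rewrite mem_set; last by rewrite /= in_itv/= !ltW.
    have {2}-> : h x = h x * 1 by rewrite mulr1.
    apply: cvgM; first exact: cvg_cst.
    apply: sigmoid_cvg1; rewrite /s mulr_gt0// sin_gt0_pi//; apply/andP; split.
      by rewrite mulr_gt0 ?pi_gt0// subr_gt0.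
    by rewrite gtr_pMr ?pi_gt0//; lra.
  have {}bx : b < x by rewrite lt_neqAle eq_sym xb.
  rewrite memNset; last by rewrite /= in_itv/= => /andP[_]; rewrite leNgt bx.
  suff : h x * psi n b x @[n --> \oo] --> h x * 0 by rewrite mulr0.
  apply: cvgM; first exact: cvg_cst.
  apply: sigmoid_cvg0; rewrite /s.
  rewrite (_ : pi * (b - x) = - (pi * (x - b))); last by ring.
  rewrite sinN mulrN oppr_lt0 mulr_gt0// sin_gt0_pi//; apply/andP; split.
    by rewrite mulr_gt0 ?pi_gt0// subr_gt0.
  by rewrite gtr_pMr ?pi_gt0//; lra.
- exact: intc_norm.
- apply: aeT => x n Cx; rewrite /= lee_fin normrM -[leRHS]mulr1.
  by rewrite ler_wpM2l// sigmoid_norm.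
move=> hbi _.
have -> : (\int[leb]_(x in circle) (hb x)%:E)%E = (indef h b)%:E.
  by rewrite -Eb /Rintegral fineK//; exact: integrable_fin_num.
move=> /fine_cvg cv; apply/esym; rewrite -(cvg_lim _ cv)//.
rewrite (_ : _ \o _ = cst 0) ?lim_cst//; apply/funext => n /=.
by rewrite -(H _ (psi_C1 n b)).
Qed.

(** The primitive of [h] vanishes at every interior point, and almost everywhere [h] is the
    derivative of its primitive. *)
Lemma fundamental_lemma h : intc h ->
  (forall psi, C1_circle psi -> \oint (fun x => h x * psi x) = 0) ->
  ae_eq_circle h (fun=> 0).
Proof.
move=> hi H; apply: aeS2 (indef_derive hi) ae_oo => x d o Cx.
have [_ <-] := d Cx; have /andP[x0 x1] := o Cx.
have H0 : \forall y \near x, indef h y = 0.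
  near=> y; apply: fundamental_indef => //; apply/andP; split.
    by near: y; exact: lt_nbhsr.
  by near: y; exact: lt_nbhsl.
by rewrite (near_eq_derive (g := cst 0) _ H0) derive_cst.
Unshelve. all: by end_near. Qed.

End FundamentalLemma.

(** * Uniqueness of weak derivatives and continuous representatives *)

Section WeakDerivativeUnique.
Context {R : realType}.
Let mC : measurable (@circle R) := measurable_circle.
Hint Resolve mC : core.
Implicit Types (f g h q psi : R -> R) (a b c e x y z M : R).

Lemma eq_weak_deriv f1 f2 g : (forall x, circle x -> f1 x = f2 x) ->
  weak_deriv f1 g -> weak_deriv f2 g.
Proof.
move=> ff H psi c; rewrite H// /distr_deriv; congr (- _).
by apply: eq_oint => x Cx; rewrite ff.
Qed.

Lemma C1_cst c : C1_circle (fun _ : R => c).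
Proof. by apply: (@C1_circleI _ _ (fun=> 0)) => // x; exact: cvg_cst. Qed.

Lemma weak_deriv_mean f g : weak_deriv f g -> \oint g = 0.
Proof.
move=> /(_ _ (C1_cst 1)); rewrite /distr_deriv.
under eq_Rintegral do rewrite mulr1.
move=> ->; rewrite (@eq_oint _ _ (fun=> 0)) ?oint_cst ?oppr0// => x _.
by rewrite derive1_cst mulr0.
Qed.

Lemma weak_deriv_unique f g1 g2 : in_H0 g1 -> in_H0 g2 ->
  weak_deriv f g1 -> weak_deriv f g2 -> ae_eq_circle g1 g2.
Proof.
move=> H1 H2 W1 W2.
have i1 := H0_intc H1; have i2 := H0_intc H2.
suff : ae_eq_circle (fun x => g1 x - g2 x) (fun=> 0).
  by apply: aeS => x gx Cx; have /eqP := gx Cx; rewrite subr_eq0 => /eqP.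
apply: fundamental_lemma; first exact: intcB.
move=> psi c; have cp := C1_cont c; have [M pM] := cont_bnd cp.
have mp : measurable_fun circle psi by exact: cont_meas.
rewrite (@eq_oint _ _ (fun x => g1 x * psi x - g2 x * psi x)); last by move=> x _; rewrite mulrBl.
rewrite ointB; [|exact: (intcM i1 mp pM)|exact: (intcM i2 mp pM)].
by rewrite W1// W2// subrr.
Qed.

Lemma wderivP f : in_H1 f -> in_H0 (wderiv f) /\ weak_deriv f (wderiv f).
Proof. by move=> [_ [g Hg]]; rewrite /wderiv; case: xgetP => [_ -> []//|/(_ g)]. Qed.

Lemma wderiv_ae f g : in_H0 g -> weak_deriv f g ->
  [/\ in_H0 (wderiv f), weak_deriv f (wderiv f) & ae_eq_circle (wderiv f) g].
Proof.
move=> Hg W; have [H1 W1] : in_H0 (wderiv f) /\ weak_deriv f (wderiv f).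
  by rewrite /wderiv; case: xgetP => [_ -> []//|/(_ g) []].
by split=> //; exact: weak_deriv_unique W1 W.
Qed.

(** Du Bois-Reymond: the primitive of a test function [q] is periodic only after subtracting the
    mean [m], and testing with [psi' = q - m] shows that [f] minus its mean is orthogonal to every
    [q]. *)
Lemma weak_deriv0_const f : intc f -> (forall psi, C1_circle psi ->
    \oint (fun x => f x * psi^`()%classic x) = 0) ->
  ae_eq_circle f (fun=> \oint f).
Proof.
move=> fi H.
suff : ae_eq_circle (fun x => f x - \oint f) (fun=> 0).
  by apply: aeS => x fx Cx; have /eqP := fx Cx; rewrite subr_eq0 => /eqP.
apply: fundamental_lemma; first by apply: intcB => //; exact: intc_cst.
move=> q cq; have cqc := C1_cont cq; have [per _ _] := cq.
have [M qM] := cont_bnd cqc; have mq : measurable_fun circle q by exact: cont_meas.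
have qi : intc q by exact: cont_intc.
pose m := primitive q 1.
have mE : m = \oint q by rewrite /m primitive_indef//; apply/circleP; rewrite ler01 lexx.
pose psi x := primitive q x - m * x.
have dpsi x : is_derive x 1 psi (q x - m).
  have D1 := primitive_derive x cqc.
  by apply: is_derive_eq; rewrite /GRing.scale/= mulr1.
have per' x : psi (x + 1) = psi x.
  (* Its derivative [q (y + 1) - q y] is zero, so it keeps its value [m] at 0. *)
  pose k y := primitive q (y + 1) - primitive q y.
  have dk y : is_derive y 1 k 0.
    have D1 := primitive_derive y cqc; have D2 := primitive_derive (y + 1) cqc.
    have D3 : is_derive y 1 (fun z : R => z + 1) 1 by apply: is_derive_eq; rewrite addr0.
    have D4 := is_derive1_comp (f := primitive q) (g := fun z => z + 1) D2 D3.
    by apply: (is_derive_eq (is_deriveB D4 D1)); rewrite per mulr1 subrr.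
  have := is_derive_const_eq dk x 0; rewrite /k primitive0 subr0 add0r -/m => /eqP.
  by rewrite subr_eq => /eqP E; rewrite /psi E; ring.
have Cpsi : C1_circle psi.
  apply: (C1_circleI per' dpsi) => x; apply: cvgB; [exact: cqc|exact: cvg_cst].
have := H _ Cpsi.
have -> : psi^`()%classic = (fun x => q x - m).
  by apply/funext => x; rewrite derive1E; have [_ ->] := dpsi x.
rewrite (@eq_oint _ _ (fun x => f x * q x - m * f x)); last by move=> x _; ring.
have i1 : intc (fun x => f x * q x) by exact: (intcM fi mq qM).
rewrite ointB ?ointZ//; last exact: intcZ.
move=> E.
rewrite (@eq_oint _ _ (fun x => f x * q x - (\oint f) * q x)); last by move=> x _; ring.
rewrite ointB ?ointZ//; last exact: intcZ.
by rewrite -mE mulrC.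
Qed.

(** The difference of the two sides is continuous, constant almost everywhere, and zero at 0. The
    pointwise initial condition for [u] rests on this. *)
Lemma weak_deriv_indef f g : continuous_circle f -> f 0 = 0 -> intc g ->
  weak_deriv f g -> forall x, circle x -> f x = indef g x.
Proof.
move=> [cf f01] f0 gi W.
have g0 := weak_deriv_mean W.
have mf : measurable_fun circle f by exact: subspace_continuous_measurable_fun.
have fi : intc f by apply: continuous_compact_integrable => //; exact: segment_compact.
have Gi : intc (indef g).
  apply: (@intc_bnd _ _ (\oint (fun y => `|g y|))); first exact: indef_meas.
  by move=> x; exact: indef_norm.
have W2 := indef_weak_deriv gi g0.
pose D x := f x - indef g x.
have cD : {within circle, continuous D}.
  by move=> x; apply: cvgB; [exact: cf|exact: indef_cont].
have : ae_eq_circle D (fun=> \oint D).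
  apply: weak_deriv0_const; first exact: intcB.
  move=> psi c; have := W _ c; rewrite W2// /distr_deriv => /eqP.
  have [_ _ cd] := c; have [M dM] := cont_bnd cd; have md := cont_meas (D := circle) cd.
  rewrite eqr_opp => /eqP E.
  rewrite (@eq_oint _ _ (fun x => f x * psi^`()%classic x - indef g x * psi^`()%classic x)).
    by rewrite ointB ?E ?subrr//; exact: (intcM _ md dM).
  by move=> x _; rewrite /D mulrBl.
have C0 : circle (0 : R) by apply/circleP; rewrite lexx ler01.
have cc : {within circle, continuous (fun _ : R => \oint D)} by move=> x; exact: cvg_cst.
move=> /(ae_eq_continuous cD cc) E x Cx; apply/eqP; rewrite -subr_eq0; apply/eqP.
rewrite -[LHS]/(D x) E// -(E 0 C0) /D f0 indef0 subrr//.
Qed.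

End WeakDerivativeUnique.

(** * Differentiation and continuity under the integral sign *)

Section UnderIntegral.
Context {R : realType}.
Let mC : measurable (@circle R) := measurable_circle.
Hint Resolve mC : core.
Implicit Types (f df : R -> R -> R) (G : R -> R) (s t x : R).

Lemma oint_derive f df G t : (forall s, intc (f s)) -> intc G ->
  (forall s x, circle x -> is_derive s 1 (f ^~ x) (df s x)) ->
  (forall s x, circle x -> `|df s x| <= G x) ->
  is_derive t 1 (fun s => \oint (f s)) (\oint (df t)).
Proof.
move=> fi Gi fd dG.
pose G' x := `|G x|.
have It : (`]t - 1, t + 1[%classic : set R) t by rewrite /= in_itv/=; apply/andP; split; lra.
have der s x : (`]t - 1, t + 1[%classic : set R) s -> circle x -> derivable (f ^~ x) s 1.
  by move=> _ Cx; have [] := fd s x Cx.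
have dE s x : circle x -> partial1of2 f s x = df s x.
  by move=> Cx; rewrite partial1of2E; have [_ ->] := fd s x Cx.
have ub s x : (`]t - 1, t + 1[%classic : set R) s -> circle x -> `|partial1of2 f s x| <= G' x.
  by move=> _ Cx; rewrite dE//; apply: le_trans (dG _ _ Cx) _; exact: ler_norm.
have fi' s : (`]t - 1, t + 1[%classic : set R) s -> leb.-integrable circle (EFin \o f s).
  by move=> _; exact: fi.
have Gi' : intc G' by exact: intc_norm.
have D := @derivable_under_integral R _ _ leb f circle mC t (t - 1) (t + 1) It fi' der G'
  (fun=> normr_ge0 _) Gi' ub.
have E := @differentiation_under_integral R _ _ leb f circle mC t (t - 1) (t + 1) It fi' der G'
  (fun=> normr_ge0 _) Gi' ub.
split; first exact: D.
by rewrite -derive1E E; apply: eq_oint => x Cx; rewrite dE.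
Qed.

Lemma oint_continuous f G : (forall s, measurable_fun circle (f s)) -> intc G ->
  (forall x, circle x -> continuous (f ^~ x)) ->
  (forall s x, circle x -> `|f s x| <= G x) ->
  continuous (fun s => \oint (f s)).
Proof.
move=> mf Gi cf fG t.
apply: (@continuity_under_integral R _ _ leb f circle mC (t - 1) (t + 1) _ _ G Gi).
- by move=> s _; apply: (intc_le _ (fG s)).
- by apply: aeT => x Cx s _; exact: cf.
- by move=> s _; apply: aeT => x Cx; exact: fG.
- by rewrite inE/= in_itv/=; apply/andP; split; lra.
Qed.

End UnderIntegral.

(** * Measurable sections of a monotone map and transported functions *)

Section Transport.
Context {R : realType} (w : R -> R).
Let mC : measurable (@circle R) := measurable_circle.
Hint Resolve mC : core.
Hypothesis wi : intc w.
Hypothesis w0 : forall x, circle x -> 0 <= w x.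
Hypothesis w1 : \oint w = 1.
Local Notation phi := (indef w).

(** Difference quotients along the segment from [x] to [a] vanish, and one direction suffices to
    determine the derivative. *)
Lemma is_derive_flat (F : R -> R) (l x a : R) : is_derive x 1 F l -> a != x ->
  (forall s, 0 <= s <= 1 -> F (x + s * (a - x)) = F x) -> l = 0.
Proof.
move=> [dF <-] ax flat; apply/eqP/negPn/negP => l0.
have l1 : 0 < `|'D_1 F x| by rewrite normr_gt0.
have /cvgrPdist_lt /(_ _ l1) [d /= d0 H] : h^-1 *: (F (h *: 1 + x) - F x) @[h --> 0^'] --> 'D_1 F x.
  exact: dF.
have ax0 : 0 < `|a - x| by rewrite normr_gt0 subr_eq0.
(* Short enough for the limit condition, yet the point stays on the segment. *)
pose s := Num.min 1 (d / (2 * `|a - x|)).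
have s0 : 0 < s by rewrite lt_min ltr01 divr_gt0// mulr_gt0.
have s1 : s <= 1 by rewrite ge_min lexx.
have hd : `|s * (a - x)| < d.
  rewrite normrM gtr0_norm//.
  have : s <= d / (2 * `|a - x|) by rewrite ge_min lexx orbT.
  rewrite ler_pdivlMr ?mulr_gt0//; nra.
have := H (s * (a - x)).
rewrite /= sub0r normrN => /(_ hd).
have hn0 : s * (a - x) != 0 by rewrite mulf_eq0 negb_or gt_eqF//= subr_eq0.
move=> /(_ hn0); rewrite [_ *: 1]mulr1 [_ + x]addrC flat ?s1 ?ltW// subrr scaler0 subr0.
by rewrite ltxx.
Qed.

(** A monotone map taking equal values at two points is constant between them; where its derivative
    is [w], this forces [w = 0]. It is the substitute for injectivity. *)
Lemma cov_flat_ae : {ae leb, forall x, circle x -> forall a, circle a -> a != x ->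
  phi a = phi x -> w x = 0}.
Proof.
apply: aeS (indef_derive wi) => x d Cx a Ca ax E.
apply: (is_derive_flat (d Cx) ax) => s /andP[s0 s1].
have /circleP/andP[x0 x1] := Cx; have /circleP/andP[a0 a1] := Ca.
have mono := cov_nondecr wi w0.
have [xa|ax'] := leP x a.
  have m1 : x <= x + s * (a - x) by nra.
  have m2 : x + s * (a - x) <= a by nra.
  by apply/eqP; rewrite eq_le -{1}E !mono//; lra.
have m1 : x + s * (a - x) <= x by nra.
have m2 : a <= x + s * (a - x) by nra.
by apply/eqP; rewrite eq_le -{2}E !mono//; lra.
Qed.

(** Any choice of preimages is monotone because [phi] is, and monotone functions are Borel. Clamping
    to [0, 1] makes the choice monotone on all of R. *)
Lemma cov_section : exists X : R -> R,
  [/\ measurable_fun circle X, forall y, circle y -> circle (X y)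
    & forall y, circle y -> phi (X y) = y].
Proof.
have /choice[X0 HX0] : forall y, exists x, circle y -> circle x /\ phi x = y.
  move=> y; have [Cy|nC] := pselect (circle y); last by exists 0.
  by have [x Cx E] := cov_onto wi w1 Cy; exists x.
pose clamp y : R := Num.max 0 (Num.min 1 y).
have Cc y : circle (clamp y).
  by apply/circleP; rewrite /clamp le_max lexx/= ge_max ler01 ge_min lexx.
have cid y : circle y -> clamp y = y.
  by move=> /circleP/andP[y0 y1]; rewrite /clamp (min_idPr y1) (max_idPr y0).
have cm x y : x <= y -> clamp x <= clamp y.
  move=> xy; rewrite /clamp ge_max le_max lexx/= le_max ge_min; apply/orP; right.
  by rewrite le_min !ge_min lexx xy orbT.
exists (X0 \o clamp); split.
- apply: nondecreasing_measurable => // x y xy /=.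
  have := cm x y xy; rewrite le_eqVlt => /predU1P[->//|cxy].
  rewrite leNgt; apply/negP => lt.
  have [C1 E1] := HX0 _ (Cc x); have [C2 E2] := HX0 _ (Cc y).
  move/circleP: C1 => /andP[_ u1]; move/circleP: C2 => /andP[u2 _].
  by have := cov_nondecr wi w0 u2 (ltW lt) u1; rewrite E1 E2 leNgt cxy.
- by move=> y Cy /=; have [] := HX0 _ (Cc y).
- by move=> y Cy /=; have [_ ->] := HX0 _ (Cc y); rewrite cid.
Qed.

(* [Q] is [q] composed with a measurable section of phi. Outside a null set, points
   with a common image have [w = 0], hence [q = 0]. *)
Lemma cov_push (q : R -> R) : measurable_fun circle q ->
  (forall x, circle x -> w x = 0 -> q x = 0) ->
  exists2 Q, measurable_fun circle Q & {ae leb, forall x, circle x -> Q (phi x) = q x}.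
Proof.
move=> mq q0; have [X [mX CX pX]] := cov_section.
have [N [mN N0 PN]] := cov_flat_ae.
have good x : ~ N x -> circle x -> forall a, circle a -> a != x -> phi a = phi x -> w x = 0.
  by move=> nN; apply: contrapT => /PN.
(* The indicator deals with a selected preimage lying in the null set [N], where [w] need not
   vanish. *)
exists (fun y => q (X y) * \1_(~` N) (X y)).
  apply: (measurable_comp (F := circle) (f := fun z => q z * \1_(~` N) z)) => //.
    by move=> _ [y Cy <-]; exact: CX.
  apply: measurable_funM => //; apply: measurable_funTS; apply: measurable_indic.
  exact: measurableC.
exists N; split=> // x /not_implyP[Cx H]; apply: contrapT => nN; apply: H.
have Cp := cov_range wi w0 w1 Cx.
have [Xx|Xx] := eqVneq (X (phi x)) x.
  by rewrite Xx indicE mem_set// mulr1.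
have E := pX _ Cp.
rewrite (q0 _ Cx) ?(good _ nN Cx _ (CX _ Cp) Xx E)// indicE.
have [NX|nNX] := pselect (N (X (phi x))).
  by rewrite memNset ?mulr0//= => /(_ NX).
by rewrite q0 ?mul0r//; [exact: CX|apply: (good _ nNX (CX _ Cp) x) => //; rewrite eq_sym].
Qed.

Lemma indef_oint (f : R -> R) y : circle y ->
  indef f y = \oint (fun z => f z * \1_(`[0, y]%classic) z).
Proof.
move=> /circleP/andP[y0 y1].
have E : circle `&` `[0, y] = `[0, y]%classic by apply/setIidPr; exact: sub_itv_circle.
rewrite /indef -{1}E Rintegral_mkcondr; apply: eq_oint => z _.
by rewrite patchE indicE; case: ifP => _; rewrite ?mulr1 ?mulr0.
Qed.

Lemma meas_indic_itv a b (D : set R) : measurable_fun D (fun z => \1_(`[a, b]%classic) z : R).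
Proof. by apply: measurable_funTS; exact: measurable_indic. Qed.

(** The indicator of [[0, phi x]] at [phi z] differs from that of [[0, x]] at [z] only if [z > x]
    and [phi z = phi x]; for almost every such [z], [w z = 0], and the integrals do not see the
    difference. *)
Lemma cov_indef (Q q : R -> R) x : measurable_fun circle Q -> measurable_fun circle q ->
  {ae leb, forall x, circle x -> Q (phi x) = q x} -> circle x ->
  indef Q (phi x) = indef (fun z => w z * q z) x.
Proof.
move=> mQ mq Qq Cx; have Cp := cov_range wi w0 w1 Cx; have mw := intc_meas wi.
rewrite (indef_oint Q Cp) (indef_oint (fun z => w z * q z) Cx) (cov_oint wi w0 w1); last first.
  by apply: measurable_funM => //; exact: meas_indic_itv.
apply: oint_ae.
- apply: measurable_funM => //.
  apply: (measurable_comp_cov wi w0 w1 (h := fun z => Q z * \1_(`[0, phi x]%classic) z)).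
  by apply: measurable_funM => //; exact: meas_indic_itv.
- by apply: measurable_funM; [exact: measurable_funM|exact: meas_indic_itv].
apply: aeS2 Qq cov_flat_ae => z Qz flat Cz; rewrite Qz// mulrA.
have [->|wz] := eqVneq (w z) 0; first by rewrite !mul0r.
congr (_ * _); rewrite !indicE; congr (_%:R); congr nat_of_bool.
have /circleP/andP[z0 z1] := Cz; have /circleP/andP[x0 x1] := Cx.
have /circleP/andP[pz0 pz1] := cov_range wi w0 w1 Cz.
apply/idP/idP => /[!inE] /=; rewrite !in_itv/= ?z0 ?pz0 ?andbT/=.
- move=> pzx; rewrite leNgt; apply/negP => xz.
  have pxz : phi x = phi z by apply/eqP; rewrite eq_le pzx andbT; exact: cov_nondecr (ltW xz) _.
  by move: wz; rewrite (flat Cz x Cx _ pxz) ?eqxx// lt_eqF.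
- by move=> zx; exact: cov_nondecr.
Qed.

End Transport.

(** * The flow *)

Section TrigForm.
Context {R : realType}.
Implicit Types (A B D s t x y M : R).

(** Both [wf] and its primitive [Phi] have this form, with coefficients [1, g, qf / 4] and
    [x, indef g, indef qf / 4]. Their time derivatives are thus explicit, with no differentiation
    under the integral sign. *)
Definition T0 A B D t : R := cos t ^+ 2 * A + cos t * sin t * B + sin t ^+ 2 * D.
Definition T1 A B D t : R :=
  - 2 * (cos t * sin t) * A + (cos t ^+ 2 - sin t ^+ 2) * B + 2 * (cos t * sin t) * D.
Definition T2 A B D t : R :=
  - 2 * (cos t ^+ 2 - sin t ^+ 2) * A - 4 * (cos t * sin t) * B + 2 * (cos t ^+ 2 - sin t ^+ 2) * D.

Let dcc t : is_derive t 1 (fun s : R => cos s ^+ 2) (- 2 * (cos t * sin t)).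
Proof.
have d := is_derive_cos t.
by apply: (is_derive_eq (is_deriveM d d)); rewrite /GRing.scale/=; ring.
Qed.

Let dss t : is_derive t 1 (fun s : R => sin s ^+ 2) (2 * (cos t * sin t)).
Proof.
have d := is_derive_sin t.
by apply: (is_derive_eq (is_deriveM d d)); rewrite /GRing.scale/=; ring.
Qed.

Let dcs t : is_derive t 1 (fun s : R => cos s * sin s) (cos t ^+ 2 - sin t ^+ 2).
Proof.
apply: (is_derive_eq (is_deriveM (is_derive_cos t) (is_derive_sin t))).
by rewrite /GRing.scale/=; ring.
Qed.

Let comb (f1 f2 f3 : R -> R) (d1 d2 d3 : R) A B D t : is_derive t 1 f1 d1 -> is_derive t 1 f2 d2 ->
  is_derive t 1 f3 d3 ->
  is_derive t 1 (fun s => f1 s * A + f2 s * B + f3 s * D) (d1 * A + d2 * B + d3 * D).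
Proof.
have H (f : R -> R) (d c : R) : is_derive t 1 f d -> is_derive t 1 (fun s => f s * c) (d * c).
  move=> df; apply: (is_derive_eq (is_deriveM df (is_derive_cst c t 1))).
  by rewrite /GRing.scale/= mulr0 add0r mulrC.
move=> D1 D2 D3.
exact: (is_deriveD (is_deriveD (H _ _ A D1) (H _ _ B D2)) (H _ _ D D3)).
Qed.

Lemma T0_derive A B D t : is_derive t 1 (T0 A B D) (T1 A B D t).
Proof. exact: comb (dcc t) (dcs t) (dss t). Qed.

Lemma T1_derive A B D t : is_derive t 1 (T1 A B D) (T2 A B D t).
Proof.
have d2 : is_derive t 1 (fun s : R => cos s ^+ 2 - sin s ^+ 2) (- 4 * (cos t * sin t)).
  by apply: (is_derive_eq (is_deriveB (dcc t) (dss t))); ring.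
have d1 c : is_derive t 1 (fun s : R => c * (cos s * sin s)) (c * (cos t ^+ 2 - sin t ^+ 2)).
  by apply: (is_derive_eq (is_deriveZ c (dcs t))); rewrite /GRing.scale/=.
apply: (is_derive_eq (comb A B D (d1 (- 2)) d2 (d1 2))).
by rewrite /T2; ring.
Qed.

Lemma cos2sin2 t : sin t ^+ 2 = 1 - cos t ^+ 2.
Proof. by have := cos2Dsin2 t => <-; ring. Qed.

Let cs_bnd t : `|cos t * sin t| <= 1 /\ `|cos t ^+ 2 - sin t ^+ 2| <= 1.
Proof.
have := cos2sin2 t; have := sqr_ge0 (cos t); have := sqr_ge0 (sin t).
have := sqr_ge0 (cos t - sin t); have := sqr_ge0 (cos t + sin t).
by split; rewrite ler_norml; apply/andP; split; nra.
Qed.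

Let tri (a b c A B D M : R) : `|a| <= M -> `|b| <= M -> `|c| <= M ->
  `|a * A + b * B + c * D| <= M * (`|A| + `|B| + `|D|).
Proof.
move=> ha hb hc; rewrite (le_trans (ler_normD _ _))// !mulrDr lerD//.
  by rewrite (le_trans (ler_normD _ _))// lerD// normrM ler_wpM2r.
by rewrite normrM ler_wpM2r.
Qed.

Lemma T1_bnd A B D t : `|T1 A B D t| <= 2 * (`|A| + `|B| + `|D|).
Proof.
have [/ler_normlP[c1 c1'] /ler_normlP[c2 c2']] := cs_bnd t; apply: tri.
- by rewrite ler_norml; apply/andP; split; lra.
- by rewrite ler_norml; apply/andP; split; lra.
- by rewrite ler_norml; apply/andP; split; lra.
Qed.

Lemma T2_bnd A B D t : `|T2 A B D t| <= 4 * (`|A| + `|B| + `|D|).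
Proof.
have [/ler_normlP[c1 c1'] /ler_normlP[c2 c2']] := cs_bnd t.
have -> : T2 A B D t = (- 2 * (cos t ^+ 2 - sin t ^+ 2)) * A + (- 4 * (cos t * sin t)) * B +
  (2 * (cos t ^+ 2 - sin t ^+ 2)) * D by rewrite /T2; ring.
apply: tri.
- by rewrite ler_norml; apply/andP; split; lra.
- by rewrite ler_norml; apply/andP; split; lra.
- by rewrite ler_norml; apply/andP; split; lra.
Qed.

End TrigForm.

Section Flow.
Context {R : realType} (g r : R -> R).
Let mC : measurable (@circle R) := measurable_circle.
Hint Resolve mC : core.
Hypotheses (Hg : in_H0 g) (Hr : in_H0 r) (g0 : \oint g = 0).
Hypothesis gr4 : norm_H0 g ^+ 2 + norm_H0 r ^+ 2 = 4.
Implicit Types (s t x y : R).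

(* [wf] is phi_x, [vf] and [af] are its first two time derivatives, and [4 kf] is
   the energy density u_x^2 + rho^2 in Lagrangian coordinates, see [v_sqr]. *)
Definition qf y : R := g y ^+ 2 + r y ^+ 2.
Definition wf t y : R := T0 1 (g y) (qf y / 4) t.
Definition vf t y : R := T1 1 (g y) (qf y / 4) t.
Definition kf t y : R := 1 + qf y / 4 - wf t y.
Definition af t y : R := T2 1 (g y) (qf y / 4) t.
(** Up to a constant factor, a majorant of [vf] and [af] that does not depend on time; it dominates
    the differentiations under the integral sign. *)
Definition mf y : R := 1 + `|g y| + `|qf y / 4|.
Definition Phi t x : R := indef (wf t) x.
Definition Vel t x : R := indef (vf t) x.

Lemma q_intc : intc qf. Proof. by apply: intcD; exact: H0_sqr. Qed.
Lemma q_oint : \oint qf = 4.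
Proof. by rewrite ointD; [rewrite -!norm_H0_sqr|exact: H0_sqr|exact: H0_sqr]. Qed.
Let gi : intc g := H0_intc Hg.
Let q4i : intc (fun y => qf y / 4).
Proof.
by have := intcZ 4^-1 q_intc; apply: eq_integrable => // x _; rewrite /= mulrC.
Qed.
Let q4E : \oint (fun y => qf y / 4) = 1.
Proof.
rewrite (@eq_oint _ _ (fun y => 4^-1 * qf y)); last by move=> y _; rewrite mulrC.
by rewrite ointZ ?q_oint ?mulVf//; exact: q_intc.
Qed.

Lemma m_intc : intc mf.
Proof. by apply: intcD; [apply: intcD; [exact: intc_cst|exact: intc_norm]|exact: intc_norm]. Qed.

Let comb_intc a b c : intc (fun y => a * 1 + b * g y + c * (qf y / 4)).
Proof. by apply: intcD; [apply: intcD; [exact: intc_cst|exact: intcZ]|exact: intcZ]. Qed.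

Let comb_oint a b c : \oint (fun y => a * 1 + b * g y + c * (qf y / 4)) = a + c.
Proof.
rewrite ointD; [|by apply: intcD; [exact: intc_cst|exact: intcZ]|exact: intcZ].
rewrite ointD; [|exact: intc_cst|exact: intcZ].
by rewrite oint_cst !ointZ// g0 q4E; ring.
Qed.

Let comb_indef a b c x : circle x -> indef (fun y => a * 1 + b * g y + c * (qf y / 4)) x =
  a * x + b * indef g x + c * (indef qf x / 4).
Proof.
move=> Cx; rewrite indefD//; [|by apply: intcD; [exact: intc_cst|exact: intcZ]|exact: intcZ].
rewrite indefD//; [|exact: intc_cst|exact: intcZ].
rewrite indef_cst// (indefZ b gi Cx) (indefZ c q4i Cx).
rewrite (@eq_indef _ (fun y => qf y / 4) (fun y => 4^-1 * qf y))//; last by move=> y _; rewrite mulrC.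
by rewrite indefZ//; [ring|exact: q_intc].
Qed.

Lemma w_intc t : intc (wf t). Proof. exact: comb_intc. Qed.
Lemma v_intc t : intc (vf t). Proof. exact: comb_intc. Qed.
Lemma a_intc t : intc (af t).
Proof.
have := comb_intc (- 2 * (cos t ^+ 2 - sin t ^+ 2)) (- (4 * (cos t * sin t))) (2 * (cos t ^+ 2 - sin t ^+ 2)).
by apply: eq_integrable => // y _ /=; congr EFin; rewrite /af /T2; ring.
Qed.

(** The energy normalisation gives [qf / 4] mean 1, [g] has mean 0, and [cos^2 + sin^2 = 1]. *)
Lemma w_oint t : \oint (wf t) = 1.
Proof. by rewrite [LHS]comb_oint cos2Dsin2. Qed.

Lemma v_oint t : \oint (vf t) = 0.
Proof. by rewrite [LHS]comb_oint; ring. Qed.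

Lemma k_intc t : intc (kf t).
Proof. by apply: intcB; [apply: intcD => //; exact: intc_cst|exact: w_intc]. Qed.

Lemma k_oint t : \oint (kf t) = 1.
Proof.
rewrite ointB; [|by apply: intcD => //; exact: intc_cst|exact: w_intc].
by rewrite ointD ?oint_cst ?q4E ?w_oint//; [ring|exact: intc_cst].
Qed.

Lemma w_sum t y : wf t y = (cos t + g y / 2 * sin t) ^+ 2 + r y ^+ 2 / 4 * sin t ^+ 2.
Proof. by rewrite /wf /T0 /qf; field. Qed.

Lemma k_sum t y : kf t y = (g y / 2 * cos t - sin t) ^+ 2 + r y ^+ 2 / 4 * cos t ^+ 2.
Proof.
rewrite /kf /wf /T0 /qf.
transitivity ((cos t ^+ 2 + sin t ^+ 2) * (1 + (g y ^+ 2 + r y ^+ 2) / 4)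
  - (cos t ^+ 2 + cos t * sin t * g y + sin t ^+ 2 * ((g y ^+ 2 + r y ^+ 2) / 4))); last by field.
by rewrite cos2Dsin2; field.
Qed.

Lemma w_ge0 t y : 0 <= wf t y.
Proof. by rewrite w_sum addr_ge0 ?sqr_ge0// mulr_ge0 ?divr_ge0 ?sqr_ge0. Qed.

Lemma k_ge0 t y : 0 <= kf t y.
Proof. by rewrite k_sum addr_ge0 ?sqr_ge0// mulr_ge0 ?divr_ge0 ?sqr_ge0. Qed.

Lemma a_kw t y : af t y = 2 * (kf t y - wf t y).
Proof. by rewrite /af /T2 /kf /wf /T0 cos2sin2; ring. Qed.

(* Lagrange's identity for the vectors (cos t + g/2 sin t, r/2 sin t) and
   (g/2 cos t - sin t, r/2 cos t), of determinant -r/2 *)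
Lemma v_sqr t y : vf t y ^+ 2 + r y ^+ 2 = 4 * wf t y * kf t y.
Proof.
have c2 := cos2sin2 t.
pose a := cos t + g y / 2 * sin t; pose b := r y / 2 * sin t.
pose a' := g y / 2 * cos t - sin t; pose b' := r y / 2 * cos t.
have -> : wf t y = a ^+ 2 + b ^+ 2 by rewrite w_sum /a /b; field.
have -> : kf t y = a' ^+ 2 + b' ^+ 2 by rewrite k_sum /a' /b'; field.
have -> : vf t y = 2 * (a * a' + b * b').
  by rewrite /vf /T1 /qf /a /a' /b /b'; field.
have -> : r y = 2 * (a * b' - a' * b).
  transitivity (r y * (cos t ^+ 2 + sin t ^+ 2)); first by rewrite c2; ring.
  by rewrite /a /a' /b /b'; field.
by ring.
Qed.

Lemma w_eq0 t y : wf t y = 0 -> vf t y = 0 /\ r y = 0.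
Proof.
move=> w0; have := v_sqr t y; rewrite w0 mulr0 mul0r.
have := sqr_ge0 (vf t y); have := sqr_ge0 (r y) => r0 v0 E.
by split; apply/eqP; rewrite -sqrf_eq0; apply/eqP; lra.
Qed.

Lemma PhiE t x : circle x -> Phi t x = T0 x (indef g x) (indef qf x / 4) t.
Proof. exact: comb_indef. Qed.

Lemma VelE t x : circle x -> Vel t x = T1 x (indef g x) (indef qf x / 4) t.
Proof. exact: comb_indef. Qed.

Lemma AccE t x : circle x -> indef (af t) x = T2 x (indef g x) (indef qf x / 4) t.
Proof.
move=> Cx; rewrite (@eq_indef _ _ (fun y => (- 2 * (cos t ^+ 2 - sin t ^+ 2)) * 1 +
  (- (4 * (cos t * sin t))) * g y + (2 * (cos t ^+ 2 - sin t ^+ 2)) * (qf y / 4)))//; last first.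
  by move=> y _; rewrite /af /T2; ring.
by rewrite comb_indef// /T2; ring.
Qed.

Lemma Phi_derive t x : circle x -> is_derive t 1 (Phi ^~ x) (Vel t x).
Proof.
move=> Cx; rewrite VelE// (_ : Phi ^~ x = T0 x (indef g x) (indef qf x / 4)).
  exact: T0_derive.
by apply/funext => s; rewrite PhiE.
Qed.

Lemma Vel_derive t x : circle x -> is_derive t 1 (Vel ^~ x) (indef (af t) x).
Proof.
move=> Cx; rewrite AccE// (_ : Vel ^~ x = T1 x (indef g x) (indef qf x / 4)).
  exact: T1_derive.
by apply/funext => s; rewrite VelE.
Qed.

Lemma Phi_circle t x : circle x -> circle (Phi t x).
Proof. exact: (cov_range (w_intc t) (fun y _ => w_ge0 t y) (w_oint t)). Qed.

Lemma Phi_meas t : measurable_fun circle (Phi t).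
Proof. exact: (indef_meas (w_intc t)). Qed.

Lemma Vel_meas t : measurable_fun circle (Vel t).
Proof. exact: (indef_meas (v_intc t)). Qed.

Lemma Phi_at0 t : Phi t 0 = 0. Proof. exact: indef0. Qed.
Lemma Vel_at0 t : Vel t 0 = 0. Proof. exact: indef0. Qed.

Lemma Phi_le t x y : 0 <= x -> x <= y -> y <= 1 -> Phi t x <= Phi t y.
Proof. exact: (indef_le (w_intc t) (fun z _ => w_ge0 t z)). Qed.

(* AM-GM: [v ^+ 2 <= 4 w k] gives [`|v| <= w / e + e k] *)
Let Vel_dist_le t x y e : 0 < e -> 0 <= x -> x <= y -> y <= 1 ->
  `|Vel t y - Vel t x| <= (Phi t y - Phi t x) / e + e.
Proof.
move=> e0 x0 xy y1.
have wi := w_intc t; have ki := k_intc t.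
have i1 : intc (fun z => e^-1 * wf t z + e * kf t z) by apply: intcD; exact: intcZ.
have Cx : circle x by apply/circleP; rewrite x0 (le_trans xy).
have Cy : circle y by apply/circleP; rewrite y1 (le_trans x0).
have C1 : circle (1 : R) by apply/circleP; rewrite ler01 lexx.
apply: (le_trans (indef_dist (v_intc t) i1 _ x0 xy y1)).
  move=> z _; have w0 := w_ge0 t z; have k0 := k_ge0 t z.
  have e0' : 0 < e^-1 by rewrite invr_gt0.
  have h0 : 0 <= e^-1 * wf t z + e * kf t z by rewrite addr_ge0// mulr_ge0// ltW.
  rewrite -(@ler_pXn2r _ 2)// real_normK ?num_real//.
  have := v_sqr t z; have := sqr_ge0 (r z); have := sqr_ge0 (e^-1 * wf t z - e * kf t z).
  have -> : (e^-1 * wf t z + e * kf t z) ^+ 2 =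
    (e^-1 * wf t z - e * kf t z) ^+ 2 + 4 * wf t z * kf t z by field; rewrite gt_eqF.
  lra.
rewrite !indefD ?indefZ//; try exact: intcZ.
have kx : 0 <= indef (kf t) x.
  rewrite -(indef0 (kf t)); apply: indef_le => //; first by move=> z _; exact: k_ge0.
  exact: le_trans xy y1.
have ky : indef (kf t) y <= 1.
  rewrite -(k_oint t) -indef1; apply: indef_le => //; first by move=> z _; exact: k_ge0.
  exact: le_trans x0 xy.
rewrite /Phi; have : e * (indef (kf t) y - indef (kf t) x) <= e by apply: (ler_piMr (ltW e0)); lra.
lra.
Qed.

(** The preceding bound is optimised by taking for [e] the square root of the increment of [Phi]; if
    the increment is zero, [e] tends to 0 instead. *)
Let Vel_dist_ord t x y : 0 <= x -> x <= y -> y <= 1 ->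
  `|Vel t y - Vel t x| <= 2 * Num.sqrt (Phi t y - Phi t x).
Proof.
move=> x0 xy y1; have D0 : 0 <= Phi t y - Phi t x by rewrite subr_ge0 Phi_le.
move: D0; rewrite le_eqVlt => /predU1P[D0|D0]; last first.
  have s0 : 0 < Num.sqrt (Phi t y - Phi t x) by rewrite sqrtr_gt0.
  apply: le_trans (Vel_dist_le t s0 x0 xy y1) _.
  have -> : (Phi t y - Phi t x) / Num.sqrt (Phi t y - Phi t x) = Num.sqrt (Phi t y - Phi t x).
    by rewrite -[X in X / _](sqr_sqrtr (ltW D0)) expr2 mulfK ?gt_eqF.
  lra.
rewrite -D0 sqrtr0 mulr0; apply/ler_addgt0Pr => e e0; rewrite add0r.
by apply: le_trans (Vel_dist_le t e0 x0 xy y1) _; rewrite -D0 mul0r add0r.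
Qed.

(** Source of two facts: labels with the same image have the same velocity, so that [u] is well
    defined, and [u] is Hoelder continuous in space with exponent 1/2. *)
Lemma Vel_dist t x y : circle x -> circle y ->
  `|Vel t y - Vel t x| <= 2 * Num.sqrt `|Phi t y - Phi t x|.
Proof.
move=> /circleP/andP[x0 x1] /circleP/andP[y0 y1]; have [xy|yx] := leP x y.
  by rewrite (ger0_norm (_ : 0 <= Phi t y - _)) ?subr_ge0 ?Phi_le// Vel_dist_ord.
rewrite distrC (distrC (Phi t y)) (ger0_norm (_ : 0 <= Phi t x - _)) ?subr_ge0 ?Phi_le ?(ltW yx)//.
by rewrite Vel_dist_ord// ltW.
Qed.

Lemma Vel_wd t x y : circle x -> circle y -> Phi t x = Phi t y -> Vel t x = Vel t y.
Proof.
move=> Cx Cy E; have := Vel_dist t Cx Cy; rewrite E subrr normr0 sqrtr0 mulr0 normr_le0.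
by rewrite subr_eq0 => /eqP.
Qed.

Lemma Vel_bnd t x : circle x -> `|Vel t x| <= 2.
Proof.
move=> Cx; have C0 : circle (0 : R) by apply/circleP; rewrite lexx ler01.
have := Vel_dist t C0 Cx; rewrite Vel_at0 Phi_at0 !subr0 => /le_trans; apply.
have /circleP/andP[p0 p1] := Phi_circle t Cx.
rewrite ger0_norm// -[leRHS]mulr1 ler_wpM2l//.
by rewrite -[leRHS]sqrtr1 ler_sqrt.
Qed.

Let mvt_bnd (f df : R -> R) (M s t : R) : (forall z : R, is_derive z 1 f (df z)) ->
  (forall z : R, `|df z| <= M) -> `|f t - f s| <= M * `|t - s|.
Proof.
move=> fd dM; wlog st : s t / s <= t.
  move=> H; have [|/ltW] := leP s t; first exact: H.
  by rewrite distrC (distrC t); exact: H.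
move: st; rewrite le_eqVlt => /predU1P[->|st]; first by rewrite !subrr normr0 mulr0.
have [c _ ->] := MVT st (fun z _ => fd z)
  (@continuous_subspaceT _ _ _ _ (fun z => is_derive_cont (fd z))).
by rewrite normrM ler_wpM2r.
Qed.

Lemma Phi_lip s t x : circle x -> `|Phi t x - Phi s x| <= 2 * `|t - s|.
Proof.
move=> Cx; apply: (@mvt_bnd (fun z => Phi z x) (fun z => Vel z x)) => z; [exact: Phi_derive|exact: Vel_bnd].
Qed.

(** The acceleration [indef (af z)] is at most 4 in absolute value because [|af| <= 2 kf + 2 wf] and
    both [kf] and [wf] have mean 1. *)
Lemma Vel_lip s t x : circle x -> `|Vel t x - Vel s x| <= 4 * `|t - s|.
Proof.
move=> Cx; apply: (@mvt_bnd (fun z => Vel z x) (fun z => indef (af z) x)) => z; first exact: Vel_derive.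
apply: (le_trans (indef_norm (a_intc z) Cx)).
have -> : 4 = \oint (fun y => 2 * kf z y + 2 * wf z y) :> R.
  rewrite ointD; [|exact/intcZ/k_intc|exact/intcZ/w_intc].
  by rewrite !ointZ ?k_oint ?w_oint; [ring|exact: w_intc|exact: k_intc].
apply: le_oint; [exact/intc_norm/a_intc|by apply: intcD; apply: intcZ; [exact: k_intc|exact: w_intc]|].
move=> y _; rewrite a_kw ler_norml; have := k_ge0 z y; have := w_ge0 z y.
by move=> ? ?; apply/andP; split; lra.
Qed.

End Flow.

(** * One-sided time derivatives *)

Section TimeDerivative.
Context {R : realType}.
Implicit Types (f F : R -> R) (s t x y l : R).

(** A function known for nonnegative times is compared with an extension differentiable at [t] in
    both directions, which covers [t = 0]. *)
Lemma is_tderiv_derive f F t l : (forall s, 0 <= s -> f s = F s) -> 0 <= t ->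
  is_derive t 1 F l -> is_tderiv f t l.
Proof.
move=> fF t0 [dF <-]; apply/cvgrPdist_le => e e0.
have /cvgrPdist_le /(_ _ e0) [d /= d0 H] : h^-1 *: (F (h *: 1 + t) - F t) @[h --> 0^'] --> 'D_1 F t.
  exact: dF.
exists d => //= s std st s0.
have := H (s - t); rewrite /= sub0r normrN distrC => /(_ std).
by rewrite subr_eq0 => /(_ st); rewrite [_ *: 1]mulr1 subrK !fF.
Qed.

Lemma is_tderiv_unique f t l1 l2 : 0 <= t -> is_tderiv f t l1 -> is_tderiv f t l2 -> l1 = l2.
Proof.
move=> t0 H1 H2; apply/eqP/negPn/negP => l12.
have e0 : 0 < `|l1 - l2| / 2 by rewrite divr_gt0// normr_gt0 subr_eq0.
have /cvgrPdist_lt /(_ _ e0) [d1 /= d10 K1] := H1.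
have /cvgrPdist_lt /(_ _ e0) [d2 /= d20 K2] := H2.
pose h := Num.min d1 d2 / 2.
have m0 : 0 < Num.min d1 d2 by rewrite lt_min d10.
have h0 : 0 < h by rewrite divr_gt0.
have hm : h < Num.min d1 d2 by rewrite /h; lra.
have st : t + h != t by rewrite gt_eqF// ltrDl.
have s0 : 0 <= t + h by rewrite addr_ge0// ltW.
have dist : `|t - (t + h)| = h by rewrite opprD addNKr normrN gtr0_norm.
move: (hm); rewrite lt_min => /andP[h1 h2].
have := K1 (t + h); rewrite /= dist => /(_ h1 st s0).
have := K2 (t + h); rewrite /= dist => /(_ h2 st s0).
set z := _ * _ => B1 B2.
have : `|l1 - l2| <= `|l1 - z| + `|l2 - z| by rewrite -[l1 - l2](subrKA z) (distrC l2) ler_normD.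
by lra.
Qed.

End TimeDerivative.

(** * Existence of pairs carried by the flow *)

Section FlowPairs.
Context {R : realType} (g r : R -> R).
Let mC : measurable (@circle R) := measurable_circle.
Hint Resolve mC : core.
Hypotheses (Hg : in_H0 g) (Hr : in_H0 r) (g0 : \oint g = 0).
Hypothesis gr4 : norm_H0 g ^+ 2 + norm_H0 r ^+ 2 = 4.
Implicit Types (s t x y : R).
Local Notation wf := (wf g r).
Local Notation Phi := (Phi g r).
Local Notation Vel := (Vel g r).
Let wi t : intc (wf t) := w_intc Hg Hr t.
Let w0 t : forall x, circle x -> 0 <= wf t x := fun x _ => w_ge0 g r t x.
Let w1 t : \oint (wf t) = 1 := w_oint Hg Hr g0 gr4 t.

(** One null set serves all times: [Phi t] is a combination, with coefficients depending on [t]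
    only, of [x] and two fixed primitives. *)
Lemma Phi_xderive : {ae leb, forall x, circle x -> forall t, is_derive x 1 (Phi t) (wf t x)}.
Proof.
apply: aeS2 (indef_derive (H0_intc Hg)) (aeS2 _ (indef_derive (q_intc Hg Hr)) ae_oo); last first.
  by move=> x dq ox; exact: conj dq ox.
move=> x dG [dQ ox] Cx t; have {}dG := dG Cx; have {}dQ := dQ Cx; have /andP[x0 x1] := ox Cx.
pose F y := cos t ^+ 2 * y + (cos t * sin t) * indef g y + (sin t ^+ 2 / 4) * indef (qf g r) y.
have dF : is_derive x 1 F (wf t x).
  apply: is_derive_eq; rewrite /wf /T0 /GRing.scale/=; by field.
apply: near_eq_is_derive dF; near=> y.
rewrite PhiE//; first by rewrite /F /T0; field.
apply/circleP; apply/andP; split; apply: ltW.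
  by near: y; exact: lt_nbhsr.
by near: y; exact: lt_nbhsl.
Unshelve. all: by end_near. Qed.

Lemma w_gt0 t x : r x != 0 -> 0 < wf t x.
Proof.
move=> r0; rewrite lt_def w_ge0 andbT; apply/eqP => E.
by have [_ rx] := w_eq0 E; rewrite rx eqxx in r0.
Qed.

Lemma w_tcont x : continuous (wf ^~ x).
Proof. by move=> t; exact: is_derive_cont (T0_derive _ _ _ t). Qed.

Lemma meas_inv (f : R -> R) : measurable_fun circle f -> (forall x, circle x -> 0 <= f x) ->
  measurable_fun circle (fun x => (f x)^-1).
Proof.
move=> mf f0; have mp : measurable_fun setT (fun z : R => z `^ (-1)) by exact: measurable_powR.
have : measurable_fun circle (fun x => f x `^ (-1)) by exact: measurableT_comp mp mf.
by apply: eq_measurable_fun => x /[!inE] Cx; rewrite powR_inv1 ?f0.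
Qed.

Lemma meas_divw t (q : R -> R) : measurable_fun circle q ->
  measurable_fun circle (fun x => q x / wf t x).
Proof.
by move=> mq; apply: measurable_funM => //; apply: meas_inv; [exact: intc_meas|exact: w0].
Qed.

(** This is [defines_pair] with its time derivatives evaluated, the form in which the pair is used
    from here on. *)
Definition flow_pair (u rho : R -> R -> R) : Prop :=
  [/\ forall t x, 0 <= t -> circle x -> u t (Phi t x) = Vel t x,
      forall t, 0 <= t -> measurable_fun circle (rho t)
    & forall t, 0 <= t -> {ae leb, forall x, circle x -> rho t (Phi t x) = r x / wf t x}].

(** [u] reads the velocity at a section of the flow, the choice being immaterial by [Vel_wd]. [rho]
    comes from [cov_push], which applies since [r / wf] is 0 where [wf] is, division by zero being
    zero. *)
Lemma flow_pair_exists : exists u rho, flow_pair u rho.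
Proof.
have /choice[X HX] t := cov_section (wi t) (w0 t) (w1 t).
have push t := cov_push (wi t) (w0 t) (w1 t) (meas_divw t (H0_meas Hr)).
have /choice[rho Hrho] : forall t, exists Q, measurable_fun circle Q /\
    {ae leb, forall x, circle x -> Q (Phi t x) = r x / wf t x}.
  move=> t; have [|Q mQ HQ] := push t; last by exists Q.
  by move=> x _ ->; rewrite invr0 mulr0.
exists (fun t y => Vel t (X t y)), rho; split.
- move=> t x _ Cx; have [_ CX pX] := HX t.
  have Cp := Phi_circle Hg Hr g0 gr4 t Cx.
  by apply: (Vel_wd Hg Hr g0 gr4) => //; [exact: CX|exact: pX].
- by move=> t _; have [] := Hrho t.
- by move=> t _; have [] := Hrho t.
Qed.

End FlowPairs.

(** * Evaluation of the time derivatives that define the pair *)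

Section DefinesPair.
Context {R : realType} (u0 rho0 : R -> R).
Local Notation g := (wderiv u0).
Local Notation r := rho0.
Let mC : measurable (@circle R) := measurable_circle.
Hint Resolve mC : core.
Hypotheses (Hg : in_H0 g) (Hr : in_H0 r) (g0 : \oint g = 0).
Hypothesis gr4 : norm_H0 g ^+ 2 + norm_H0 r ^+ 2 = 4.
Implicit Types (s t x y : R).
Local Notation wf := (wf g r).
Local Notation Phi := (Phi g r).
Local Notation Vel := (Vel g r).

Lemma phi_Phi t : phi u0 rho0 t = Phi t.
Proof. by apply/funext => x; apply: eq_Rintegral => y _; rewrite w_sum. Qed.

Lemma phi_tderiv t x : 0 <= t -> circle x -> is_tderiv (phi u0 rho0 ^~ x) t (Vel t x).
Proof.
move=> t0 Cx; apply: (@is_tderiv_derive _ _ (Phi ^~ x)) => //; last exact: Phi_derive.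
by move=> s _; rewrite phi_Phi.
Qed.

(** Where [r x] is nonzero, [wf] is positive at all times, so the indicator is 1 and the integrand
    is continuous in time. Where [r x = 0], [varrho] is identically zero. *)
Lemma varrho_tderiv : {ae leb, forall x, circle x -> forall t, 0 <= t ->
  is_tderiv (varrho u0 rho0 ^~ x) t (r x / wf t x)}.
Proof.
apply: aeS (Phi_xderive Hg Hr) => x d Cx t t0.
have E s : phi_x u0 rho0 s x = wf s x.
  by rewrite /phi_x phi_Phi derive1E; have [_ ->] := d Cx s.
have [rx|rx] := eqVneq (r x) 0.
  apply: (@is_tderiv_derive _ _ (fun=> 0)) => //.
    by move=> s _; rewrite /varrho rx mul0r.
  by rewrite rx mul0r; exact: is_derive_cst.
pose F s := r x * primitive (fun z => (wf z x)^-1) s.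
have cw : continuous (fun z => (wf z x)^-1).
  move=> z; apply: cvgV; first by rewrite gt_eqF// w_gt0.
  exact: w_tcont.
apply: (@is_tderiv_derive _ _ F) => //.
  move=> s s0; rewrite /varrho /F primitive_ge0//; congr (_ * _).
  apply: eq_Rintegral => z _; rewrite E indicE mem_set ?mul1r//=.
  by rewrite E w_gt0.
exact: (is_deriveZ (r x) (primitive_derive t cw)).
Qed.

Lemma defines_pairP u rho : defines_pair u0 rho0 u rho <-> flow_pair g r u rho.
Proof.
split=> -[H1 H2 H3]; split=> //.
- move=> t x t0 Cx; have := H1 t x t0 Cx; rewrite phi_Phi => H.
  exact: (is_tderiv_unique t0 H (phi_tderiv t0 Cx)).
- move=> t t0; apply: aeS2 (H3 t t0) varrho_tderiv => x K1 K2 Cx.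
  have := K1 Cx; rewrite phi_Phi => K.
  exact: (is_tderiv_unique t0 K (K2 Cx t t0)).
- by move=> t x t0 Cx; rewrite phi_Phi H1//; exact: phi_tderiv.
- move=> t t0; apply: aeS2 (H3 t t0) varrho_tderiv => x K1 K2 Cx.
  by rewrite phi_Phi K1//; exact: K2.
Qed.

End DefinesPair.

(** * The pair transported by the flow *)

Section Solution.
Context {R : realType} (g r : R -> R).
Let mC : measurable (@circle R) := measurable_circle.
Hint Resolve mC : core.
Hypotheses (Hg : in_H0 g) (Hr : in_H0 r) (g0 : \oint g = 0).
Hypothesis gr4 : norm_H0 g ^+ 2 + norm_H0 r ^+ 2 = 4.
Implicit Types (s t x y e : R) (h : R -> R).
Local Notation wf := (wf g r).
Local Notation vf := (vf g r).
Local Notation kf := (kf g r).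
Local Notation Phi := (Phi g r).
Local Notation Vel := (Vel g r).
Let wi t : intc (wf t) := w_intc Hg Hr t.
Let w0 t : forall x, circle x -> 0 <= wf t x := fun x _ => w_ge0 g r t x.
Let w1 t : \oint (wf t) = 1 := w_oint Hg Hr g0 gr4 t.
Variables (u rho : R -> R -> R).
Hypothesis Hpair : flow_pair g r u rho.

(** A candidate for u_x, built from the Lagrangian quotient before any differentiability of [u] is
    known. *)
Lemma ux_exists : exists ux : R -> R -> R, forall t, measurable_fun circle (ux t) /\
  {ae leb, forall x, circle x -> ux t (Phi t x) = vf t x / wf t x}.
Proof.
have /choice[ux H] : forall t, exists Q, measurable_fun circle Q /\
  {ae leb, forall x, circle x -> Q (Phi t x) = vf t x / wf t x}; last by exists ux.
move=> t; have [||Q mQ HQ] := cov_push (wi t) (w0 t) (w1 t) (q := fun x => vf t x / wf t x).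
- apply: (meas_divw Hg Hr); exact: intc_meas (v_intc Hg Hr t).
- by move=> x _ ->; rewrite invr0 mulr0.
- by exists Q.
Qed.

Variable ux : R -> R -> R.
Hypothesis Hux : forall t, measurable_fun circle (ux t) /\
  {ae leb, forall x, circle x -> ux t (Phi t x) = vf t x / wf t x}.

Lemma intc_ae (f1 f2 : R -> R) : intc f1 -> measurable_fun circle f2 ->
  ae_eq_circle f1 f2 -> intc f2.
Proof.
move=> i1 m2 f12; have m1 := intc_meas i1; apply/integrableP; split.
  exact/measurable_EFinP.
move/integrableP : i1 => [_]; congr (_ < _)%E.
apply: ge0_ae_eq_integral => //.
- by apply/measurable_EFinP; apply: measurableT_comp.
- by apply/measurable_EFinP; apply: measurableT_comp.
- by apply: aeS f12 => x fx Cx; rewrite /= fx.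
Qed.

Let rho_meas t : 0 <= t -> measurable_fun circle (rho t).
Proof. by case: Hpair => _ + _; exact. Qed.

Let rho_Phi t : 0 <= t -> {ae leb, forall x, circle x -> rho t (Phi t x) = r x / wf t x}.
Proof. by case: Hpair => _ _; exact. Qed.

Let u_Phi t x : 0 <= t -> circle x -> u t (Phi t x) = Vel t x.
Proof. by case: Hpair => + _ _; exact. Qed.

Definition vanish t : set R := [set x | circle x /\ wf t x = 0].

Lemma measurable_vanish t : measurable (vanish t).
Proof.
have -> : vanish t = circle `&` wf t @^-1` [set 0] by [].
exact: (intc_meas (wi t)).
Qed.

Let meas_indic_vanish t (D : set R) : measurable_fun D (fun x => \1_(vanish t) x : R).
Proof. by apply: measurable_funTS; apply: measurable_indic; exact: measurable_vanish. Qed.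

Let kvan_intc t : intc (fun x => kf t x * \1_(vanish t) x).
Proof.
apply: (@intcM _ _ _ 1); [exact: k_intc|exact: meas_indic_vanish|].
by move=> x _; rewrite indicE; case: (_ \in _); rewrite ?normr1 ?normr0.
Qed.

Let ef t y := ux t y ^+ 2 + rho t y ^+ 2.

Let ef_meas t : 0 <= t -> measurable_fun circle (ef t).
Proof.
move=> t0; apply: measurable_funD; apply: measurable_funX; last exact: rho_meas.
by have [] := Hux t.
Qed.

(** By [v_sqr] the transported density is [4 kf] wherever [wf] is nonzero; on [vanish t] the factor
    [wf] kills it. The subtracted term is the energy lost. *)
Let ef_Phi t : 0 <= t -> ae_eq_circle (fun x => 4 * kf t x - 4 * (kf t x * \1_(vanish t) x))
  (fun x => wf t x * ef t (Phi t x)).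
Proof.
move=> t0; have [_ U] := Hux t; apply: aeS2 U (rho_Phi t0) => x Ux Rx Cx.
rewrite /ef Ux// Rx// indicE; have [E|E] := eqVneq (wf t x) 0.
  by rewrite mem_set//= E mul0r mulr1 subrr.
rewrite memNset; last by move=> [_ /eqP]; rewrite (negbTE E).
have := v_sqr g r t x => V.
have -> : wf t x * ((vf t x / wf t x) ^+ 2 + (r x / wf t x) ^+ 2) =
  (vf t x ^+ 2 + r x ^+ 2) / wf t x by field.
by rewrite V /= !mulr0 subr0; field.
Qed.

Lemma energy_intc t : 0 <= t -> intc (ef t).
Proof.
move=> t0; apply/(cov_intc (wi t) (w0 t) (w1 t) (ef_meas t0)).
apply: (intc_ae _ _ (ef_Phi t0)); first by apply: intcB; apply: intcZ; [exact: k_intc|exact: kvan_intc].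
apply: measurable_funM; first exact: intc_meas.
exact: (measurable_comp_cov (wi t) (w0 t) (w1 t) (ef_meas t0)).
Qed.

Lemma energy_oint t : 0 <= t ->
  \oint (ef t) = 4 - 4 * \oint (fun x => kf t x * \1_(vanish t) x).
Proof.
move=> t0; rewrite (cov_oint (wi t) (w0 t) (w1 t) (ef_meas t0)).
rewrite -(oint_ae _ _ (ef_Phi t0)).
- rewrite ointB ?ointZ ?(k_oint Hg Hr g0 gr4) ?mulr1//; try exact: intcZ; try exact: kvan_intc;
    try exact: k_intc; exact/intcZ/k_intc.
- apply: intc_meas; apply: intcB; apply: intcZ; [exact: k_intc|exact: kvan_intc].
- apply: measurable_funM; first exact: intc_meas.
  exact: (measurable_comp_cov (wi t) (w0 t) (w1 t) (ef_meas t0)).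
Qed.

Lemma ux_H0 t : 0 <= t -> in_H0 (ux t).
Proof.
move=> t0; have [mu _] := Hux t; split=> //; apply: (intc_le _ _ (energy_intc t0)).
  exact: measurable_funX.
by move=> x _; rewrite ger0_norm ?sqr_ge0// lerDl sqr_ge0.
Qed.

Lemma rho_H0 t : 0 <= t -> in_H0 (rho t).
Proof.
move=> t0; split; first exact: rho_meas.
apply: (intc_le _ _ (energy_intc t0)); first by apply: measurable_funX; exact: rho_meas.
by move=> x _; rewrite ger0_norm ?sqr_ge0// lerDr sqr_ge0.
Qed.

Lemma energy_norm2 t : 0 <= t -> norm_H0 (ux t) ^+ 2 + norm_H0 (rho t) ^+ 2 =
  4 - 4 * \oint (fun x => kf t x * \1_(vanish t) x).
Proof.
move=> t0; rewrite -energy_oint// !norm_H0_sqr -ointD//; last exact: H0_sqr (rho_H0 t0).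
exact: H0_sqr (ux_H0 t0).
Qed.

Lemma energy_le4 t : 0 <= t -> norm_H0 (ux t) ^+ 2 + norm_H0 (rho t) ^+ 2 <= 4.
Proof.
move=> t0; rewrite energy_norm2// lerBlDr lerDl mulr_ge0// oint_ge0// => x _.
by rewrite mulr_ge0 ?k_ge0.
Qed.

Lemma ux_norm t : 0 <= t -> norm_H0 (ux t) <= 2.
Proof.
move=> t0; have := energy_le4 t0; have := norm_H0_ge0 (ux t); have := sqr_ge0 (norm_H0 (rho t)).
by nra.
Qed.

Lemma rho_norm t : 0 <= t -> norm_H0 (rho t) <= 2.
Proof.
move=> t0; have := energy_le4 t0; have := norm_H0_ge0 (rho t); have := sqr_ge0 (norm_H0 (ux t)).
by nra.
Qed.

(** On [vanish t] one has [r = 0] and [g = -2 cot t], whence [kf = (cos^2 t / sin t + sin t)^2 = 1 /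
    sin^2 t] is constant there. *)
Lemma vanish_oint t : sin t != 0 ->
  \oint (fun x => kf t x * \1_(vanish t) x) = (sin t ^+ 2)^-1 * fine (leb (vanish t)).
Proof.
move=> st; rewrite (@eq_oint _ _ (fun x => (sin t ^+ 2)^-1 * \1_(vanish t) x)); last first.
  move=> x Cx; rewrite indicE; have [E|E] := eqVneq (wf t x) 0; last first.
    by rewrite memNset ?mulr0// => -[_ /eqP]; rewrite (negbTE E).
  rewrite mem_set// !mulr1; have [_ r0] := w_eq0 E.
  have gE : g x = - 2 * (cos t / sin t).
    move: E; rewrite w_sum r0 expr0n/= !mul0r addr0 => /eqP.
    rewrite sqrf_eq0 => /eqP E; have -> : g x = (cos t + g x / 2 * sin t) * (2 / sin t) - 2 * (cos t / sin t).
      by field.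
    by rewrite E mul0r sub0r mulNr.
  rewrite k_sum r0 expr0n/= !mul0r addr0 gE.
  transitivity ((cos t ^+ 2 + sin t ^+ 2) ^+ 2 / sin t ^+ 2); first by field.
  by rewrite cos2Dsin2 expr1n mul1r.
rewrite ointZ; last first.
  apply: (@intc_bnd _ _ 1); first exact: meas_indic_vanish.
  by move=> x _; rewrite indicE; case: (_ \in _); rewrite ?normr1 ?normr0.
congr (_ * _); congr fine; have mv := measurable_vanish t.
transitivity (leb (vanish t `&` circle)).
  by apply: integral_indic => //.
by congr (leb _); apply/setIidPl => x [].
Qed.

Lemma vanish_sin0 t : sin t = 0 -> vanish t = set0.
Proof.
move=> s0; apply/seteqP; split=> // x [_]; rewrite w_sum s0.
have := cos2Dsin2 t; rewrite s0 expr0n/= addr0 => c2.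
by rewrite !mulr0 !addr0 c2 => /eqP; rewrite oner_eq0.
Qed.

Lemma vanishE t : sin t != 0 -> vanish t =
  [set x | circle x /\ g x = - 2 * (cos t / sin t)] `&` [set x | circle x /\ r x = 0].
Proof.
move=> st; apply/seteqP; split=> x /=.
  move=> [Cx E]; have [_ r0] := w_eq0 E; split; split=> //.
  move: E; rewrite w_sum r0 expr0n/= !mul0r addr0 => /eqP.
  rewrite sqrf_eq0 => /eqP E; have -> : g x = (cos t + g x / 2 * sin t) * (2 / sin t) - 2 * (cos t / sin t).
    by field.
  by rewrite E mul0r sub0r mulNr.
by move=> [[Cx gE] [_ r0]]; split=> //; rewrite w_sum gE r0; field.
Qed.

(** The Jacobian [wf] cancels the denominator of the quotient, and where [wf] is zero so is [vf].
    For smooth [h], time enters the right side only through explicitly differentiable functions. *)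
Lemma ux_test t h : measurable_fun circle h ->
  \oint (fun y => ux t y * h y) = \oint (fun x => vf t x * h (Phi t x)).
Proof.
move=> mh; have [mu U] := Hux t.
have mhP := measurable_comp_cov (wi t) (w0 t) (w1 t) mh.
rewrite (cov_oint (wi t) (w0 t) (w1 t)); last exact: measurable_funM.
apply: oint_ae.
- apply: measurable_funM; first exact: intc_meas.
  apply: (measurable_comp_cov (wi t) (w0 t) (w1 t) (h := fun y => ux t y * h y)).
  exact: measurable_funM.
- by apply: measurable_funM => //; exact: intc_meas (v_intc Hg Hr t).
apply: aeS U => x Ux Cx; rewrite /= Ux//.
have [E|E] := eqVneq (wf t x) 0; last by field.
by have [v0 _] := w_eq0 E; rewrite E v0 !mul0r.
Qed.

Lemma rho_test t h : 0 <= t -> measurable_fun circle h ->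
  \oint (fun y => rho t y * h y) = \oint (fun x => r x * h (Phi t x)).
Proof.
move=> t0 mh; have mr := rho_meas t0.
have mhP := measurable_comp_cov (wi t) (w0 t) (w1 t) mh.
rewrite (cov_oint (wi t) (w0 t) (w1 t)); last exact: measurable_funM.
apply: oint_ae.
- apply: measurable_funM; first exact: intc_meas.
  apply: (measurable_comp_cov (wi t) (w0 t) (w1 t) (h := fun y => rho t y * h y)).
  exact: measurable_funM.
- by apply: measurable_funM => //; exact: H0_meas.
apply: aeS (rho_Phi t0) => x Ux Cx; rewrite /= Ux//.
have [E|E] := eqVneq (wf t x) 0; last by field.
by have [_ r0] := w_eq0 E; rewrite E r0 !mul0r.
Qed.

Let Phi_onto t y : circle y -> exists2 x, circle x & Phi t x = y.
Proof. exact: (cov_onto (wi t) (w1 t)). Qed.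

(** [Vel] is the primitive of [vf = wf (vf / wf)], and [cov_indef] carries this primitive to the
    image side. *)
Lemma u_indef t y : 0 <= t -> circle y -> u t y = indef (ux t) y.
Proof.
move=> t0 Cy; have [x Cx <-] := Phi_onto t Cy; rewrite u_Phi//.
have [mu U] := Hux t.
have mq : measurable_fun circle (fun x => vf t x / wf t x).
  by apply: (meas_divw Hg Hr); exact: intc_meas (v_intc Hg Hr t).
have /= -> := cov_indef (wi t) (w0 t) (w1 t) mu mq U Cx.
apply: eq_indef => // z Cz; have [E|E] := eqVneq (wf t z) 0; last by field.
by have [v0 _] := w_eq0 E; rewrite E v0 !mul0r.
Qed.

Lemma ux_oint t : 0 <= t -> \oint (ux t) = 0.
Proof.
move=> t0; have mc : measurable_fun circle (fun _ : R => 1 : R) by exact: measurable_cst.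
have := ux_test t mc; rewrite (@eq_oint _ _ (ux t)); last by move=> x _; rewrite mulr1.
move=> ->; rewrite (@eq_oint _ _ (vf t)); last by move=> x _; rewrite mulr1.
exact: v_oint.
Qed.

Lemma u_weak_deriv t : 0 <= t -> weak_deriv (u t) (ux t).
Proof.
move=> t0; apply: (@eq_weak_deriv _ (indef (ux t))).
  by move=> x Cx; rewrite u_indef.
by apply: indef_weak_deriv; [exact: H0_intc (ux_H0 t0)|exact: ux_oint].
Qed.

Lemma u_bnd t y : 0 <= t -> circle y -> `|u t y| <= 2.
Proof.
move=> t0 Cy; have [x Cx <-] := Phi_onto t Cy; rewrite u_Phi//; exact: (Vel_bnd Hg Hr g0 gr4).
Qed.

Lemma u_holder t y z : 0 <= t -> circle y -> circle z ->
  `|u t y - u t z| <= 2 * Num.sqrt `|y - z|.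
Proof.
move=> t0 Cy Cz; have [x Cx <-] := Phi_onto t Cy; have [x' Cx' <-] := Phi_onto t Cz.
by rewrite !u_Phi//; exact: (Vel_dist Hg Hr g0 gr4).
Qed.

(** Comparison along a trajectory: the velocity at a fixed label is Lipschitz in time, and the
    displacement, at most [2 |t - s|], enters through the Hoelder bound in space. *)
Lemma u_time t s y : 0 <= t -> 0 <= s -> circle y ->
  `|u t y - u s y| <= 4 * `|t - s| + 2 * Num.sqrt (2 * `|t - s|).
Proof.
move=> t0 s0 Cy; have [x Cx <-] := Phi_onto t Cy; rewrite u_Phi//.
have Cs : circle (Phi s x) by exact: Phi_circle.
have Ct : circle (Phi t x) by exact: Phi_circle.
have -> : Vel t x - u s (Phi t x) = (Vel t x - Vel s x) + (u s (Phi s x) - u s (Phi t x)).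
  by rewrite (u_Phi s0 Cx); ring.
rewrite (le_trans (ler_normD _ _))// lerD//; first exact: (Vel_lip Hg Hr g0 gr4).
apply: (le_trans (u_holder s0 Cs Ct)).
by rewrite ler_wpM2l// ler_wsqrtr// distrC; exact: (Phi_lip Hg Hr g0 gr4).
Qed.

Lemma u_meas t : 0 <= t -> measurable_fun circle (u t).
Proof.
move=> t0; apply: (@eq_measurable_fun _ _ _ _ _ (indef (ux t))).
  by move=> x /[!inE] Cx; rewrite u_indef.
exact: (indef_meas (H0_intc (ux_H0 t0))).
Qed.

Lemma u_H0 t : 0 <= t -> in_H0 (u t).
Proof. by move=> t0; apply: (H0_bnd (u_meas t0)) => y; exact: u_bnd. Qed.

Lemma u_at0 t : 0 <= t -> u t 0 = 0.
Proof.
move=> t0; have C0 : circle (0 : R) by apply/circleP; rewrite lexx ler01.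
by rewrite u_indef// indef0.
Qed.

Lemma u_at1 t : 0 <= t -> u t 1 = 0.
Proof.
move=> t0; have C1 : circle (1 : R) by apply/circleP; rewrite lexx ler01.
by rewrite u_indef// indef1 ux_oint.
Qed.

Lemma u_H1 t : 0 <= t -> in_H1 (u t).
Proof.
by move=> t0; split; [exact: u_H0|exists (ux t); split; [exact: ux_H0|exact: u_weak_deriv]].
Qed.

Lemma u_wderiv t : 0 <= t ->
  [/\ in_H0 (wderiv (u t)), weak_deriv (u t) (wderiv (u t)) & ae_eq_circle (wderiv (u t)) (ux t)].
Proof. by move=> t0; apply: wderiv_ae; [exact: ux_H0|exact: u_weak_deriv]. Qed.

End Solution.

(** * Times of full energy *)

Section DisjointFamilies.
Context {R : realType}.

(** Infinitely many members of measure greater than [1 / (n + 1)] are impossible: any [n + 1] of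
    them, being disjoint, would have total measure above 1. *)
Lemma disjoint_countable (A : R -> set R) (D : set R) :
  (forall t, D t -> measurable (A t)) -> (forall t, A t `<=` circle) -> trivIset D A ->
  countable [set t | D t /\ 0 < fine (leb (A t))].
Proof.
move=> mA Ac tA.
rewrite [X in countable X](_ : _ =
    \bigcup_n [set t | D t /\ n.+1%:R^-1 < fine (leb (A t))]); last first.
  apply/seteqP; split=> [t/= [Dt /ltr_add_invr[k /[!add0r] kt]]|t/= [k _ [Dt kt]]].
    by exists k.
  by split=> //; exact: lt_trans kt.
apply: bigcup_countable => // n _; apply: finite_set_countable.
apply: contrapT => /infiniteP/pcard_leP/injfunPex[/= q q_fun q_inj].
have Dq k : D (q k) by have [] := q_fun k I.
have fin k : leb (A (q k)) \is a fin_num.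
  rewrite ge0_fin_numE//; apply: le_lt_trans leb_circle_lty.
  by apply: le_measure; rewrite ?inE//; [exact: mA|exact: measurable_circle].
have mU : measurable (\bigcup_k A (q k)) by apply: bigcup_measurable => k _; exact: mA.
have : (leb (\bigcup_k A (q k)) <= leb (@circle R))%E.
  by apply: le_measure; rewrite ?inE//; [exact: measurable_circle|apply: bigcup_sub => k _; exact: Ac].
rewrite [X in (_ <= X)%E](leb_circle) leNgt => /negP; apply.
rewrite [ltRHS](_ : _ = (\sum_(0 <= k <oo) leb (A (q k)))%E); last first.
  rewrite measure_bigcup//; first by apply: eq_eseriesl => // i; rewrite in_setT.
  - by move=> k _; exact: mA.
  - apply/trivIsetP => i j _ _ ij; move/trivIsetP : tA; apply => //.
    by apply: contra ij => /eqP /q_inj -> //; rewrite inE.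
apply: (lt_le_trans _ (nneseries_lim_ge n.+1 _)) => //.
rewrite -EFin_sum_fine//.
rewrite lte_fin (_ : 1%R = (\sum_(0 <= k < n.+1) n.+1%:R^-1:R)%R); last first.
  by rewrite sumr_const_nat subn0 -[RHS]mulr_natr mulVf.
by apply: ltr_sum => // k _; have [] := q_fun k I.
Qed.

End DisjointFamilies.

(** * Null vanishing sets and time regularity of test integrals *)

Section GoodTimes.
Context {R : realType} (g r : R -> R).
Let mC : measurable (@circle R) := measurable_circle.
Hint Resolve mC : core.
Hypotheses (Hg : in_H0 g) (Hr : in_H0 r) (g0 : \oint g = 0).
Hypothesis gr4 : norm_H0 g ^+ 2 + norm_H0 r ^+ 2 = 4.
Implicit Types (s t x y e : R) (h : R -> R).
Local Notation wf := (wf g r).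
Local Notation vf := (vf g r).
Local Notation kf := (kf g r).
Local Notation af := (af g r).
Local Notation Phi := (Phi g r).
Local Notation Vel := (Vel g r).
Local Notation vanish := (vanish g r).

(** At a common point [r = 0], so at both times [(cos, sin)] is orthogonal to [(1, g / 2)]. The two
    vectors are then parallel and [sin (t - s) = 0], which a gap in ]0, 1[ excludes. *)
Lemma vanish_disjoint s t : s < t < s + 1 -> vanish s `&` vanish t = set0.
Proof.
move=> /andP[st ts]; apply/seteqP; split=> // x [[Cx Es] [_ Et]].
have [_ r0] := w_eq0 Es.
have Z z : wf z x = 0 -> cos z = - (g x / 2 * sin z).
  rewrite w_sum r0 expr0n/= !mul0r addr0 => /eqP; rewrite sqrf_eq0 addr_eq0 => /eqP //.
have p2 := pi_ge2 R.
have : 0 < sin (t - s) by rewrite sin_gt0_pi//; apply/andP; split; lra.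
rewrite sinB (Z _ Es) (Z _ Et) => h.
by move: h; rewrite (_ : _ - _ = 0) ?ltxx//; ring.
Qed.

Lemma good_time_ae : {ae leb, forall t : R, 0 <= t -> leb (vanish t) = 0%E}.
Proof.
(* Two distinct times in the same half-open unit interval are less than 1 apart, as
   [vanish_disjoint] requires. *)
pose D (n : nat) : set R := `[n%:R, n.+1%:R[%classic.
pose B n : set R := [set t | D n t /\ 0 < fine (leb (vanish t))].
have cB n : countable (B n).
  apply: disjoint_countable.
  - by move=> t _; exact: measurable_vanish.
  - by move=> t x [].
  - apply/trivIsetP => s t; rewrite /D /= !in_itv/= => /andP[s0 s1] /andP[t0 t1] st.
    have n1 : n.+1%:R = n%:R + 1 :> R by rewrite -natr1.
    have [lt|lt|E] := ltgtP s t; last by rewrite E eqxx in st.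
    - by apply: vanish_disjoint; rewrite lt/=; lra.
    - by rewrite setIC; apply: vanish_disjoint; rewrite lt/=; lra.
have cU : countable (\bigcup_n B n) by apply: bigcup_countable.
exists (\bigcup_n B n); split.
- by apply: bigcupT_measurable => n; exact: countable_measurable.
- exact: countable_lebesgue_measure0.
move=> t /not_implyP[t0 /eqP nz]; exists (Num.truncn t) => //; split.
  by rewrite /D /= in_itv/= truncn_itv.
rewrite fine_gt0// lt0e nz/= measure_ge0/=.
apply: le_lt_trans (leb_circle_lty : (_ < +oo)%E).
apply: le_measure; rewrite ?inE//; last by move=> x [].
exact: measurable_vanish.
Qed.

Lemma good_defect t : leb (vanish t) = 0%E ->
  \oint (fun x => kf t x * \1_(vanish t) x) = 0.
Proof.
move=> z; rewrite -[RHS](oint_cst 0); apply: oint_ae.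
- apply: measurable_funM; first exact: intc_meas (k_intc Hg Hr t).
  by apply: measurable_funTS; apply: measurable_indic; exact: measurable_vanish.
- exact: measurable_cst.
exists (vanish t); split => //; first exact: measurable_vanish.
move=> x /not_implyP[Cx]; apply: contra_notP => nv.
by rewrite indicE memNset ?mulr0.
Qed.

Variables (psi dpsi : R -> R).
Hypothesis psiD : forall y : R, is_derive y 1 psi (dpsi y).
Hypothesis dpsi_cont : continuous dpsi.
Let psi_cont : continuous psi. Proof. by move=> y; exact: is_derive_cont (psiD y). Qed.

Let comp_meas h t : continuous h -> measurable_fun circle (fun x => h (Phi t x)).
Proof.
by move=> ch; apply: cont_meas_comp => //; exact: Phi_meas.
Qed.

Let v_bnd t x : `|vf t x| <= 2 * mf g r x.
Proof. by have := T1_bnd 1 (g x) (qf g r x / 4) t; rewrite normr1. Qed.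

Let a_bnd t x : `|af t x| <= 4 * mf g r x.
Proof. by have := T2_bnd 1 (g x) (qf g r x / 4) t; rewrite normr1. Qed.

Let m_ge0 x : 0 <= mf g r x.
Proof. by rewrite /mf !addr_ge0. Qed.

Let Phi_tcont x : circle x -> continuous (Phi ^~ x).
Proof. by move=> Cx t; exact: is_derive_cont (Phi_derive Hg Hr t Cx). Qed.

Let Vel_tcont x : circle x -> continuous (Vel ^~ x).
Proof. by move=> Cx t; exact: is_derive_cont (Vel_derive Hg Hr t Cx). Qed.

Let comp_tcont h x : continuous h -> circle x -> continuous (fun t => h (Phi t x)).
Proof. by move=> ch Cx t; apply: continuous_comp; [exact: Phi_tcont|exact: ch]. Qed.

Let comp_derive x t : circle x -> is_derive t 1 (fun s => psi (Phi s x)) (dpsi (Phi t x) * Vel t x).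
Proof.
move=> Cx.
exact: (is_derive1_comp (f := psi) (g := fun s => Phi s x) (psiD _) (Phi_derive Hg Hr t Cx)).
Qed.

Lemma rho_test_derive t : is_derive t 1 (fun s => \oint (fun x => r x * psi (Phi s x)))
  (\oint (fun x => r x * (dpsi (Phi t x) * Vel t x))).
Proof.
have [B pB] := cont_bnd psi_cont; have [B' dB] := cont_bnd dpsi_cont.
have ri := H0_intc Hr.
apply: (@oint_derive _ (fun s x => r x * psi (Phi s x)) (fun s x => r x * (dpsi (Phi s x) * Vel s x))
  (fun x => (B' * 2) * `|r x|)).
- move=> s; apply: (@intcM _ _ _ B) => //; first exact: comp_meas.
  by move=> x Cx; apply: pB; exact: Phi_circle.
- exact/intcZ/intc_norm.
- move=> s x Cx.
  by apply: (is_derive_eq (is_deriveZ (r x) (comp_derive s Cx))).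
- move=> s x Cx; rewrite normrM mulrC ler_wpM2r// normrM ler_pM//.
    by apply: dB; exact: Phi_circle.
  exact: Vel_bnd.
Qed.

Lemma rho_test_cont h : continuous h -> continuous (fun s => \oint (fun x => r x * h (Phi s x))).
Proof.
move=> ch; have [B hB] := cont_bnd ch; have ri := H0_intc Hr.
apply: (@oint_continuous _ (fun s x => r x * h (Phi s x)) (fun x => B * `|r x|)).
- by move=> s; apply: measurable_funM; [exact: intc_meas|exact: comp_meas].
- exact/intcZ/intc_norm.
- by move=> x Cx s; apply: cvgM; [exact: cvg_cst|exact: comp_tcont].
- by move=> s x Cx; rewrite normrM mulrC ler_wpM2r//; apply: hB; exact: Phi_circle.
Qed.

Lemma ux_test_cont h : continuous h -> continuous (fun s => \oint (fun x => vf s x * h (Phi s x))).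
Proof.
move=> ch; have [B hB] := cont_bnd ch.
apply: (@oint_continuous _ (fun s x => vf s x * h (Phi s x)) (fun x => B * (2 * mf g r x))).
- by move=> s; apply: measurable_funM; [exact: intc_meas (v_intc Hg Hr s)|exact: comp_meas].
- exact/intcZ/intcZ/m_intc.
- move=> x Cx s; apply: cvgM; last exact: comp_tcont.
  exact: is_derive_cont (T1_derive _ _ _ s).
- move=> s x Cx; rewrite normrM mulrC; apply: ler_pM => //.
  by apply: hB; exact: Phi_circle.
Qed.

(** Time derivative of the integral of [ux] against [psi], in Lagrangian coordinates; it is
    continuous also across times of energy defect. *)
Definition ux_test_rate t := \oint (fun x => af t x * psi (Phi t x) + vf t x * (dpsi (Phi t x) * Vel t x)).

Lemma ux_test_derive t : is_derive t 1 (fun s => \oint (fun x => vf s x * psi (Phi s x))) (ux_test_rate t).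
Proof.
have [B pB] := cont_bnd psi_cont; have [B' dB] := cont_bnd dpsi_cont.
have C0 : circle (0 : R) by apply/circleP; rewrite lexx ler01.
have B'0 : 0 <= B' by apply: le_trans (dB 0 C0).
apply: (@oint_derive _ (fun s x => vf s x * psi (Phi s x))
  (fun s x => af s x * psi (Phi s x) + vf s x * (dpsi (Phi s x) * Vel s x))
  (fun x => B * (4 * mf g r x) + (B' * 2) * (2 * mf g r x))).
- move=> s; apply: (@intcM _ _ _ B); [exact: v_intc|exact: comp_meas|].
  by move=> x Cx; apply: pB; exact: Phi_circle.
- by apply: intcD; apply/intcZ/intcZ/m_intc.
- move=> s x Cx.
  apply: (is_derive_eq (is_deriveM (T1_derive 1 (g x) (qf g r x / 4) s) (comp_derive s Cx))).
  by rewrite /GRing.scale/= [RHS]addrC (mulrC (af s x)).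
- move=> s x Cx; rewrite (le_trans (ler_normD _ _))// lerD// normrM mulrC.
    apply: ler_pM => //; by apply: pB; exact: Phi_circle.
  apply: ler_pM => //; rewrite normrM; apply: ler_pM => //; last exact: Vel_bnd.
  by apply: dB; exact: Phi_circle.
Qed.

Lemma ux_test_rate_cont : continuous ux_test_rate.
Proof.
have [B pB] := cont_bnd psi_cont; have [B' dB] := cont_bnd dpsi_cont.
apply: (@oint_continuous _ (fun s x => af s x * psi (Phi s x) + vf s x * (dpsi (Phi s x) * Vel s x))
  (fun x => B * (4 * mf g r x) + (B' * 2) * (2 * mf g r x))).
- move=> s; apply: measurable_funD; apply: measurable_funM.
  + exact: intc_meas (a_intc Hg Hr s).
  + exact: comp_meas.
  + exact: intc_meas (v_intc Hg Hr s).
  + by apply: measurable_funM; [exact: comp_meas|exact: Vel_meas].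
- by apply: intcD; apply/intcZ/intcZ/m_intc.
- move=> x Cx s; apply: cvgD; apply: cvgM.
  + have E : af ^~ x = (fun z => 2 * (1 + qf g r x / 4) - 4 * wf z x).
      by apply/funext => z; rewrite a_kw /kf; ring.
    have D2 : is_derive s 1 (fun z => 2 * (1 + qf g r x / 4) - 4 * wf z x) _ :=
      is_deriveB (is_derive_cst (2 * (1 + qf g r x / 4)) s 1)
      (is_deriveZ 4 (T0_derive 1 (g x) (qf g r x / 4) s)).
    suff : {for s, continuous (af ^~ x)} by [].
    by rewrite E; exact: is_derive_cont D2.
  + exact: comp_tcont.
  + exact: is_derive_cont (T1_derive _ _ _ s).
  + by apply: cvgM; [exact: comp_tcont|exact: Vel_tcont].
- move=> s x Cx; rewrite (le_trans (ler_normD _ _))// lerD// normrM mulrC.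
    apply: ler_pM => //; by apply: pB; exact: Phi_circle.
  apply: ler_pM => //; rewrite normrM; apply: ler_pM => //; last exact: Vel_bnd.
  by apply: dB; exact: Phi_circle.
Qed.

End GoodTimes.

(** * Hilbert space estimates *)

Section Hilbert.
Context {R : realType}.
Let mC : measurable (@circle R) := measurable_circle.
Hint Resolve mC : core.
Implicit Types (f h : R -> R) (F : R -> R -> R) (s t x y e d : R).

Lemma oint_mulB f1 f2 h : in_H0 f1 -> in_H0 f2 -> in_H0 h ->
  \oint (fun x => (f1 x - f2 x) * h x) = \oint (fun x => f1 x * h x) - \oint (fun x => f2 x * h x).
Proof.
move=> H1 H2 Hh; rewrite -ointB; [|exact: H0M|exact: H0M].
by apply: eq_oint => x _; rewrite mulrBl.
Qed.

Lemma norm_H0B_sqr f h : in_H0 f -> in_H0 h ->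
  norm_H0 (fun x => f x - h x) ^+ 2 =
  norm_H0 f ^+ 2 + norm_H0 h ^+ 2 - 2 * \oint (fun x => f x * h x).
Proof.
move=> Hf Hh; rewrite !norm_H0_sqr.
rewrite (@eq_oint _ _ (fun x => (f x ^+ 2 + h x ^+ 2) - 2 * (f x * h x))); last by move=> x _; ring.
rewrite ointB; [|by apply: intcD; exact: H0_sqr|exact/intcZ/H0M].
by rewrite ointD ?ointZ//; [exact: H0M|exact: H0_sqr|exact: H0_sqr].
Qed.

Lemma H0_norm f : in_H0 f -> in_H0 (fun x => `|f x|).
Proof.
move=> [mf f2]; split; first exact: measurableT_comp.
by apply: eq_integrable f2 => // x _; rewrite /= real_normK ?num_real.
Qed.

Lemma norm_H0_norm f : norm_H0 (fun x => `|f x|) = norm_H0 f.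
Proof. by congr Num.sqrt; apply: eq_oint => x _; rewrite real_normK ?num_real. Qed.

Lemma oint_normM_le f h : in_H0 f -> in_H0 h ->
  \oint (fun x => `|f x * h x|) <= norm_H0 f * norm_H0 h.
Proof.
move=> Hf Hh; rewrite -(norm_H0_norm f) -(norm_H0_norm h).
apply: le_trans (cauchy_schwarz (H0_norm Hf) (H0_norm Hh)).
rewrite (le_trans _ (ler_norm _))// le_eqVlt; apply/orP; left; apply/eqP.
by apply: eq_oint => x _; rewrite normrM.
Qed.

Lemma norm_H0Mb f h M : in_H0 f -> measurable_fun circle h -> 0 <= M ->
  (forall x, circle x -> `|h x| <= M) -> norm_H0 (fun x => h x * f x) <= M * norm_H0 f.
Proof.
move=> Hf mh M0 hM; apply: norm_H0_le; first by rewrite mulr_ge0// norm_H0_ge0.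
rewrite exprMn norm_H0_sqr -ointZ; last exact: H0_sqr.
have Hhf : in_H0 (fun x => h x * f x).
  by apply: (H0_ext _ (H0Mb Hf mh hM)) => x _; rewrite mulrC.
apply: le_oint; [exact: H0_sqr|exact/intcZ/H0_sqr|move=> x Cx].
rewrite exprMn ler_wpM2r ?sqr_ge0// -[h x ^+ 2]real_normK ?num_real//.
by rewrite lerXn2r// ?nnegrE// hM.
Qed.

(** Let [N] be the norm of [f]. Testing with a continuous [h] at distance at most [d] from [f]
    itself gives [N^2 <= e (N + d) + N d]. *)
Lemma dual_norm_le f e : in_H0 f -> 0 <= e ->
  (forall h, continuous h -> `|\oint (fun x => f x * h x)| <= e * norm_H0 h) -> norm_H0 f <= e.
Proof.
move=> Hf e0 H; have n0 := norm_H0_ge0 f; rewrite leNgt; apply/negP => ef.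
have nf : 0 < norm_H0 f by exact: le_lt_trans ef.
have nfe : 0 < e + norm_H0 f by rewrite ltr_wpDl.
(* Half the value at which [N (N - e) = d (N + e)]: the resulting bound is absurd when [N > e]. *)
have [d dE] : exists d, d = norm_H0 f * (norm_H0 f - e) / (2 * (e + norm_H0 f)) by eexists.
have d0 : 0 < d by rewrite dE divr_gt0// ?mulr_gt0// ?subr_gt0.
have [h ch fh] := H0_dense Hf d0.
have Hh := cont_H0 ch.
have Hd : in_H0 (fun x => f x - h x) by exact: H0B.
have E : norm_H0 f ^+ 2 = \oint (fun x => f x * h x) + \oint (fun x => f x * (f x - h x)).
  rewrite norm_H0_sqr -ointD; [|exact: H0M|exact: H0M].
  by apply: eq_oint => x _; ring.
have I1 := H h ch.
have I2 := cauchy_schwarz Hf Hd.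
have I3 : norm_H0 h <= norm_H0 f + d.
  rewrite (@eq_norm_H0 _ h (fun x => f x - (f x - h x))); last by move=> x _; ring.
  by apply: (le_trans (norm_H0B Hf Hd)); rewrite lerD2l.
have I4 : norm_H0 f * norm_H0 (fun x => f x - h x) <= norm_H0 f * d by rewrite ler_wpM2l.
have I5 : e * norm_H0 h <= e * (norm_H0 f + d) by rewrite ler_wpM2l.
have A1 := ler_norm (\oint (fun x => f x * h x)).
have A2 := ler_norm (\oint (fun x => f x * (f x - h x))).
have D : d * (2 * (e + norm_H0 f)) = norm_H0 f * (norm_H0 f - e).
  by rewrite dE mulfVK// gt_eqF// mulr_gt0.
have U1 : norm_H0 f ^+ 2 <= e * (norm_H0 f + d) + norm_H0 f * d.
  rewrite E lerD//.
    by apply: le_trans A1 _; apply: le_trans I1 _.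
  by apply: le_trans A2 _; apply: le_trans I2 _.
have U2 : norm_H0 f * (norm_H0 f - e) <= d * (e + norm_H0 f).
  rewrite (_ : _ * (_ - e) = norm_H0 f ^+ 2 - e * norm_H0 f); last by ring.
  rewrite lerBlDr; apply: le_trans U1 _; rewrite le_eqVlt; apply/orP; left; apply/eqP; ring.
have : 0 < d * (e + norm_H0 f) by rewrite mulr_gt0.
rewrite -D mulrCA in U2.
by move=> p; move: U2; rewrite leNgt => /negP; apply; rewrite ltr_pMl// ltr1n.
Qed.

(* A bounded family that is continuous when tested against continuous functions
   is weakly continuous in L^2, by density. *)
Lemma weak_continuity F h t e : (forall s, 0 <= s -> in_H0 (F s)) ->
  (forall s, 0 <= s -> norm_H0 (F s) <= 2) ->
  (forall k, continuous k -> exists2 c : R -> R, continuous c &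
     forall s, 0 <= s -> \oint (fun x => F s x * k x) = c s) ->
  in_H0 h -> 0 <= t -> 0 < e -> exists2 d, 0 < d & forall s, 0 <= s -> `|t - s| < d ->
    `|\oint (fun x => F t x * h x) - \oint (fun x => F s x * h x)| <= e.
Proof.
move=> HF bF tF Hh t0 e0.
have e8 : 0 < e / 8 by rewrite divr_gt0.
have [k ck hk] := H0_dense Hh e8.
have Hk := cont_H0 ck; have Hd : in_H0 (fun x => h x - k x) by exact: H0B.
have [c cc cE] := tF k ck.
have e2 : 0 < e / 2 by rewrite divr_gt0.
have /cvgrPdist_lt /(_ _ e2) [d /= d0 D] := cc t.
exists d => // s s0 ts; have := D s ts; rewrite -!cE// => {}D.
have small z : 0 <= z -> `|\oint (fun x => F z x * h x) - \oint (fun x => F z x * k x)| <= 2 * (e / 8).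
  move=> z0; rewrite -ointB; [|exact: H0M (HF z z0) _|exact: H0M (HF z z0) _].
  rewrite (@eq_oint _ _ (fun x => F z x * (h x - k x))); last by move=> x _; ring.
  apply: (le_trans (cauchy_schwarz (HF z z0) Hd)).
  by apply: ler_pM; rewrite ?norm_H0_ge0 ?bF.
have S1 := small t t0; have S2 := small s s0.
move: D S1 S2; rewrite ltr_norml => /andP[? ?]; rewrite !ler_norml => /andP[? ?] /andP[? ?].
by apply/andP; split; lra.
Qed.

Lemma mvt_near (f df : R -> R) (t h : R) : (forall z : R, is_derive z 1 f (df z)) -> h != 0 ->
  exists2 c, `|c - t| < `|h| & h^-1 * (f (t + h) - f t) = df c.
Proof.
move=> fd h0.
have cf a b : {within `[a, b], continuous f}.
  by apply: continuous_subspaceT => z; exact: is_derive_cont (fd z).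
have [hp|hn|E] := ltgtP 0 h; last by rewrite -E eqxx in h0.
- have tt : t < t + h by rewrite ltrDl.
  have [c] := MVT tt (fun z _ => fd z) (cf _ _).
  rewrite in_itv/= => /andP[c1 c2] E; exists c.
    by rewrite !gtr0_norm ?subr_gt0//; lra.
  by rewrite E addrAC subrr add0r mulrC mulfK.
- have tt : t + h < t by lra.
  have [c] := MVT tt (fun z _ => fd z) (cf _ _).
  rewrite in_itv/= => /andP[c1 c2] E; exists c.
    by rewrite !ltr0_norm ?subr_lt0//; lra.
  rewrite -opprB E opprD addrA subrr sub0r; by field.
Qed.

(** A set of full measure is dense, so the bound passes to the limit by continuity. It carries
    estimates from times of full energy to mean value points, whose position is not controlled. *)
Lemma ae_dense_le (f : R -> R) (c e a b : R) (P : R -> Prop) : continuous f ->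
  {ae leb, forall s, P s} -> (forall s, a < s < b -> P s -> `|f s - c| <= e) ->
  forall s, a < s < b -> `|f s - c| <= e.
Proof.
move=> cf aeP H s /andP[sa sb]; apply/ler_addgt0Pr => z z0.
have /cvgrPdist_lt /(_ _ z0) [d /= d0 D] := cf s.
have [|y /andP[ay yb] Py] := ae_meets (a := Num.max a (s - d)) (b := Num.min b (s + d)) aeP.
  by rewrite gt_max !lt_min; apply/andP; split; apply/andP; split => //; lra.
move: ay yb; rewrite gt_max lt_min => /andP[ay sy] /andP[yb ys].
have ab : a < y < b by rewrite ay yb.
have I1 := H y ab Py.
have I2 : `|f s - f y| < z by apply: D; rewrite /= ltr_norml; apply/andP; split; lra.
rewrite (_ : f s - c = (f y - c) + (f s - f y)); last by ring.
by rewrite (le_trans (ler_normD _ _))// lerD// ltW.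
Qed.

End Hilbert.

(** * Continuity in time *)

Section Evolution.
Context {R : realType} (g r : R -> R).
Let mC : measurable (@circle R) := measurable_circle.
Hint Resolve mC : core.
Hypotheses (Hg : in_H0 g) (Hr : in_H0 r) (g0 : \oint g = 0).
Hypothesis gr4 : norm_H0 g ^+ 2 + norm_H0 r ^+ 2 = 4.
Implicit Types (s t x y e : R) (h k : R -> R).
Local Notation wf := (wf g r).
Local Notation vf := (vf g r).
Local Notation Phi := (Phi g r).
Local Notation vanish := (vanish g r).
Variables (u rho ux : R -> R -> R).
Hypothesis Hpair : flow_pair g r u rho.
Hypothesis Hux : forall t, measurable_fun circle (ux t) /\
  {ae leb, forall x, circle x -> ux t (Phi t x) = vf t x / wf t x}.

Let uxH t : 0 <= t -> in_H0 (ux t) := @ux_H0 _ _ _ Hg Hr g0 gr4 _ _ Hpair _ Hux t.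
Let rhoH t : 0 <= t -> in_H0 (rho t) := @rho_H0 _ _ _ Hg Hr g0 gr4 _ _ Hpair _ Hux t.
Let uxN t : 0 <= t -> norm_H0 (ux t) <= 2 := @ux_norm _ _ _ Hg Hr g0 gr4 _ _ Hpair _ Hux t.
Let rhoN t : 0 <= t -> norm_H0 (rho t) <= 2 := @rho_norm _ _ _ Hg Hr g0 gr4 _ _ Hpair _ Hux t.
Let uM t : 0 <= t -> measurable_fun circle (u t) := @u_meas _ _ _ Hg Hr g0 gr4 _ _ Hpair _ Hux t.
Let uB t y : 0 <= t -> circle y -> `|u t y| <= 2 := @u_bnd _ _ _ Hg Hr g0 gr4 _ _ Hpair t y.
Let uxT t h : measurable_fun circle h -> _ := @ux_test _ _ _ Hg Hr g0 gr4 _ Hux t h.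
Let rhoT t h : 0 <= t -> measurable_fun circle h -> _ :=
  @rho_test _ _ _ Hg Hr g0 gr4 _ _ Hpair t h.
Let uI t y : 0 <= t -> circle y -> u t y = indef (ux t) y :=
  @u_indef _ _ _ Hg Hr g0 gr4 _ _ Hpair _ Hux t y.

(** Positivity leaves room for the two-sided increments in the derivatives at [t]. *)
Definition good t := 0 < t /\ leb (vanish t) = 0%E.

Lemma good_ae : {ae leb, forall t, 0 <= t -> good t}.
Proof.
have ne : {ae leb, forall t : R, t != 0}.
  by exists [set 0]; split=> //; [exact: lebesgue_measure_set1|move=> t /= /negP/negPn/eqP].
apply: aeS2 (good_time_ae Hg Hr) ne => t G t0 tp; split; last exact: G.
by rewrite lt_neqAle eq_sym t0.
Qed.

Lemma good_energy t : good t -> norm_H0 (ux t) ^+ 2 + norm_H0 (rho t) ^+ 2 = 4.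
Proof.
move=> [t0 G].
rewrite (energy_norm2 Hg Hr g0 gr4 Hpair Hux (ltW t0)) (good_defect Hg Hr G).
by rewrite mulr0 subr0.
Qed.

Lemma ux_weak_cont h t e : in_H0 h -> 0 <= t -> 0 < e -> exists2 d, 0 < d &
  forall s, 0 <= s -> `|t - s| < d ->
    `|\oint (fun x => ux t x * h x) - \oint (fun x => ux s x * h x)| <= e.
Proof.
apply: weak_continuity => // k ck; exists (fun s => \oint (fun x => vf s x * k (Phi s x))).
  exact: (ux_test_cont Hg Hr g0 gr4 ck).
by move=> s s0; apply: uxT; exact: cont_meas.
Qed.

Lemma rho_weak_cont h t e : in_H0 h -> 0 <= t -> 0 < e -> exists2 d, 0 < d &
  forall s, 0 <= s -> `|t - s| < d ->
    `|\oint (fun x => rho t x * h x) - \oint (fun x => rho s x * h x)| <= e.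
Proof.
apply: weak_continuity => // k ck; exists (fun s => \oint (fun x => r x * k (Phi s x))).
  exact: (rho_test_cont Hg Hr g0 gr4 ck).
by move=> s s0; apply: rhoT => //; exact: cont_meas.
Qed.

(* Weak continuity upgrades to norm continuity where the energy is maximal. *)
Lemma strong_cont t e : good t -> 0 < e -> exists2 d, 0 < d &
  forall s, 0 <= s -> `|t - s| < d ->
    norm_H0 (fun x => ux s x - ux t x) <= e /\ norm_H0 (fun x => rho s x - rho t x) <= e.
Proof.
move=> Gt e0; have t0 : 0 <= t by case: Gt => /ltW.
(* Two inner products within [e^2 / 4] of their limits, which add up to 4, give a total squared
   distance of at most [4 + 4 - 2 (4 - e^2 / 2) = e^2]. *)
have e4 : 0 < e ^+ 2 / 4 by rewrite divr_gt0// exprn_gt0.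
have [d1 d10 D1] := ux_weak_cont (uxH t0) t0 e4.
have [d2 d20 D2] := rho_weak_cont (rhoH t0) t0 e4.
exists (Num.min d1 d2); first by rewrite lt_min d10.
move=> s s0; rewrite lt_min => /andP[/(D1 s s0){}D1 /(D2 s s0){}D2].
have E1 := norm_H0B_sqr (uxH s0) (uxH t0).
have E2 := norm_H0B_sqr (rhoH s0) (rhoH t0).
have Es := energy_le4 Hg Hr g0 gr4 Hpair Hux s0.
have Et := good_energy Gt.
have I1 : norm_H0 (ux t) ^+ 2 = \oint (fun x => ux t x * ux t x).
  by rewrite norm_H0_sqr; apply: eq_oint => x _; rewrite expr2.
have I2 : norm_H0 (rho t) ^+ 2 = \oint (fun x => rho t x * rho t x).
  by rewrite norm_H0_sqr; apply: eq_oint => x _; rewrite expr2.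
move: D1 D2; rewrite -I1 -I2 !ler_norml => /andP[_ D1] /andP[_ D2].
have p1 := sqr_ge0 (norm_H0 (fun x => ux s x - ux t x)).
have p2 := sqr_ge0 (norm_H0 (fun x => rho s x - rho t x)).
split; rewrite -(@ler_pXn2r _ 2)// ?nnegrE ?norm_H0_ge0 ?(ltW e0)//; lra.
Qed.

Lemma u_unif_cont t e : 0 <= t -> 0 < e -> exists2 d, 0 < d &
  forall s y, 0 <= s -> `|t - s| < d -> circle y -> `|u s y - u t y| <= e.
Proof.
move=> t0 e0.
have c : continuous (fun z : R => 4 * z + 2 * Num.sqrt (2 * z)).
  move=> z; apply: cvgD; first by apply: cvgM; [exact: cvg_cst|exact: cvg_id].
  apply: cvgM; first exact: cvg_cst.
  apply: (continuous_comp (f := fun z : R => 2 * z)); last exact: sqrt_continuous.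
  by apply: cvgM; [exact: cvg_cst|exact: cvg_id].
have /cvgrPdist_lt /(_ _ e0) [d /= d0 D] := c 0.
exists d => // s y s0 ts Cy; have := D `|t - s|.
rewrite /= !sub0r !normrN normr_id => /(_ ts).
rewrite !mulr0 sqrtr0 mulr0 addr0 sub0r normrN => H; rewrite distrC.
apply: (le_trans (u_time Hg Hr g0 gr4 Hpair t0 s0 Cy)).
by apply: (le_trans (ler_norm _)); exact: ltW.
Qed.

Definition ener t y := ux t y ^+ 2 + rho t y ^+ 2.
(** The value that the first equation prescribes for u_t, with [ux] in place of the chosen weak
    derivative. *)
Definition rhs t x := 2^-1 * (indef (ener t) x - x * \oint (ener t)) - u t x * ux t x.

Let enerI t : 0 <= t -> intc (ener t).
Proof. by move=> t0; apply: intcD; [exact: H0_sqr (uxH t0)|exact: H0_sqr (rhoH t0)]. Qed.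

Lemma gap_H0 k : intc k -> in_H0 (fun x => indef k x - x * \oint k).
Proof.
move=> ki; apply: H0B.
  by apply: (@H0_bnd _ _ (\oint (fun y => `|k y|))); [exact: indef_meas|move=> x; exact: indef_norm].
apply: (@H0_bnd _ _ `|\oint k|).
  apply: measurable_funM; last exact: measurable_cst.
  by apply: measurable_funTS; exact: measurable_id.
by move=> x /circleP/andP[x0 x1]; rewrite normrM ger0_norm// ler_piMl.
Qed.

Lemma gap_norm k : intc k -> norm_H0 (fun x => indef k x - x * \oint k) <= 2 * \oint (fun y => `|k y|).
Proof.
move=> ki; have k0 : 0 <= \oint (fun y => `|k y|) by apply: oint_ge0.
apply: norm_H0_bnd; [by rewrite mulr_ge0|by case: (gap_H0 ki)|move=> x Cx].
have /circleP/andP[x0 x1] := Cx.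
have I1 := indef_norm ki Cx; have I2 := le_norm_oint ki.
have I3 : `|x * \oint k| <= `|\oint k| by rewrite normrM ger0_norm// ler_piMl.
by rewrite (le_trans (ler_normB _ _))// mulr_natl mulr2n lerD// (le_trans I3).
Qed.

Let u_ux_H0 t : 0 <= t -> in_H0 (fun x => u t x * ux t x).
Proof.
move=> t0; apply: (H0_ext _ (H0Mb (uxH t0) (uM t0) (fun x => uB t0 (y := x)))).
by move=> x _; rewrite mulrC.
Qed.

Lemma rhs_H0 t : 0 <= t -> in_H0 (rhs t).
Proof. by move=> t0; apply: H0B; [apply: H0Z; apply: gap_H0; exact: enerI|exact: u_ux_H0]. Qed.

(** The nonlocal term contributes at most half of [2 * 4], by the energy bound 4, and the product
    [u * ux] at most [2 * 2]. *)
Lemma rhs_norm t : 0 <= t -> norm_H0 (rhs t) <= 8.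
Proof.
move=> t0; have Hgap := gap_H0 (enerI t0).
apply: (le_trans (norm_H0B (H0Z _ Hgap) (u_ux_H0 t0))).
rewrite norm_H0Z//; have := gap_norm (enerI t0).
rewrite (@eq_oint _ (fun y => `|ener t y|) (ener t)); last first.
  by move=> y _; rewrite ger0_norm// addr_ge0// sqr_ge0.
have := norm_H0Mb (uxH t0) (uM t0) (ler0n R 2) (fun x => uB t0 (y := x)).
have := uxN t0.
have : \oint (ener t) <= 4.
  rewrite ointD; [|exact: H0_sqr (uxH t0)|exact: H0_sqr (rhoH t0)].
  by rewrite -!norm_H0_sqr; exact: (energy_le4 Hg Hr g0 gr4 Hpair Hux t0).
have -> : `|2^-1 : R| = 2^-1 by rewrite ger0_norm.
move=> ? ? ? ?; lra.
Qed.

(** The boundary term of the integration by parts vanishes because [ux] has mean zero; what remains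
    is a test of [ux] against a C^1 function, hence differentiable in time. *)
Lemma u_test_flow t h : 0 <= t -> continuous h ->
  \oint (fun y => u t y * h y) = - \oint (fun x => vf t x * primitive h (Phi t x)).
Proof.
move=> t0 ch; have cH := primitive_cont ch.
rewrite (@eq_oint _ _ (fun y => indef (ux t) y * h y)); last by move=> y Cy; rewrite uI.
have U0 : \oint (ux t) = 0 by apply: (ux_oint Hg Hr g0 gr4 _ t0); exact: Hux.
rewrite (ibp (H0_intc (uxH t0)) ch) U0 mul0r sub0r.
by rewrite (uxT t (cont_meas (D := circle) cH)).
Qed.

End Evolution.

(** * The evolution equations *)

Section EquationU.
Context {R : realType} (g r : R -> R).
Let mC : measurable (@circle R) := measurable_circle.
Hint Resolve mC : core.
Hypotheses (Hg : in_H0 g) (Hr : in_H0 r) (g0 : \oint g = 0).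
Hypothesis gr4 : norm_H0 g ^+ 2 + norm_H0 r ^+ 2 = 4.
Implicit Types (s t x y e : R) (h k : R -> R).
Local Notation wf := (wf g r).
Local Notation vf := (vf g r).
Local Notation kf := (kf g r).
Local Notation Phi := (Phi g r).
Local Notation Vel := (Vel g r).
Local Notation vanish := (vanish g r).
Local Notation good := (good g r).
Let wi t : intc (wf t) := w_intc Hg Hr t.
Let w0 t : forall x, circle x -> 0 <= wf t x := fun x _ => w_ge0 g r t x.
Let w1 t : \oint (wf t) = 1 := w_oint Hg Hr g0 gr4 t.
Variables (u rho ux : R -> R -> R).
Hypothesis Hpair : flow_pair g r u rho.
Hypothesis Hux : forall t, measurable_fun circle (ux t) /\
  {ae leb, forall x, circle x -> ux t (Phi t x) = vf t x / wf t x}.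
Local Notation ener := (ener rho ux).
Local Notation rhs := (rhs u rho ux).

Let uxH t : 0 <= t -> in_H0 (ux t) := @ux_H0 _ _ _ Hg Hr g0 gr4 _ _ Hpair _ Hux t.
Let rhoH t : 0 <= t -> in_H0 (rho t) := @rho_H0 _ _ _ Hg Hr g0 gr4 _ _ Hpair _ Hux t.
Let uM t : 0 <= t -> measurable_fun circle (u t) := @u_meas _ _ _ Hg Hr g0 gr4 _ _ Hpair _ Hux t.
Let uB t y : 0 <= t -> circle y -> `|u t y| <= 2 := @u_bnd _ _ _ Hg Hr g0 gr4 _ _ Hpair t y.
Let uP t x : 0 <= t -> circle x -> u t (Phi t x) = Vel t x.
Proof. by case: Hpair => + _ _; exact. Qed.
Let PhiM t h : continuous h -> measurable_fun circle (fun x => h (Phi t x)).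
Proof. by move=> ch; apply: cont_meas_comp => //; exact: (Phi_meas Hg Hr). Qed.

Lemma ener_good t : good t -> ae_eq_circle (fun x => wf t x * ener t (Phi t x)) (fun x => 4 * kf t x).
Proof.
move=> [t0 Z]; have [_ U] := Hux t; have [_ _ Rr] := Hpair.
have nz : {ae leb, forall x, circle x -> wf t x != 0}.
  exists (vanish t); split=> //; first exact: (measurable_vanish Hg Hr).
  by move=> x /not_implyP[Cx /negP/negPn/eqP E]; split.
apply: aeS2 nz (aeS2 _ U (Rr t (ltW t0))); last by move=> x A B; exact: conj A B.
move=> x E [Ux Rx] Cx; have {}E := E Cx; rewrite /ener Ux// Rx//.
have -> : wf t x * ((vf t x / wf t x) ^+ 2 + (r x / wf t x) ^+ 2) =
  (vf t x ^+ 2 + r x ^+ 2) / wf t x by field.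
by rewrite v_sqr; field.
Qed.

Let enerM t : 0 <= t -> measurable_fun circle (ener t).
Proof.
move=> t0; apply: measurable_funD; apply: measurable_funX; last exact: H0_meas (rhoH t0).
exact: H0_meas (uxH t0).
Qed.

Let enerI t : 0 <= t -> intc (ener t).
Proof. by move=> t0; apply: intcD; [exact: H0_sqr (uxH t0)|exact: H0_sqr (rhoH t0)]. Qed.

(** Let [H] be the primitive of [h]. After integration by parts and passage to Lagrangian
    coordinates, the nonlocal term pairs [-2 kf + 2 wf = - af] with [H] along the flow, while its
    boundary terms [2 H(1)] cancel. Full energy enters through the total 4 and through
    [ener_good]. *)
Lemma rhs_test t h : good t -> continuous h ->
  \oint (fun x => rhs t x * h x) = - ux_test_rate g r (primitive h) h t.
Proof.
move=> Gt ch; have [tp Z] := Gt; have t0 := ltW tp.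
have cH := primitive_cont ch.
have [B hB] := cont_bnd ch; have [B' HB'] := cont_bnd cH.
have mh : measurable_fun circle h by exact: cont_meas.
have mH : measurable_fun circle (primitive h) by exact: cont_meas.
have ei := enerI t0.
have e4 : \oint (ener t) = 4.
  rewrite ointD; [|exact: H0_sqr (uxH t0)|exact: H0_sqr (rhoH t0)].
  by rewrite -!norm_H0_sqr; exact: (good_energy Hg Hr g0 gr4 Hpair Hux Gt).
have iE : in_H0 (indef (ener t)).
  by apply: (@H0_bnd _ _ (\oint (fun y => `|ener t y|))); [exact: indef_meas|move=> x; exact: indef_norm].
have ix : in_H0 (fun x : R => x).
  by apply: cont_H0 => x; exact: cvg_id.
have Hh := cont_H0 ch.
have iuux : in_H0 (fun x => u t x * ux t x).
  apply: (H0_ext _ (H0Mb (uxH t0) (uM t0) (fun x => uB t0 (y := x)))).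
  by move=> x _; rewrite mulrC.
have S1 : \oint (fun x => indef (ener t) x * h x) =
    4 * primitive h 1 - \oint (fun x => 4 * kf t x * primitive h (Phi t x)).
  rewrite (ibp ei ch) e4.
  suff -> : \oint (fun x => ener t x * primitive h x) =
    \oint (fun x => 4 * kf t x * primitive h (Phi t x)) by [].
  rewrite (cov_oint (wi t) (w0 t) (w1 t)); last by apply: measurable_funM => //; exact: enerM.
  apply: oint_ae.
  - apply: measurable_funM; first exact: intc_meas.
    apply: (measurable_comp_cov (wi t) (w0 t) (w1 t) (h := fun y => ener t y * primitive h y)).
    by apply: measurable_funM => //; exact: enerM.
  - apply: measurable_funM; last exact: PhiM.
    exact: intc_meas (intcZ 4 (k_intc Hg Hr t)).
  apply: aeS (ener_good Gt) => x E Cx; rewrite mulrA.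
  by have -> : wf t x * ener t (Phi t x) = 4 * kf t x := E Cx.
have S2 : \oint (fun x => x * h x) = primitive h 1 - \oint (fun x => wf t x * primitive h (Phi t x)).
  have -> : \oint (fun x => x * h x) = \oint (fun x => indef (fun=> 1) x * h x).
    by apply: eq_oint => x Cx; rewrite indef_cst// mul1r.
  rewrite (ibp (intc_cst 1) ch) oint_cst mul1r.
  rewrite (@eq_oint _ (fun x => 1 * primitive h x) (primitive h)); last by move=> x _; rewrite mul1r.
  by rewrite (cov_oint (wi t) (w0 t) (w1 t) mH).
have S3 : \oint (fun x => (u t x * ux t x) * h x) = \oint (fun x => vf t x * (h (Phi t x) * Vel t x)).
  transitivity (\oint (fun x => ux t x * (u t x * h x))).
    by apply: eq_oint => x _; ring.
  rewrite (@ux_test _ _ _ Hg Hr g0 gr4 _ Hux t (fun x => u t x * h x)); last first.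
    by apply: measurable_funM => //; exact: uM.
  by apply: eq_oint => x Cx; rewrite uP//; ring.
have i1 : intc (fun x => indef (ener t) x * h x) by exact: H0M.
have i2 : intc (fun x => x * h x) by exact: H0M.
have i3 : intc (fun x => (u t x * ux t x) * h x) by exact: H0M.
have kH : intc (fun x => kf t x * primitive h (Phi t x)).
  by apply: (@intcM _ _ _ B'); [exact: k_intc|exact: PhiM|move=> x Cx; apply: HB'; exact: Phi_circle].
have wH : intc (fun x => wf t x * primitive h (Phi t x)).
  by apply: (@intcM _ _ _ B'); [exact: wi|exact: PhiM|move=> x Cx; apply: HB'; exact: Phi_circle].
have vH : intc (fun x => vf t x * (h (Phi t x) * Vel t x)).
  apply: (@intcM _ _ _ (B * 2)); [exact: v_intc| |].
    by apply: measurable_funM; [exact: PhiM|exact: (Vel_meas Hg Hr)].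
  move=> x Cx; rewrite normrM; apply: ler_pM => //; last exact: (Vel_bnd Hg Hr g0 gr4).
  by apply: hB; exact: Phi_circle.
have -> : \oint (fun x => rhs t x * h x) = 2^-1 * \oint (fun x => indef (ener t) x * h x)
    - (2^-1 * 4) * \oint (fun x => x * h x) - \oint (fun x => (u t x * ux t x) * h x).
  rewrite (@eq_oint _ _ (fun x => (2^-1 * (indef (ener t) x * h x) - (2^-1 * 4) * (x * h x)) -
     (u t x * ux t x) * h x)); last first.
    by move=> x _; rewrite /rhs e4; ring.
  by rewrite ointB ?ointB ?ointZ//; try (apply: intcB); try exact: intcZ.
have -> : ux_test_rate g r (primitive h) h t =
    2 * \oint (fun x => kf t x * primitive h (Phi t x)) -
    2 * \oint (fun x => wf t x * primitive h (Phi t x)) +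
    \oint (fun x => vf t x * (h (Phi t x) * Vel t x)).
  rewrite /ux_test_rate.
  rewrite (@eq_oint _ _ (fun x => (2 * (kf t x * primitive h (Phi t x)) -
    2 * (wf t x * primitive h (Phi t x))) + vf t x * (h (Phi t x) * Vel t x))); last first.
    by move=> x _; rewrite a_kw; ring.
  by rewrite ointD ?ointB ?ointZ//; try (apply: intcB); try exact: intcZ.
rewrite S1 S2 S3.
have -> : \oint (fun x => 4 * kf t x * primitive h (Phi t x)) =
    4 * \oint (fun x => kf t x * primitive h (Phi t x)).
  by rewrite -ointZ//; apply: eq_oint => x _; rewrite mulrA.
by field.
Qed.

End EquationU.

(** * Lipschitz continuity in time and the two equations *)

Section Equations.
Context {R : realType} (g r : R -> R).
Let mC : measurable (@circle R) := measurable_circle.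
Hint Resolve mC : core.
Hypotheses (Hg : in_H0 g) (Hr : in_H0 r) (g0 : \oint g = 0).
Hypothesis gr4 : norm_H0 g ^+ 2 + norm_H0 r ^+ 2 = 4.
Implicit Types (s t x y e : R) (h k : R -> R).
Local Notation wf := (wf g r).
Local Notation vf := (vf g r).
Local Notation Phi := (Phi g r).
Local Notation Vel := (Vel g r).
Local Notation good := (good g r).
Variables (u rho ux : R -> R -> R).
Hypothesis Hpair : flow_pair g r u rho.
Hypothesis Hux : forall t, measurable_fun circle (ux t) /\
  {ae leb, forall x, circle x -> ux t (Phi t x) = vf t x / wf t x}.
Local Notation ener := (ener rho ux).
Local Notation rhs := (rhs u rho ux).

Let uxH t : 0 <= t -> in_H0 (ux t) := @ux_H0 _ _ _ Hg Hr g0 gr4 _ _ Hpair _ Hux t.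
Let rhoH t : 0 <= t -> in_H0 (rho t) := @rho_H0 _ _ _ Hg Hr g0 gr4 _ _ Hpair _ Hux t.
Let uxN t : 0 <= t -> norm_H0 (ux t) <= 2 := @ux_norm _ _ _ Hg Hr g0 gr4 _ _ Hpair _ Hux t.
Let rhoN t : 0 <= t -> norm_H0 (rho t) <= 2 := @rho_norm _ _ _ Hg Hr g0 gr4 _ _ Hpair _ Hux t.
Let uM t : 0 <= t -> measurable_fun circle (u t) := @u_meas _ _ _ Hg Hr g0 gr4 _ _ Hpair _ Hux t.
Let uH t : 0 <= t -> in_H0 (u t) := @u_H0 _ _ _ Hg Hr g0 gr4 _ _ Hpair _ Hux t.
Let uB t y : 0 <= t -> circle y -> `|u t y| <= 2 := @u_bnd _ _ _ Hg Hr g0 gr4 _ _ Hpair t y.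
Let uP t x : 0 <= t -> circle x -> u t (Phi t x) = Vel t x.
Proof. by case: Hpair => + _ _; exact. Qed.
Let rhsH t : 0 <= t -> in_H0 (rhs t) := @rhs_H0 _ _ _ Hg Hr g0 gr4 _ _ _ Hpair Hux t.
Let rhsN t : 0 <= t -> norm_H0 (rhs t) <= 8 := @rhs_norm _ _ _ Hg Hr g0 gr4 _ _ _ Hpair Hux t.

Let good_ge0 t : good t -> 0 <= t.
Proof. by case=> /ltW. Qed.

Let flow_test h s : R := \oint (fun x => vf s x * primitive h (Phi s x)).

Let flow_test_derive h s : continuous h ->
  is_derive s 1 (flow_test h) (ux_test_rate g r (primitive h) h s).
Proof.
by move=> ch; exact: (ux_test_derive Hg Hr g0 gr4 (fun y => primitive_derive y ch) ch s).
Qed.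

Let rate_cont h : continuous h -> continuous (ux_test_rate g r (primitive h) h).
Proof. by move=> ch; exact: (ux_test_rate_cont Hg Hr g0 gr4 (fun y => primitive_derive y ch) ch). Qed.

Let u_test t h : 0 <= t -> continuous h -> \oint (fun y => u t y * h y) = - flow_test h t.
Proof. exact: (u_test_flow Hg Hr g0 gr4 Hpair Hux). Qed.

Let rhsT t h : good t -> continuous h ->
  \oint (fun x => rhs t x * h x) = - ux_test_rate g r (primitive h) h t.
Proof. exact: (rhs_test Hg Hr g0 gr4 Hpair Hux). Qed.

(** Cauchy-Schwarz with [rhs] gives the bound at times of full energy; continuity of the rate gives
    it at every positive time. *)
Lemma rate_bnd h t : continuous h -> 0 < t ->
  `|ux_test_rate g r (primitive h) h t| <= 8 * norm_H0 h.
Proof.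
move=> ch t0; rewrite -[X in `|X|]subr0.
apply: (ae_dense_le (a := 0) (b := t + 1) (rate_cont ch) (good_ae Hg Hr)); last first.
  by apply/andP; split=> //; rewrite ltrDl.
move=> s /andP[s0 _] Gs; have {}Gs := Gs (ltW s0); rewrite subr0 -normrN -rhsT//.
apply: (le_trans (cauchy_schwarz (rhsH (ltW s0)) (cont_H0 ch))).
by rewrite ler_wpM2r ?norm_H0_ge0// rhsN// ltW.
Qed.

(** Duality with continuous functions and the mean value theorem. The intermediate time need not
    have full energy, which is why [rate_bnd] covers all positive times. *)
Lemma u_lip a b : 0 <= a -> a <= b -> norm_H0 (fun x => u b x - u a x) <= 8 * (b - a).
Proof.
move=> a0 ab; have b0 : 0 <= b := le_trans a0 ab.
apply: dual_norm_le; [exact: H0B (uH b0) (uH a0)|by rewrite mulr_ge0// subr_ge0|].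
move=> h ch; rewrite (oint_mulB (uH b0) (uH a0) (cont_H0 ch)) !u_test//.
move: ab; rewrite le_eqVlt => /predU1P[->|ab].
  by rewrite !subrr mulr0 mul0r normr0.
have cf : {within `[a, b], continuous (flow_test h)}.
  by apply: continuous_subspaceT => z; exact: is_derive_cont (flow_test_derive z ch).
have [c] := MVT ab (fun z _ => flow_test_derive z ch) cf.
rewrite in_itv/= => /andP[ac cb] E.
rewrite opprK addrC -opprB normrN E normrM (ger0_norm (_ : 0 <= b - a)) ?subr_ge0 ?(ltW ab)//.
rewrite mulrAC ler_wpM2r ?subr_ge0 ?(ltW ab)// rate_bnd//.
exact: le_lt_trans ac.
Qed.

Lemma ac_u : abs_continuous_H0 u.
Proof.
split; first exact: uH.
move=> e e0; exists (e / 8); first by rewrite divr_gt0.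
move=> n a b ab _ S.
apply: (@le_lt_trans _ _ (\sum_(i < n) (8 * (b i - a i)))).
  by apply: ler_sum => i _; have /andP[a0 ba] := ab i; exact: u_lip.
by rewrite -mulr_sumr mulrC -ltr_pdivlMr.
Qed.

(** Differences of squares factor, and the sums [ux s + ux t] and [rho s + rho t] have norm at most
    4. *)
Lemma ener_close s t : 0 <= s -> 0 <= t ->
  \oint (fun x => `|ener s x - ener t x|) <=
  4 * norm_H0 (fun x => ux s x - ux t x) + 4 * norm_H0 (fun x => rho s x - rho t x).
Proof.
move=> s0 t0.
have sq f1 f2 : in_H0 f1 -> in_H0 f2 -> norm_H0 f1 <= 2 -> norm_H0 f2 <= 2 ->
    \oint (fun x => `|(f1 x - f2 x) * (f1 x + f2 x)|) <= 4 * norm_H0 (fun x => f1 x - f2 x).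
  move=> H1 H2 n1 n2; rewrite mulrC.
  apply: (le_trans (oint_normM_le (H0B H1 H2) (H0D H1 H2))).
  rewrite ler_wpM2l ?norm_H0_ge0// (le_trans (norm_H0D H1 H2))// (_ : 4 = 2 + 2 :> R); last by ring.
  exact: lerD.
have I1 := sq _ _ (uxH s0) (uxH t0) (uxN s0) (uxN t0).
have I2 := sq _ _ (rhoH s0) (rhoH t0) (rhoN s0) (rhoN t0).
apply: (le_trans _ (lerD I1 I2)).
have i1 : intc (fun x => `|(ux s x - ux t x) * (ux s x + ux t x)|).
  by apply: intc_norm; apply: H0M; [exact: H0B (uxH s0) (uxH t0)|exact: H0D (uxH s0) (uxH t0)].
have i2 : intc (fun x => `|(rho s x - rho t x) * (rho s x + rho t x)|).
  by apply: intc_norm; apply: H0M; [exact: H0B (rhoH s0) (rhoH t0)|exact: H0D (rhoH s0) (rhoH t0)].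
have ie z : 0 <= z -> intc (ener z).
  by move=> z0; apply: intcD; [exact: H0_sqr (uxH z0)|exact: H0_sqr (rhoH z0)].
rewrite -ointD//; apply: le_oint; [exact/intc_norm/intcB/ie/t0/ie|exact: intcD|].
move=> x _; apply: (le_trans _ (ler_normD _ _)).
by rewrite le_eqVlt; apply/orP; left; apply/eqP; congr (`|_|); rewrite /ener; ring.
Qed.

Lemma rhs_cont t e : good t -> 0 < e -> exists2 d, 0 < d & forall s, 0 <= s -> `|t - s| < d ->
  norm_H0 (fun x => rhs s x - rhs t x) <= e.
Proof.
(* Twelve shares: eight for the nonlocal term, two for each half of the difference of the products
   [u * ux]. *)
move=> Gt e0; have t0 := good_ge0 Gt; have e12 : 0 < e / 12 by rewrite divr_gt0.
have [d1 d10 D1] := strong_cont Hg Hr g0 gr4 Hpair Hux Gt e12.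
have [d2 d20 D2] := u_unif_cont Hg Hr g0 gr4 Hpair t0 e12.
exists (Num.min d1 d2); first by rewrite lt_min d10.
move=> s s0; rewrite lt_min => /andP[/(D1 s s0)[N1 N2] T2].
have U y : circle y -> `|u s y - u t y| <= e / 12 by move=> Cy; exact: D2.
have ie z : 0 <= z -> intc (ener z).
  by move=> z0; apply: intcD; [exact: H0_sqr (uxH z0)|exact: H0_sqr (rhoH z0)].
pose k x := ener s x - ener t x.
have ki : intc k by apply: intcB; exact: ie.
have Hgap := gap_H0 ki.
have Mu : measurable_fun circle (fun x => u s x - u t x) by apply: measurable_funB; exact: uM.
have HA := H0B (uxH s0) (uxH t0).
have H1 : in_H0 (fun x => u s x * (ux s x - ux t x)).
  by apply: (H0_ext _ (H0Mb HA (uM s0) (fun x => uB s0 (y := x)))) => x _; rewrite mulrC.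
have H2 : in_H0 (fun x => (u s x - u t x) * ux t x).
  by apply: (H0_ext _ (H0Mb (uxH t0) Mu U)) => x _; rewrite mulrC.
rewrite (@eq_norm_H0 _ _ (fun x => 2^-1 * (indef k x - x * \oint k) -
   u s x * (ux s x - ux t x) - (u s x - u t x) * ux t x)); last first.
  move=> x Cx; rewrite /rhs /k ointB; [|exact: ie|exact: ie].
  rewrite (@eq_indef _ (fun y => ener s y - ener t y) (fun y => ener s y + (-1) * ener t y))//; last first.
    by move=> y _; rewrite mulN1r.
  rewrite (indefD (ie s s0) (intcZ (-1) (ie t t0)) Cx) (indefZ (-1) (ie t t0) Cx); ring.
have B1 := norm_H0B (H0B (H0Z 2^-1 Hgap) H1) H2.
have B2 := norm_H0B (H0Z 2^-1 Hgap) H1.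
have B3 := norm_H0Z 2^-1 Hgap.
have B4 := gap_norm ki.
have B5 := norm_H0Mb HA (uM s0) (ler0n R 2) (fun x => uB s0 (y := x)).
have B6 := norm_H0Mb (uxH t0) Mu (ltW e12) U.
have B7 := ener_close s0 t0.
have B8 : e / 12 * norm_H0 (ux t) <= e / 12 * 2 by rewrite ler_wpM2l ?(ltW e12)// uxN.
have B9 : `|2^-1 : R| = 2^-1 by rewrite ger0_norm.
apply: (le_trans B1); apply: (le_trans (lerD B2 B6)); rewrite B3 B9.
have B10 : 2^-1 * norm_H0 (fun x => indef k x - x * \oint k) <= 8 * (e / 12).
  rewrite mulrC ler_pdivrMr//; apply: (le_trans B4).
  rewrite mulrC ler_wpM2r//; apply: (le_trans B7).
  have -> : 8 * (e / 12) = 4 * (e / 12) + 4 * (e / 12) by ring.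
  by apply: lerD; rewrite ler_wpM2l.
have B11 : norm_H0 (fun x => u s x * (ux s x - ux t x)) <= 2 * (e / 12).
  by apply: (le_trans B5); rewrite ler_wpM2l.
apply: (le_trans (lerD (lerD B10 B11) B8)).
rewrite (_ : _ + _ = e)//; by field.
Qed.

(** Tested against [k], the difference quotient is minus the rate at an intermediate time [c]. Near
    [t], the rate at times of full energy is within [e * norm_H0 k] of its value at [t]; continuity
    extends this to [c], and uniformity in [k] gives convergence in L^2 by duality. *)
Lemma u_deriv t : good t -> is_deriv_H0 u t (rhs t).
Proof.
move=> Gt; have [tp _] := Gt; have t0 := ltW tp.
split; first exact: rhsH.
apply/cvgrPdist_le => e e0.
have [d1 d10 D1] := rhs_cont Gt e0.
(* The radius [t] keeps all the times involved positive. *)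
exists (Num.min d1 t) => /=; first by rewrite lt_min d10.
move=> h /=; rewrite sub0r normrN lt_min => /andP[hd ht] h0.
have th : 0 < t + h by move: ht; rewrite ltr_norml => /andP[]; lra.
rewrite sub0r normrN ger0_norm ?norm_H0_ge0//.
have HD := H0Z h^-1 (H0B (uH (ltW th)) (uH t0)).
apply: dual_norm_le; [exact: H0B HD (rhsH t0)|exact: ltW|].
move=> k ck; have Hk := cont_H0 ck.
rewrite (oint_mulB HD (rhsH t0) Hk).
have -> : \oint (fun x => h^-1 * (u (t + h) x - u t x) * k x) = - (h^-1 * (flow_test k (t + h) - flow_test k t)).
  rewrite (@eq_oint _ _ (fun x => h^-1 * ((u (t + h) x - u t x) * k x))); last by move=> x _; rewrite mulrA.
  rewrite ointZ; last exact: H0M (H0B (uH (ltW th)) (uH t0)) Hk.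
  rewrite (oint_mulB (uH (ltW th)) (uH t0) Hk) (u_test (ltW th) ck) (u_test t0 ck).
  by rewrite -mulrN opprB opprK addrC.
have [c ct ->] := mvt_near t (fun z => flow_test_derive z ck) h0.
rewrite -opprD normrN -[X in _ + X]opprK.
apply: (ae_dense_le (a := t - Num.min d1 t) (b := t + Num.min d1 t) (rate_cont ck) (good_ae Hg Hr)).
  move=> s /andP[s1 s2] Gs.
  have m1 : Num.min d1 t <= d1 by rewrite ge_min lexx.
  have m2 : Num.min d1 t <= t by rewrite ge_min lexx orbT.
  have s0 : 0 <= s by lra.
  have {}Gs := Gs s0.
  rewrite opprK -normrN opprD -(rhsT Gs ck) -(oint_mulB (rhsH s0) (rhsH t0) Hk).
  apply: (le_trans (cauchy_schwarz (H0B (rhsH s0) (rhsH t0)) Hk)).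
  rewrite ler_wpM2r ?norm_H0_ge0// D1// ltr_norml; apply/andP; split; lra.
have : `|c - t| < Num.min d1 t by rewrite (lt_trans ct)// lt_min hd.
by rewrite ltr_norml => /andP[? ?]; apply/andP; split; lra.
Qed.

Lemma indef_ae (f1 f2 : R -> R) x : measurable_fun circle f1 -> measurable_fun circle f2 ->
  ae_eq_circle f1 f2 -> circle x -> indef f1 x = indef f2 x.
Proof.
move=> m1 m2 f12 Cx; rewrite (indef_oint f1 Cx) (indef_oint f2 Cx); apply: oint_ae.
- by apply: measurable_funM => //; exact: meas_indic_itv.
- by apply: measurable_funM => //; exact: meas_indic_itv.
- by apply: aeS f12 => z fz Cz; rewrite /= fz.
Qed.

Lemma equation_u t : good t -> eq_u u rho t.
Proof.
move=> Gt; have t0 := good_ge0 Gt; exists (rhs t); split; first exact: u_deriv.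
have [Hw _ wux] := u_wderiv Hg Hr g0 gr4 Hpair Hux t0.
pose e' y := wderiv (u t) y ^+ 2 + rho t y ^+ 2.
have me : measurable_fun circle (ener t).
  by apply: measurable_funD; apply: measurable_funX; [exact: H0_meas (uxH t0)|exact: H0_meas (rhoH t0)].
have me' : measurable_fun circle e'.
  by apply: measurable_funD; apply: measurable_funX; [exact: H0_meas Hw|exact: H0_meas (rhoH t0)].
have ee : ae_eq_circle e' (ener t) by apply: aeS wux => x E Cx; rewrite /e' /ener E.
have E1 : \oint e' = \oint (ener t) by exact: oint_ae.
apply: aeS wux => x E Cx.
have E2 : \int[leb]_(y in `[0, x]) e' y = indef (ener t) x by exact: (indef_ae me' me ee Cx).
rewrite -/e' E2 -[X in x * X]/(\oint e') E1 E// /rhs; ring.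
Qed.

Lemma urho_cont t e : good t -> 0 < e -> exists2 d, 0 < d & forall s, 0 <= s -> `|t - s| < d ->
  norm_H0 (fun x => u s x * rho s x - u t x * rho t x) <= e.
Proof.
move=> Gt e0; have t0 := good_ge0 Gt; have e4 : 0 < e / 4 by rewrite divr_gt0.
have [d1 d10 D1] := strong_cont Hg Hr g0 gr4 Hpair Hux Gt e4.
have [d2 d20 D2] := u_unif_cont Hg Hr g0 gr4 Hpair t0 e4.
exists (Num.min d1 d2); first by rewrite lt_min d10.
move=> s s0; rewrite lt_min => /andP[/(D1 s s0)[N1 N2] T2].
have U y : circle y -> `|u s y - u t y| <= e / 4 by move=> Cy; exact: D2.
have Mu : measurable_fun circle (fun x => u s x - u t x) by apply: measurable_funB; exact: uM.
have HA := H0B (rhoH s0) (rhoH t0).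
have H1 : in_H0 (fun x => u s x * (rho s x - rho t x)).
  by apply: (H0_ext _ (H0Mb HA (uM s0) (fun x => uB s0 (y := x)))) => x _; rewrite mulrC.
have H2 : in_H0 (fun x => (u s x - u t x) * rho t x).
  by apply: (H0_ext _ (H0Mb (rhoH t0) Mu U)) => x _; rewrite mulrC.
rewrite (@eq_norm_H0 _ _ (fun x => u s x * (rho s x - rho t x) + (u s x - u t x) * rho t x)); last first.
  by move=> x _; ring.
have B5 := norm_H0Mb HA (uM s0) (ler0n R 2) (fun x => uB s0 (y := x)).
have B6 := norm_H0Mb (rhoH t0) Mu (ltW e4) U.
apply: (le_trans (norm_H0D H1 H2)); apply: (le_trans (lerD B5 B6)).
rewrite [leRHS](_ : e = 2 * (e / 4) + e / 4 * 2); last by field.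
by apply: lerD; [rewrite ler_wpM2l|rewrite ler_wpM2l ?(ltW e4)// rhoN].
Qed.

(** Here the derivative of the test integral is the pairing of [u * rho] with [psi'] at every
    nonnegative time, so the mean value point can be used directly. The error is at most the L^2
    distance between the fluxes times [norm_H1 psi], uniformly in [psi]. *)
Lemma equation_rho t : good t -> eq_rho u rho t.
Proof.
move=> Gt; have [tp _] := Gt; have t0 := ltW tp.
exists (fun psi => \oint (fun x => (u t x * rho t x) * psi^`()%classic x)); split; last first.
  by move=> psi c; rewrite /distr_deriv subrr.
move=> e e0; have [d1 d10 D1] := urho_cont Gt e0.
exists (Num.min d1 t) => /=; first by rewrite lt_min d10.
move=> h /=; rewrite sub0r normrN lt_min => /andP[hd ht] h0 psi c.
have th : 0 < t + h by move: ht; rewrite ltr_norml => /andP[]; lra.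
have cp := C1_cont c; have [_ _ cd] := c; have Hp := cont_H0 cp; have Hd := cont_H0 cd.
have mp : measurable_fun circle psi by exact: cont_meas.
have md : measurable_fun circle psi^`()%classic by exact: cont_meas.
pose J s := \oint (fun x => r x * psi (Phi s x)).
pose dJ s := \oint (fun x => r x * (psi^`()%classic (Phi s x) * Vel s x)).
have JD s : is_derive s 1 J (dJ s).
  exact: (rho_test_derive Hg Hr g0 gr4 (fun y => C1_derive y c) cd s).
have rJ s : 0 <= s -> \oint (fun x => rho s x * psi x) = J s.
  by move=> s0; exact: (rho_test Hg Hr g0 gr4 Hpair s0 mp).
have Hur s : 0 <= s -> in_H0 (fun x => u s x * rho s x).
  move=> s0; apply: (H0_ext _ (H0Mb (rhoH s0) (uM s0) (fun x => uB s0 (y := x)))).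
  by move=> x _; rewrite mulrC.
have rdJ s : 0 <= s -> \oint (fun x => (u s x * rho s x) * psi^`()%classic x) = dJ s.
  move=> s0; rewrite (@eq_oint _ _ (fun x => rho s x * (u s x * psi^`()%classic x))); last first.
    by move=> x _; ring.
  rewrite (@rho_test _ _ _ Hg Hr g0 gr4 _ _ Hpair s (fun x => u s x * psi^`()%classic x) s0); last first.
    by apply: measurable_funM => //; exact: uM.
  by apply: eq_oint => x Cx; rewrite uP// (mulrC (Vel s x)).
have -> : \oint (fun x => h^-1 * (rho (t + h) x - rho t x) * psi x) = h^-1 * (J (t + h) - J t).
  rewrite (@eq_oint _ _ (fun x => h^-1 * ((rho (t + h) x - rho t x) * psi x))); last by move=> x _; rewrite mulrA.
  rewrite ointZ; last exact: H0M (H0B (rhoH (ltW th)) (rhoH t0)) Hp.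
  by rewrite (oint_mulB (rhoH (ltW th)) (rhoH t0) Hp) (rJ _ (ltW th)) (rJ _ t0).
have [s st ->] := mvt_near t JD h0.
have s0 : 0 <= s.
  have := lt_trans st ht; rewrite ltr_norml => /andP[A _]; apply: ltW; lra.
rewrite -(rdJ _ s0) -(oint_mulB (Hur s s0) (Hur t t0) Hd).
apply: (le_trans (cauchy_schwarz (H0B (Hur s s0) (Hur t t0)) Hd)).
apply: ler_pM; rewrite ?norm_H0_ge0//; first by apply: D1 => //; rewrite distrC (lt_trans st).
rewrite /norm_H1 -{1}(ger0_norm (norm_H0_ge0 psi^`()%classic)) -sqrtr_sqr.
by apply: ler_wsqrtr; rewrite lerDr sqr_ge0.
Qed.

End Equations.

(** * The weak solution *)

Section BochnerMeasurability.
Context {R : realType}.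
Implicit Types (F : R -> R -> R) (s t x e d : R).

(** Sampling [F] at the left endpoints of a grid gives simple functions that converge at every time
    of norm continuity. *)
Lemma strongly_measurable_cont F : (forall t, 0 <= t -> in_H0 (F t)) ->
  {ae leb, forall t, 0 <= t -> forall e, 0 < e -> exists2 d, 0 < d &
    forall s, 0 <= s -> `|t - s| < d -> norm_H0 (fun x => F s x - F t x) <= e} ->
  strongly_measurable_H0 F.
Proof.
move=> HF cF.
(* With cells of length [1 / (n + 1)], the [(n + 1)^2] of them used below cover [[0, n + 1[], which
   contains any given time for large [n]. *)
pose A (n i : nat) : set R := `[i%:R / n.+1%:R, i.+1%:R / n.+1%:R[%classic.
exists (fun n t x => \sum_(i < n.+1 * n.+1) \1_(A n i) t * F (i%:R / n.+1%:R) x); split.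
  move=> n; exists (n.+1 * n.+1)%N, (fun i => A n i), (fun i => F (i%:R / n.+1%:R)); split=> // i.
  by split; [exact: measurable_itv|apply: HF; rewrite divr_ge0].
apply: aeS cF => t cF t0; apply/cvgrPdist_le => e e0.
have [d d0 D] := cF t0 e e0.
near=> n.
have n0 : (0 : R) < n.+1%:R by [].
have tn0 : t < n%:R by near: n; exact: nbhs_infty_gtr.
have tn : t < n.+1%:R by rewrite (lt_trans tn0)// ltr_nat.
have nd : n.+1%:R^-1 < d by near: n; exact: (near_infty_natSinv_lt (PosNum d0)).
pose m := Num.truncn (t * n.+1%:R).
have /andP[m1 m2] : m%:R <= t * n.+1%:R < m.+1%:R by apply: truncn_itv; rewrite mulr_ge0.
have mlt : (m < n.+1 * n.+1)%N.
  by rewrite -(ltr_nat R) natrM (le_lt_trans m1)// ltr_pM2r.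
have Am i : (i < n.+1 * n.+1)%N -> A n i t -> i = m.
  move=> _; rewrite /A /= in_itv/= ler_pdivrMr// ltr_pdivlMr// => /andP[i1 i2].
  have : (i < m.+1)%N by rewrite -(ltr_nat R) (le_lt_trans i1).
  have : (m < i.+1)%N by rewrite -(ltr_nat R) (le_lt_trans m1).
  by rewrite !ltnS => mi im; apply/eqP; rewrite eqn_leq im mi.
have E x : \sum_(i < n.+1 * n.+1) \1_(A n i) t * F (i%:R / n.+1%:R) x = F (m%:R / n.+1%:R) x.
  rewrite (bigD1 (Ordinal mlt))//= big1 ?addr0.
    rewrite indicE mem_set ?mul1r//= /A /= in_itv/= ler_pdivrMr// ltr_pdivlMr// m1//.
  move=> i im; rewrite indicE memNset ?mul0r// => /(Am _ (ltn_ord i)) Em.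
  by move/negP: im; apply; apply/eqP/val_inj.
rewrite sub0r normrN ger0_norm ?norm_H0_ge0//.
rewrite (@eq_norm_H0 _ _ (fun x => F (m%:R / n.+1%:R) x - F t x)); last by move=> x _; rewrite E.
apply: D; first by rewrite divr_ge0.
apply: le_lt_trans nd; rewrite ger0_norm ?subr_ge0 ?ler_pdivrMr//.
rewrite -(ler_pM2r n0) mulrBl mulfVK ?gt_eqF// mulVf ?gt_eqF//.
by rewrite lerBlDl natr1 ltW.
Unshelve. all: by end_near. Qed.

End BochnerMeasurability.

(** * Energy identities, joint continuity and initial data *)

Section Assembly.
Context {R : realType} (g r : R -> R).
Let mC : measurable (@circle R) := measurable_circle.
Hint Resolve mC : core.
Hypotheses (Hg : in_H0 g) (Hr : in_H0 r) (g0 : \oint g = 0).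
Hypothesis gr4 : norm_H0 g ^+ 2 + norm_H0 r ^+ 2 = 4.
Implicit Types (s t x y e : R).
Local Notation wf := (wf g r).
Local Notation vf := (vf g r).
Local Notation Phi := (Phi g r).
Variables (u rho ux : R -> R -> R).
Hypothesis Hpair : flow_pair g r u rho.
Hypothesis Hux : forall t, measurable_fun circle (ux t) /\
  {ae leb, forall x, circle x -> ux t (Phi t x) = vf t x / wf t x}.

Let uxH t : 0 <= t -> in_H0 (ux t) := @ux_H0 _ _ _ Hg Hr g0 gr4 _ _ Hpair _ Hux t.
Let rhoH t : 0 <= t -> in_H0 (rho t) := @rho_H0 _ _ _ Hg Hr g0 gr4 _ _ Hpair _ Hux t.

Lemma wderiv_norm t : 0 <= t -> norm_H0 (wderiv (u t)) = norm_H0 (ux t).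
Proof.
move=> t0; have [Hw _ E] := u_wderiv Hg Hr g0 gr4 Hpair Hux t0.
by apply: norm_H0_ae => //; [exact: H0_meas Hw|exact: H0_meas (uxH t0)].
Qed.

Lemma energy_value t : 0 <= t -> norm_H0 (wderiv (u t)) ^+ 2 + norm_H0 (rho t) ^+ 2 =
  if sin t == 0 then 4
  else 4 - 4 * ((sin t ^+ 2)^-1 * fine (leb
    ([set x | circle x /\ g x = - 2 * (cos t / sin t)] `&` [set x | circle x /\ r x = 0]))).
Proof.
move=> t0; rewrite wderiv_norm// (energy_norm2 Hg Hr g0 gr4 Hpair Hux t0).
have [s0|s0] := eqVneq (sin t) 0.
  by rewrite (good_defect Hg Hr) ?mulr0 ?subr0// vanish_sin0// measure0.
by rewrite vanish_oint// vanishE.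
Qed.

Lemma energy_conserved : {ae leb, forall t : R, 0 <= t ->
  norm_H0 (wderiv (u t)) ^+ 2 + norm_H0 (rho t) ^+ 2 = 4}.
Proof.
apply: aeS (good_ae Hg Hr) => t G t0; rewrite wderiv_norm//.
exact: (good_energy Hg Hr g0 gr4 Hpair Hux (G t0)).
Qed.

(** Continuity in time, uniform in space, combines with the Hoelder bound in space at the fixed time
    [t]. *)
Lemma u_jointly_continuous : {within [set p : R * R | 0 <= p.1 /\ circle p.2],
  continuous (fun p : R * R => u p.1 p.2)}.
Proof.
apply/subspace_continuousP => -[t y] [/= t0 Cy].
suff : (fun p : R * R => u p.1 p.2) p @[p --> within [set p : R * R | 0 <= p.1 /\ circle p.2] (nbhs (t, y))] --> u t y.
  by [].
apply/cvgrPdist_le => e e0.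
have e2 : 0 < e / 2 by rewrite divr_gt0.
have [d1 d10 D1] := u_unif_cont Hg Hr g0 gr4 Hpair t0 e2.
(* Twice the square root of this radius is [e / 2]. *)
have d20 : 0 < (e / 4) ^+ 2 by rewrite exprn_gt0// divr_gt0.
have c1 : \forall p \near (t, y), `|t - p.1| < d1.
  have : (fun p : R * R => p.1) p @[p --> (t, y)] --> t by exact: cvg_fst.
  by move/cvgrPdist_lt; apply.
have c2 : \forall p \near (t, y), `|y - p.2| < (e / 4) ^+ 2.
  have : (fun p : R * R => p.2) p @[p --> (t, y)] --> y by exact: cvg_snd.
  by move/cvgrPdist_lt; apply.
near=> p.
have [s0 Cz] : 0 <= p.1 /\ circle p.2 by near: p; exact: withinT.
have B1 : `|u p.1 p.2 - u t p.2| <= e / 2.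
  by apply: D1 => //; near: p; exact: cvg_within c1.
have B2 : `|u t y - u t p.2| <= e / 2.
  apply: (le_trans (u_holder Hg Hr g0 gr4 Hpair t0 Cy Cz)).
  have : Num.sqrt `|y - p.2| <= Num.sqrt ((e / 4) ^+ 2).
    by apply: ler_wsqrtr; apply: ltW; near: p; exact: cvg_within c2.
  rewrite sqrtr_sqr [`|e / 4|]ger0_norm; last by rewrite divr_ge0// ltW.
  by move=> ?; lra.
rewrite (_ : u t y - u p.1 p.2 = (u t y - u t p.2) - (u p.1 p.2 - u t p.2)); last by ring.
by rewrite (le_trans (ler_normB _ _))// (splitr e) lerD.
Unshelve. all: by end_near. Qed.

(** [strong_cont] concerns [ux]; equality almost everywhere, time by time, carries it to the
    representatives chosen by [wderiv]. *)
Lemma wderiv_Linfty : in_Linfty_H0 (fun t => wderiv (u t)).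
Proof.
have W t : 0 <= t -> in_H0 (wderiv (u t)).
  by move=> t0; have [Hw _ _] := u_wderiv Hg Hr g0 gr4 Hpair Hux t0.
split=> //.
- apply: strongly_measurable_cont => //.
  apply: aeS (good_ae Hg Hr) => t G t0 e e0.
  have [d d0 D] := strong_cont Hg Hr g0 gr4 Hpair Hux (G t0) e0.
  exists d => // s s0 ts; have [D1 _] := D s s0 ts.
  have [Hs _ Es] := u_wderiv Hg Hr g0 gr4 Hpair Hux s0.
  have [Ht _ Et] := u_wderiv Hg Hr g0 gr4 Hpair Hux t0.
  rewrite (@norm_H0_ae _ _ (fun x => ux s x - ux t x))//.
  + exact: H0_meas (H0B Hs Ht).
  + exact: H0_meas (H0B (uxH s0) (uxH t0)).
  + exact: (ae_eq_circle_comp2 (fun a b => a - b) Es Et).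
- exists 2; apply: aeT => t t0; rewrite wderiv_norm//.
  exact: (ux_norm Hg Hr g0 gr4 Hpair Hux).
Qed.

Lemma rho_Linfty : in_Linfty_H0 rho.
Proof.
split; first exact: rhoH.
- apply: strongly_measurable_cont => //.
  apply: aeS (good_ae Hg Hr) => t G t0 e e0.
  have [d d0 D] := strong_cont Hg Hr g0 gr4 Hpair Hux (G t0) e0.
  by exists d => // s s0 ts; have [_ D2] := D s s0 ts.
- exists 2; apply: aeT => t t0; exact: (rho_norm Hg Hr g0 gr4 Hpair Hux).
Qed.

Lemma Phi_time0 x : circle x -> Phi 0 x = x.
Proof.
by move=> Cx; rewrite (PhiE Hg Hr) // /T0 cos0 sin0 expr1n expr0n/= !mulr0 !mul0r mul1r !addr0.
Qed.

Lemma u_time0 x : circle x -> u 0 x = indef g x.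
Proof.
move=> Cx; have [Hu _ _] := Hpair.
rewrite -{1}(Phi_time0 Cx) Hu// (VelE Hg Hr)// /T1 cos0 sin0; ring.
Qed.

Lemma rho_time0 : ae_eq_circle (rho 0) r.
Proof.
have [_ _ H] := Hpair; apply: aeS (H 0 (lexx 0)) => x E Cx.
have := E Cx; rewrite Phi_time0// => ->.
by rewrite w_sum cos0 sin0 mulr0 addr0 expr1n expr0n/= mulr0 addr0 divr1.
Qed.

Lemma flow_pair_weak_solution (u0 : R -> R) : (forall x, circle x -> u0 x = indef g x) ->
  weak_solution u0 r u rho.
Proof.
move=> u0E; split.
- by move=> t t0; exact: (u_H1 Hg Hr g0 gr4 Hpair Hux t0).
- exact: u_jointly_continuous.
- move=> t t0; rewrite (u_at0 Hg Hr g0 gr4 Hpair Hux t0).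
  by rewrite (u_at1 Hg Hr g0 gr4 Hpair Hux t0).
- by move=> x Cx; rewrite u_time0// u0E.
- exact: rho_time0.
- exact: wderiv_Linfty.
- exact: rho_Linfty.
- exact: (ac_u Hg Hr g0 gr4 Hpair Hux).
- apply: aeS (good_ae Hg Hr) => t G t0; exact: (equation_u Hg Hr g0 gr4 Hpair Hux (G t0)).
- apply: aeS (good_ae Hg Hr) => t G t0; exact: (equation_rho Hg Hr g0 gr4 Hpair Hux (G t0)).
Qed.

End Assembly.

Lemma energy_norm_sqr (R : realType) (f1 f2 : R -> R) :
  energy_norm f1 f2 ^+ 2 = 4^-1 * (norm_H0 (wderiv f1) ^+ 2 + norm_H0 f2 ^+ 2).
Proof.
rewrite /energy_norm exprMn sqr_sqrtr ?addr_ge0 ?sqr_ge0//; congr (_ * _).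
by field.
Qed.

Theorem theorem4p2 (R : realType) (u0 rho0 : R -> R)
    (u0_H1 : in_H1 u0) (u0_cont : continuous_circle u0) (rho0_H0 : in_H0 rho0)
    (norm4 : norm_H0 (wderiv u0) ^+ 2 + norm_H0 rho0 ^+ 2 = 4)
    (u00 : u0 0 = 0) :
  (exists u rho : R -> R -> R, defines_pair u0 rho0 u rho) /\
  forall u rho : R -> R -> R, defines_pair u0 rho0 u rho ->
    [/\ weak_solution u0 rho0 u rho,
        forall t : R, 0 <= t ->
          energy_norm (u t) (rho t) ^+ 2 =
          if sin t == 0 then energy_norm u0 rho0 ^+ 2
          else energy_norm u0 rho0 ^+ 2
               - (sin t ^+ 2)^-1 *
                 fine (lebesgue_measure
                   ([set x : R | circle x /\ wderiv u0 x = - 2 * (cos t / sin t)]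
                    `&` [set x : R | circle x /\ rho0 x = 0]))
      & {ae lebesgue_measure, forall t : R, 0 <= t ->
          norm_H0 (wderiv (u t)) ^+ 2 + norm_H0 (rho t) ^+ 2 =
          norm_H0 (wderiv u0) ^+ 2 + norm_H0 rho0 ^+ 2}].
Proof.
have [Hg Wg] := wderivP u0_H1.
have g0 := weak_deriv_mean Wg.
(* Continuity and [u0 0 = 0] give this identity at every point of the circle, not merely almost
   everywhere. *)
have u0E := weak_deriv_indef u0_cont u00 (H0_intc Hg) Wg.
split.
  have [u [rho Hp]] := flow_pair_exists Hg rho0_H0 g0 norm4.
  by exists u, rho; apply/(defines_pairP Hg rho0_H0).
move=> u rho /(defines_pairP Hg rho0_H0) Hp.
have [ux Hux] := ux_exists Hg rho0_H0 g0 norm4.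
split.
- exact: (flow_pair_weak_solution Hg rho0_H0 g0 norm4 Hp Hux u0E).
- move=> t t0; have := energy_norm_sqr (u t) (rho t).
  rewrite (energy_value Hg rho0_H0 g0 norm4 Hp Hux t0) => Et.
  have := energy_norm_sqr u0 rho0; rewrite norm4 mulVf// => E0.
  move: (energy_norm u0 rho0) E0 (energy_norm (u t) (rho t)) Et => a -> b ->.
  case: ifP => _; first by rewrite mulVf.
  by move: (fine _) => m; rewrite mulrBr mulVf// mulKf.
- apply: aeS (energy_conserved Hg rho0_H0 g0 norm4 Hp Hux) => t E t0.
  exact: etrans (E t0) (esym norm4).
Qed.
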